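(* Let $\Omega$ be a domain in $\mathbb{H}$ and let $u:\Omega\to[-\infty,+\infty)$ be upper semicontinuous with $u\not\equiv-\infty$. Then $u$ is strongly subharmonic (respectively, strongly harmonic) if, and only if, for every regular function $f:\Omega'\to\Omega$ (with $\Omega'$ a domain in $\mathbb{H}$) the composition $u\circ f$ is weakly subharmonic (respectively, weakly harmonic).
   Context: $\mathbb{H}$ is the real algebra of quaternions with its Euclidean topology; a domain is a nonempty connected open set. $\mathbb{S}=\{q\in\mathbb{H}:q^2=-1\}$; for $I\in\mathbb{S}$, $L_I=\mathbb{R}+I\mathbb{R}\cong\mathbb{C}$, and for a domain $\Omega$, $\Omega_I=\Omega\cap L_I$. A function $f:\Omega\to\mathbb{H}$ on a domain $\Omega$ is (slice) regular if for every $I\in\mathbb{S}$ the restriction $f_I=f|_{\Omega_I}$ has continuous partial derivatives and $\frac12\left(\frac{\partial}{\partial x}+I\frac{\partial}{\partial y}\right)f_I(x+yI)\equiv0$ on $\Omega_I$. For a domain $\Omega$ let $\mathsf{us}(\Omega)$ be the set of upper semicontinuous functions $v:\Omega\to[-\infty,+\infty)$ with $v\not\equiv-\infty$. A function $v\in\mathsf{us}(\Omega)$ is called weakly subharmonic (resp. weakly harmonic) if for every $I\in\mathbb{S}$ the restriction $v_I=v|_{\Omega_I}$ is subharmonic (resp. harmonic), after the natural identification between $L_I$ and $\mathbb{C}$. A function $v\in\mathsf{us}(\Omega)$ is strongly subharmonic (resp. strongly harmonic) if it is plurisubharmonic (resp. pluriharmonic) with respect to every constant orthogonal complex structure on $\Omega$,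 i.e., for every $I\in\mathbb{S}$, with respect to the structure given by left multiplication $w\mapsto Iw$ on each tangent space $T_q\mathbb{H}\cong\mathbb{H}$ (choosing $J\in\mathbb{S}$, $J\perp I$, this structure is identified with the standard one on $\mathbb{C}^2$ through $q=z_1+z_2J\mapsto(z_1,z_2)\in L_I^2$).
   Formalization: ''u∘f is weakly subharmonic (harmonic)'' means only that each restriction to a slice is subharmonic (identically −∞ allowed) or harmonic; u∘f need not be in us(Ω'), which fails e.g. for u = log|q| and f ≡ 0, or for regular f discontinuous across slices. *)

(* Defs.v *)
From HB Require Import structures.
From mathcomp Require Import all_boot all_order all_algebra.
From mathcomp Require Import all_classical all_reals all_analysis.

Set Implicit Arguments.
Unset Strict Implicit.
Unset Printing Implicit Defensive.

Import Order.TTheory GRing.Theory Num.Theory.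
Import numFieldNormedType.Exports.

Local Open Scope classical_set_scope.
Local Open Scope ring_scope.

(* 'rV[R]_n carries the sup norm, which induces the Euclidean topology.
   All functions below are total; only their values on the given open set
   matter. *)

Notation plane R := 'rV[R]_2.
Notation quat R := 'rV[R]_4.

Definition mkplane (R : realType) (x y : R) : plane R :=
  \row_(k < 2) [:: x; y]`_k.

Definition mkquat (R : realType) (a b c d : R) : quat R :=
  \row_(k < 4) [:: a; b; c; d]`_k.

Definition qone (R : realType) : quat R := mkquat 1 0 0 0.

(* Hamilton product in the basis 1, i, j, k. *)
Definition qmul (R : realType) (p q : quat R) : quat R :=
  let a := p 0 0 in let b := p 0 1 in let c := p 0 2 in let d := p 0 3 in
  let a' := q 0 0 in let b' := q 0 1 in let c' := q 0 2 in let d' := q 0 3 in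
  mkquat (a * a' - b * b' - c * c' - d * d')
         (a * b' + b * a' + c * d' - d * c')
         (a * c' - b * d' + c * a' + d * b')
         (a * d' + b * c' - c * b' + d * a').

Definition imag_units (R : realType) : set (quat R) :=
  [set q | qmul q q = - qone R].

(* The identification of the plane with L_I, (x, y) |-> x + y I. *)
Definition slice (R : realType) (I : quat R) (z : plane R) : quat R :=
  z 0 0 *: qone R + z 0 1 *: I.

Definition domain (T : topologicalType) (D : set T) : Prop :=
  [/\ D !=set0, open D & connected D].

Section EuclideanCalculus.
Context (R : realType) (n : nat).

Definition dirE (i : 'I_n.+1) : 'rV[R]_n.+1 := delta_mx 0 i.

Definition C1_on (W : normedModType R) (D : set 'rV[R]_n.+1)
    (g : 'rV[R]_n.+1 -> W) : Prop :=
  forall (i : 'I_n.+1) z, D z ->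
    derivable g z (dirE i) /\ {for z, continuous (fun w => 'D_(dirE i) g w)}.

Definition C2_on (D : set 'rV[R]_n.+1) (g : 'rV[R]_n.+1 -> R) : Prop :=
  C1_on D g /\ forall i : 'I_n.+1, C1_on D (fun w => 'D_(dirE i) g w).

Definition laplacian (g : 'rV[R]_n.+1 -> R) (z : 'rV[R]_n.+1) : R :=
  \sum_(i < n.+1) 'D_(dirE i) (fun w => 'D_(dirE i) g w) z.

End EuclideanCalculus.

(* Slice regularity; f need not be continuous on Omega (for instance, if Omega
   misses the real axis, the slices are unrelated to one another). *)
Definition regular (R : realType) (Omega : set (quat R))
    (f : quat R -> quat R) : Prop :=
  forall I : quat R, imag_units I ->
    let D := slice I @^-1` Omega in
    let fI := f \o slice I in
    C1_on D fI /\
    forall z, D z ->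
      2^-1 *: ('D_(dirE R 0) fI z + qmul I ('D_(dirE R 1) fI z)) = 0.

(* Upper semicontinuous with values in [-oo, +oo). *)
Definition usc_on (R : realType) (T : topologicalType) (D : set T)
    (v : T -> \bar R) : Prop :=
  (forall x, D x -> (v x < +oo)%E) /\
  forall x, D x -> forall a : R, (v x < a%:E)%E ->
    \forall y \near x, D y -> (v y < a%:E)%E.

Definition us (R : realType) (T : topologicalType) (D : set T)
    (v : T -> \bar R) : Prop :=
  usc_on D v /\ exists2 x, D x & v x <> -oo%E.

Definition circle (R : realType) (c : plane R) (r t : R) : plane R :=
  c + r *: mkplane (cos t) (sin t).

Definition closed_disc (R : realType) (c : plane R) (r : R) : set (plane R) :=
  [set w : plane R | (w 0 0 - c 0 0) ^+ 2 + (w 0 1 - c 0 1) ^+ 2 <= r ^+ 2].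

(* Convention: functions identically -oo (on some component of D) are allowed.
   The integral makes sense in [-oo, +oo) because v is bounded above on
   circles. *)
Definition subharmonic_on (R : realType) (D : set (plane R))
    (v : plane R -> \bar R) : Prop :=
  usc_on D v /\
  forall (c : plane R) (r : R), 0 < r -> closed_disc c r `<=` D ->
    (v c <= ((2 * pi)^-1)%R%:E *
       \int[lebesgue_measure]_(t in `[0%R, (2 * pi)%R])
         v (circle c r t))%E.

Definition harmonic_on (R : realType) (D : set (plane R))
    (v : plane R -> \bar R) : Prop :=
  [/\ forall z, D z -> v z \is a fin_num,
      C2_on D (fine \o v) &
      forall z, D z -> laplacian (fine \o v) z = 0].

(* Parametrization of the complex line a + L_I b for the complex structure
   w |-> I w. *)
Definition cline (R : realType) (I a b : quat R) (z : plane R) : quat R :=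
  a + qmul (slice I z) b.

Definition plurisubharmonic_on (R : realType) (I : quat R)
    (Omega : set (quat R)) (v : quat R -> \bar R) : Prop :=
  usc_on Omega v /\
  forall a b : quat R, subharmonic_on (cline I a b @^-1` Omega) (v \o cline I a b).

Definition pluriharmonic_on (R : realType) (I : quat R)
    (Omega : set (quat R)) (v : quat R -> \bar R) : Prop :=
  [/\ forall q, Omega q -> v q \is a fin_num,
      C2_on Omega (fine \o v) &
      forall a b : quat R, harmonic_on (cline I a b @^-1` Omega) (v \o cline I a b)].

(* The next four notions are meant for functions in us(Omega), but membership
   is not built in: for u in us(Omega) and f regular, u \o f may be identically
   -oo (f constant), and it may fail to be upper semicontinuous across slices
   (f discontinuous). *)
Definition weakly_subharmonic (R : realType) (Omega : set (quat R))
    (v : quat R -> \bar R) : Prop :=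
  forall I : quat R, imag_units I ->
    subharmonic_on (slice I @^-1` Omega) (v \o slice I).

Definition weakly_harmonic (R : realType) (Omega : set (quat R))
    (v : quat R -> \bar R) : Prop :=
  forall I : quat R, imag_units I ->
    harmonic_on (slice I @^-1` Omega) (v \o slice I).

Definition strongly_subharmonic (R : realType) (Omega : set (quat R))
    (v : quat R -> \bar R) : Prop :=
  forall I : quat R, imag_units I -> plurisubharmonic_on I Omega v.

Definition strongly_harmonic (R : realType) (Omega : set (quat R))
    (v : quat R -> \bar R) : Prop :=
  forall I : quat R, imag_units I -> pluriharmonic_on I Omega v.

(* Main.v *)
Require Import Defs.
From mathcomp Require Import all_boot all_order all_algebra.
From mathcomp Require Import all_classical all_reals all_analysis.
From mathcomp Require Import measurable_realfun.
From mathcomp Require Import ring lra.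
Import Order.TTheory GRing.Theory Num.Theory.
Import numFieldNormedType.Exports.

(**
For the converse implications, the restriction of u to a complex line
z |-> a + z b is the composition of u with the regular affine function
q |-> a + q b, restricted to a slice.

In the direct implication for subharmonic functions, a slice f_I of a regular
function is a holomorphic curve for the complex structure I. The function
w_n(z) = sup_x (max(u x, -n) - n^2 |x - f_I z|^2), with x near the image of a
disc, is continuous and decreases to u(f_I z). It satisfies a sub-mean
inequality on small circles up to an error o(s^2), because the complex line
tangent to f_I can be translated to pass through any point x. Averaging over
rotations and applying the maximum principle turns this into the sub-mean
inequality on the whole disc; then let n tend to infinity.

In the harmonic case, v, I v and J v span three real planes that are complex
lines for suitable structures, so the second derivatives of u in all directions
vanish and u is locally affine. What remains is that holomorphic functions of
class C^1 have C^2 harmonic components, which follows from the formula for f'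
in terms of the circular means of f.
*)

Set Implicit Arguments.
Unset Strict Implicit.
Unset Printing Implicit Defensive.
Local Open Scope classical_set_scope.
Local Open Scope ring_scope.

(** * Circular means *)

Section Average.
Context {R : realType}.
Implicit Types (f g : R -> R) (t al : R).
Local Notation mu := (@lebesgue_measure R).

(** The slices of a regular function may be unrelated to one another, so everything happens on one
    slice at a time. Since u is only semicontinuous and may take the value -oo, no chain rule
    applies to it. The classical route smooths u by convolution and transports its Levi form; the
    sup-convolution is used instead because it needs nothing but the sub-mean inequality on lines.
    The truncation at -n keeps it real-valued, and the weight n^2 beats the oscillation of order n
    of the truncated function, so that near-maximizers stay close to f_I z. The error o(s^2) is
    delicate because the remainder E of the first-order expansion of f_I is only o(s). It enters the
    penalty through the scalar product of x - f_I z with E, whose circular mean vanishes by the mean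
    value property, and through |E|^2, which is o(s^2). In the harmonic case regularity is known
    only along each line, so the linearity of directional derivatives has to be proved; it comes
    from affineness along a segment and its midpoint. *)

Definition avg g : R :=
  (2 * pi)^-1 * \int[mu]_(t in `[0, 2 * pi]) g t.

Lemma twopi_gt0 : 0 < 2 * pi :> R.
Proof. by rewrite mulr_gt0// pi_gt0. Qed.

Lemma continuous_integrable g (a b : R) : continuous g ->
  mu.-integrable `[a, b] (EFin \o g).
Proof.
move=> cg; apply: continuous_compact_integrable; first exact: segment_compact.
exact: continuous_subspaceT.
Qed.

Lemma avg_cst c : avg (fun=> c) = c.
Proof.
have p0 := twopi_gt0.
rewrite /avg Rintegral_cst//.
have H : fine (mu `[0, 2 * pi]%classic) = 2 * pi.
  by rewrite lebesgue_measure_itv/= lte_fin p0 -EFinB subr0.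
rewrite -[X in _ * (_ * X)]/(fine (mu `[0, 2 * pi]%classic)) H.
by rewrite mulrCA mulVf ?mulr1// gt_eqF.
Qed.

Lemma avgD f g : continuous f -> continuous g ->
  avg (fun t => f t + g t) = avg f + avg g.
Proof.
by move=> cf cg; rewrite /avg RintegralD ?mulrDr//; exact: continuous_integrable.
Qed.

Lemma avgB f g : continuous f -> continuous g ->
  avg (fun t => f t - g t) = avg f - avg g.
Proof.
by move=> cf cg; rewrite /avg RintegralB ?mulrBr//; exact: continuous_integrable.
Qed.

Lemma avgZ c g : continuous g -> avg (fun t => c * g t) = c * avg g.
Proof.
move=> cg; rewrite /avg RintegralZl; first by rewrite mulrCA.
  exact: measurable_itv.
exact: continuous_integrable.
Qed.

Lemma avg_sum n (h : 'I_n -> R -> R) : (forall i, continuous (h i)) ->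
  continuous (fun t => \sum_i h i t) /\
  avg (fun t => \sum_i h i t) = \sum_i avg (h i).
Proof.
elim: n h => [|n IH] h ch.
  rewrite big_ord0 (_ : (fun=> _) = fun=> 0) ?avg_cst.
    by split=> // x; exact: cvg_cst.
  by apply/funext => t; rewrite big_ord0.
have [c e] := IH (fun i => h (lift ord0 i)) (fun i => ch _).
rewrite (_ : (fun t => _) = fun t => h ord0 t + \sum_i h (lift ord0 i) t).
  split; first by move=> x; apply: cvgD; [exact: ch|exact: c].
  by rewrite avgD// e big_ord_recl.
by apply/funext => t; rewrite big_ord_recl.
Qed.

Lemma ler_avg f g : continuous f -> continuous g ->
  (forall t, f t <= g t) -> avg f <= avg g.
Proof.
move=> cf cg fg; rewrite /avg ler_pM2l ?invr_gt0 ?twopi_gt0//.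
apply: le_Rintegral => [|||t _]; last exact: fg.
- exact: measurable_itv.
- exact: continuous_integrable.
- exact: continuous_integrable.
Qed.

Lemma normr_avg_le g c : continuous g -> (forall t, `|g t| <= c) ->
  `|avg g| <= c.
Proof.
move=> cg gc; have cc (a : R) : continuous (fun _ : R => a) by move=> ?; exact: cvg_cst.
have gc' t : - c <= g t <= c by rewrite -ler_norml.
rewrite ler_norml; apply/andP; split.
  rewrite -[leLHS]avg_cst; apply: ler_avg => [||t]; [exact: cc|exact: cg|].
  by have /andP[] := gc' t.
rewrite -[leRHS]avg_cst; apply: ler_avg => [||t]; [exact: cg|exact: cc|].
by have /andP[] := gc' t.
Qed.

Lemma is_derive_continuous f (df : R -> R) :
  (forall t, is_derive t 1 f (df t)) -> continuous f.
Proof.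
move=> fd t; apply: differentiable_continuous; apply/derivable1_diffP.
by have [] := fd t.
Qed.

(** The derivative is asked only to the right of -1, so that primitives defined by integration from
    a finite base point qualify. *)
Lemma avg_antiderivative_near (G g : R -> R) : continuous g ->
  (forall t : R, -1 < t -> is_derive t 1 G (g t)) ->
  avg g = (G (2 * pi) - G 0) / (2 * pi).
Proof.
move=> cg Gg; have p0 := twopi_gt0.
have cG t : -1 < t -> {for t, continuous G}.
  move=> t1; apply: differentiable_continuous; apply/derivable1_diffP.
  by have [] := Gg t t1.
rewrite /avg mulrC /Rintegral (@continuous_FTC2 _ g G)//.
- exact: continuous_subspaceT.
- split.
  + by move=> x; rewrite in_itv/= => /andP[x0 _]; have [] := Gg x (lt_trans (ltrN10 R) x0).
  + by apply/cvg_at_right_filter/cG.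
  + by apply/cvg_at_left_filter/cG; rewrite (lt_trans (ltrN10 R)).
- move=> x; rewrite in_itv/= => /andP[x0 _]; rewrite derive1E.
  by have [_ ->] := Gg x (lt_trans (ltrN10 R) x0).
Qed.

Lemma avg_antiderivative (G g : R -> R) : continuous g ->
  (forall t, is_derive t 1 G (g t)) -> avg g = (G (2 * pi) - G 0) / (2 * pi).
Proof. by move=> cg Gg; apply: avg_antiderivative_near. Qed.

Lemma cos_Dtwopi al : cos (al + 2 * pi) = cos al.
Proof. by rewrite mulr_natl cosD2pi. Qed.

Lemma sin_Dtwopi al : sin (al + 2 * pi) = sin al.
Proof. by rewrite mulr_natl sinD2pi. Qed.

Lemma is_derive_cosD al t : is_derive t 1 (fun t => cos (al + t)) (- sin (al + t)).
Proof. by apply: is_derive_eq; rewrite add0r [LHS]mulr1. Qed.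

Lemma is_derive_sinD al t : is_derive t 1 (fun t => sin (al + t)) (cos (al + t)).
Proof. by apply: is_derive_eq; rewrite add0r [LHS]mulr1. Qed.

Lemma continuous_cosD al : continuous (fun t => cos (al + t)).
Proof. exact: is_derive_continuous (is_derive_cosD al). Qed.

Lemma continuous_sinD al : continuous (fun t => sin (al + t)).
Proof. exact: is_derive_continuous (is_derive_sinD al). Qed.

Lemma avg_cosD al : avg (fun t => cos (al + t)) = 0.
Proof.
rewrite (avg_antiderivative (@continuous_cosD al) (is_derive_sinD al)).
by rewrite sin_Dtwopi addr0 subrr mul0r.
Qed.

Lemma avg_sinD al : avg (fun t => sin (al + t)) = 0.
Proof.
have dG t : is_derive t 1 (fun t => - cos (al + t)) (sin (al + t)).
  by have := is_derive_cosD al t => /is_deriveN; rewrite opprK.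
rewrite (avg_antiderivative (@continuous_sinD al) dG).
by rewrite cos_Dtwopi addr0 subrr mul0r.
Qed.

(** Differentiation under the integral sign, with the constant C as dominating function on the
    bounded interval. *)
Lemma is_derive_avg (F dF : R -> R -> R) (x0 d C : R) : 0 < d ->
  (forall x t, `|x - x0| < d -> is_derive x 1 (F^~ t) (dF x t)) ->
  (forall x t, `|x - x0| < d -> `|dF x t| <= C) ->
  (forall x, `|x - x0| < d -> continuous (F x)) -> continuous (dF x0) ->
  is_derive x0 1 (fun x => avg (F x)) (avg (dF x0)).
Proof.
move=> d0 FdF dFC cF cdF.
have C0 : 0 <= C.
  by apply: le_trans (dFC x0 0 _); rewrite ?normr_ge0// subrr normr0.
have Ix0 : `]x0 - d, x0 + d[%classic x0 by rewrite /= in_itv/= ltrBlDr ltrDl d0.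
have I x : `]x0 - d, x0 + d[%classic x -> `|x - x0| < d.
  by rewrite /= in_itv/= ltr_norml -ltrBlDl -ltrBDr; move=> /andP[]; lra.
have i1 x : `]x0 - d, x0 + d[%classic x ->
    mu.-integrable `[0, 2 * pi] (EFin \o F x).
  by move=> /I xd; apply/continuous_integrable/cF.
have i2 x t : `]x0 - d, x0 + d[%classic x -> `[0, 2 * pi]%classic t ->
    derivable (F^~ t) x 1.
  by move=> /I xd _; have [] := FdF x t xd.
have i3 : mu.-integrable `[0, 2 * pi] (EFin \o (fun _ : R => C)).
  by apply: continuous_integrable => ?; exact: cvg_cst.
have i4 x t : `]x0 - d, x0 + d[%classic x -> `[0, 2 * pi]%classic t ->
    `|derive1 (F^~ t) x| <= C.
  move=> /I xd _; rewrite derive1E.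
  by have [_ ->] := FdF x t xd; exact: dFC.
have m : measurable (`[0, 2 * pi]%classic : set R) by exact: measurable_itv.
have D := @derivable_under_integral _ _ _ mu F _ m _ _ _ Ix0 i1 i2 _ (fun=> C0) i3 i4.
have E := @differentiation_under_integral _ _ _ mu F _ m _ _ _ Ix0 i1 i2 _ (fun=> C0) i3 i4.
have /is_deriveZ := derivableP D => /(_ (2 * pi)^-1) H.
apply: is_derive_eq H _; rewrite -derive1E E /avg /GRing.scale/=; congr (_ * _).
apply: eq_Rintegral => t _; rewrite /partial1of2 derive1E.
by have [_ ->] := FdF x0 t (I _ Ix0).
Qed.

End Average.

(** * Continuously differentiable functions on the plane *)

Section LineDerivative.
Context {R : realType} {V W : normedModType R}.

Lemma growth_rate_line (g : V -> W) a v (s : R) :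
  (fun h : R => h^-1 *: (((fun s => g (a + s *: v)) \o shift s) (h *: 1) - g (a + s *: v))) =
  (fun h => h^-1 *: ((g \o shift (a + s *: v)) (h *: v) - g (a + s *: v))).
Proof.
apply/funext => h /=; congr (_ *: (g _ - _)).
by rewrite [h%:A]mulr1 scalerDl addrCA.
Qed.

Lemma is_derive_line (g : V -> W) a v (s : R) :
  derivable g (a + s *: v) v ->
  is_derive s 1 (fun s => g (a + s *: v)) ('D_v g (a + s *: v)).
Proof.
move=> dg; split; first by rewrite /derivable growth_rate_line.
by rewrite /derive growth_rate_line.
Qed.

End LineDerivative.

Lemma normr_coord_le {R : realType} {m n} (x : 'M[R]_(m.+1, n.+1)) i j : `|x i j| <= `|x|.
Proof.
rewrite [leRHS]/Num.norm/= mx_normrE.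
by apply: le_trans; last exact: (le_bigmax _ _ (i, j)).
Qed.

Lemma row_norm_le {R : realType} {n} (x : 'rV[R]_n.+1) (e : R) : 0 <= e ->
  (forall j, `|x 0 j| <= e) -> `|x| <= e.
Proof.
move=> e0 xe; rewrite [leLHS]/Num.norm/= mx_normrE; apply: bigmax_le => // -[i j] _.
by rewrite ord1.
Qed.

Section SmallSlope.
Context {R : realType}.

Lemma slope_le (f df : R -> R) (C : R) :
  (forall s : R, 0 <= s <= 1 -> is_derive s 1 f (df s)) ->
  (forall s, 0 <= s <= 1 -> `|df s| <= C) -> `|f 1 - f 0| <= C.
Proof.
move=> fd dC.
have cf : {within `[0, 1], continuous f}.
  apply: derivable_within_continuous => x; rewrite in_itv/= => x01.
  by have [] := fd x x01.
have fd' (x : R) : x \in `]0, 1[ -> is_derive x 1 f (df x).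
  by rewrite in_itv/= => /andP[/ltW x0 /ltW x1]; apply: fd; rewrite x0.
have [c] := MVT ltr01 fd' cf.
rewrite in_itv/= => /andP[/ltW c0 /ltW c1] ->; rewrite subr0 mulr1.
by apply: dC; rewrite c0.
Qed.

End SmallSlope.

Section Plane.
Context {R : realType}.
Implicit Types (z w c : plane R) (g : plane R -> R).

Lemma planeE z : z = mkplane (z 0 0) (z 0 1).
Proof.
by apply/rowP => -[[|[|//]]] i; rewrite mxE/=; congr (z 0 _); apply: val_inj.
Qed.

Lemma mkplane0 (x y : R) : mkplane x y 0 0 = x.
Proof. by rewrite mxE. Qed.

Lemma mkplane1 (x y : R) : mkplane x y 0 1 = y.
Proof. by rewrite mxE. Qed.

Lemma dirE0 (s : R) z : z + s *: dirE R 0 = mkplane (z 0 0 + s) (z 0 1).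
Proof.
apply/rowP => -[[|[|//]]] i; rewrite !mxE/= ?mulr1 ?mulr0 ?addr0;
  by congr (z 0 _ + _) || congr (z 0 _); apply: val_inj.
Qed.

Lemma dirE1 (s : R) z : z + s *: dirE R 1 = mkplane (z 0 0) (z 0 1 + s).
Proof.
apply/rowP => -[[|[|//]]] i; rewrite !mxE/= ?mulr1 ?mulr0 ?addr0;
  by congr (z 0 _ + _) || congr (z 0 _); apply: val_inj.
Qed.

Lemma plane_norm_lt z (e : R) : (`|z| < e) = (`|z 0 0| < e) && (`|z 0 1| < e).
Proof.
apply/idP/andP => [ze|[z0 z1]].
  by split; apply: le_lt_trans ze; exact: normr_coord_le.
rewrite [ltLHS]/Num.norm/= mx_normrE; apply: bigmax_lt => [|[i j] _/=].
  exact: le_lt_trans z0.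
rewrite ord1; case: j => -[|[|//]] j.
  by rewrite (_ : Ordinal j = 0)//; apply: val_inj.
by rewrite (_ : Ordinal j = 1)//; apply: val_inj.
Qed.

(** A ball of the sup norm is a square with sides parallel to the axes: the path from z to w through
    the corner [m] stays inside, and the mean value inequality applies to each of its two sides. *)
Lemma partials_lipschitz g c (rho C : R) :
  (forall i z, `|z - c| < rho -> derivable g z (dirE R i) /\ `|'D_(dirE R i) g z| <= C) ->
  forall z w, `|z - c| < rho -> `|w - c| < rho ->
  `|g w - g z| <= C * (`|w 0 0 - z 0 0| + `|w 0 1 - z 0 1|).
Proof.
move=> gC z w zc wc.
have step i (x : plane R) (h : R) :
    (forall s : R, 0 <= s <= 1 -> `|(x + (s * h) *: dirE R i) - c| < rho) ->
    `|g (x + h *: dirE R i) - g x| <= C * `|h|.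
  move=> xc.
  have := @slope_le R (fun s => g (x + (s * h) *: dirE R i))
    (fun s => 'D_(dirE R i) g (x + (s * h) *: dirE R i) * h) (C * `|h|).
  rewrite mul1r mul0r scale0r addr0; apply.
    move=> s s01.
    have [d _] := gC i _ (xc s s01).
    have H := is_derive_line d.
    have K : is_derive s 1 (fun s : R => s * h) h.
      by apply: is_derive_eq; rewrite scaler0 add0r [LHS]mulr1.
    exact: (@is_derive1_comp R (fun s => g (x + s *: dirE R i)) (fun s => s * h) s _ _ H K).
  move=> s s01; rewrite normrM ler_wpM2r//.
  by have [] := gC i _ (xc s s01).
have conv (a b s : R) : 0 <= s <= 1 -> `|a| < rho -> `|b| < rho ->
    `|a + s * (b - a)| < rho.
  move=> /andP[s0 s1]; rewrite !ltr_norml => /andP[a1 a2] /andP[b1 b2].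
  by apply/andP; split; have [ab|/ltW ab] := leP a b; nra.
move: zc wc; rewrite !plane_norm_lt !mxE => /andP[z0 z1] /andP[w0 w1].
pose m : plane R := mkplane (w 0 0) (z 0 1).
have e1 : m = z + (w 0 0 - z 0 0) *: dirE R 0.
  by rewrite dirE0 addrC subrK.
have e2 : w = m + (w 0 1 - z 0 1) *: dirE R 1.
  by rewrite dirE1 mkplane0 mkplane1 addrC subrK -planeE.
have s1 : `|g m - g z| <= C * `|w 0 0 - z 0 0|.
  rewrite e1; apply: step => s s01.
  rewrite dirE0 plane_norm_lt !mxE/= z1 andbT.
  rewrite (_ : _ - _ = z 0 0 - c 0 0 + s * ((w 0 0 - c 0 0) - (z 0 0 - c 0 0))); last by ring.
  exact: conv.
have s2 : `|g w - g m| <= C * `|w 0 1 - z 0 1|.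
  rewrite {1}e2; apply: step => s s01.
  rewrite dirE1 plane_norm_lt !mxE/= w0/=.
  rewrite (_ : _ - _ = z 0 1 - c 0 1 + s * ((w 0 1 - c 0 1) - (z 0 1 - c 0 1))); last by ring.
  exact: conv.
have -> : g w - g z = (g m - g z) + (g w - g m) by ring.
by rewrite mulrDr (le_trans (ler_normD _ _))// lerD.
Qed.

End Plane.

Lemma near_dist_lt {R : realType} {V : normedModType R} (z : V) (e : R) :
  0 < e -> \forall w \near z, `|w - z| < e.
Proof. by move=> e0; apply/nbhs_normP; exists e => // w; rewrite /= distrC. Qed.

Section C1Plane.
Context {R : realType}.
Implicit Types (z w c : plane R) (g : plane R -> R) (D : set (plane R)).

Lemma C1_local_approx D g z (e : R) : open D -> C1_on D g -> D z -> 0 < e ->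
  exists2 rho : R, 0 < rho & forall w, `|w - z| < rho ->
    D w /\ forall i, derivable g w (dirE R i) /\
      `|'D_(dirE R i) g w - 'D_(dirE R i) g z| <= e.
Proof.
move=> oD gC Dz e0.
have H i : \forall w \near z, `|'D_(dirE R i) g w - 'D_(dirE R i) g z| <= e.
  have [_ cg] := gC i z Dz.
  exact: (cvgr_distC_le _ _ cg).
have : \forall w \near z, D w /\ forall i, `|'D_(dirE R i) g w - 'D_(dirE R i) g z| <= e.
  near=> w; split; first by near: w; exact: open_nbhs_nbhs.
  by near: w; apply: filter_forall => i; exact: H.
move/nbhs_normP => -[rho /= rho0 Hrho]; exists rho => // w wz.
have [|Dw Hw] := Hrho w; first by rewrite /= distrC.
split=> // i; split; last exact: Hw.
by have [] := gC i w Dw.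
Unshelve. all: by end_near. Qed.

Lemma is_derive_coord n (z v : 'rV[R]_n.+1) j : is_derive z v (fun w : 'rV[R]_n.+1 => w 0 j) (v 0 j).
Proof.
have d : derivable (id : 'rV[R]_n.+1 -> 'rV[R]_n.+1) z v by exact: derivable_id.
split; first by have := (derivable_mxP _ _ _).1 d 0 j.
by have := derive_mx d => /rowP/(_ j); rewrite derive_id mxE.
Qed.

(** Subtracting the linear part [L] leaves a function whose partials are at most e near z, hence one
    that is Lipschitz there with constant e. *)
Lemma C1_expand D g z (e : R) : open D -> C1_on D g -> D z -> 0 < e ->
  \forall w \near z,
    `|g w - g z - ('D_(dirE R 0) g z * (w 0 0 - z 0 0) +
                   'D_(dirE R 1) g z * (w 0 1 - z 0 1))|
    <= e * (`|w 0 0 - z 0 0| + `|w 0 1 - z 0 1|).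
Proof.
move=> oD gC Dz e0.
have [rho rho0 H] := C1_local_approx oD gC Dz e0.
set a := 'D_(dirE R 0) g z; set b := 'D_(dirE R 1) g z.
pose L w : R := a * w 0 0 + b * w 0 1.
have dL w i : is_derive w (dirE R i) L ('D_(dirE R i) g z).
  have := is_deriveD (is_deriveZ a (is_derive_coord w (dirE R i) 0))
                     (is_deriveZ b (is_derive_coord w (dirE R i) 1)).
  rewrite (_ : _ + _ = 'D_(dirE R i) g z)//.
  rewrite /GRing.scale/= !mxE/=; case: i => -[|[|//]] i /=; rewrite mulr1 mulr0.
    by rewrite addr0 (_ : Ordinal i = 0)//; exact: val_inj.
  by rewrite add0r (_ : Ordinal i = 1)//; exact: val_inj.
have K : forall i w, `|w - z| < rho -> derivable (g - L) w (dirE R i) /\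
    `|'D_(dirE R i) (g - L) w| <= e.
  move=> i w /H[_ /(_ i)[dg be]].
  have := is_deriveB (derivableP dg) (dL w i) => -[dB ->].
  by split.
apply/nbhs_normP; exists rho => // w; rewrite /= distrC => wz.
have zz : `|z - z| < rho by rewrite subrr normr0.
have := partials_lipschitz K zz wz.
rewrite (_ : (g - L) w - (g - L) z = g w - g z - (a * (w 0 0 - z 0 0) + b * (w 0 1 - z 0 1)))//.
by rewrite !fctE /L; ring.
Qed.

Lemma C1_continuous D g z : open D -> C1_on D g -> D z -> {for z, continuous g}.
Proof.
move=> oD gC Dz.
have [rho rho0 H] := C1_local_approx oD gC Dz ltr01.
pose C := `|'D_(dirE R 0) g z| + `|'D_(dirE R 1) g z| + 1.
have K : forall i w, `|w - z| < rho -> derivable g w (dirE R i) /\ `|'D_(dirE R i) g w| <= C.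
  move=> i w /H[_ /(_ i)[dg be]]; split => //.
  have : `|'D_(dirE R i) g w| <= `|'D_(dirE R i) g z| + 1.
    by rewrite -lerBlDl (le_trans _ be)// lerB_dist.
  move/le_trans; apply; rewrite /C lerD2r; case: i {dg be} => -[|[|//]] i.
    by rewrite (_ : Ordinal i = 0) ?lerDl//; exact: val_inj.
  by rewrite (_ : Ordinal i = 1) ?lerDr//; exact: val_inj.
have C0 : 0 < C by rewrite /C ltr_wpDl// addr_ge0.
apply: (@cvgrPdist_le _ _ _ (nbhs z) _ g (g z)).2 => e e0.
near=> w.
have wz : `|w - z| < rho by near: w; exact: (@near_dist_lt R (plane R) z).
have zz : `|z - z| < rho by rewrite subrr normr0.
have := partials_lipschitz K zz wz; rewrite distrC => /le_trans; apply.
rewrite -ler_pdivlMl// [leRHS](splitr) lerD//.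
  rewrite (_ : w 0 0 - z 0 0 = (w - z) 0 0); last by rewrite !mxE.
  rewrite (le_trans (normr_coord_le _ _ _))// ltW//; near: w.
  by apply: (@near_dist_lt R (plane R) z); rewrite divr_gt0// mulr_gt0// invr_gt0.
rewrite (_ : w 0 1 - z 0 1 = (w - z) 0 1); last by rewrite !mxE.
rewrite (le_trans (normr_coord_le _ _ _))// ltW//; near: w.
by apply: (@near_dist_lt R (plane R) z); rewrite divr_gt0// mulr_gt0// invr_gt0.
Unshelve. all: by end_near. Qed.

Lemma mkplane_cvg (x y : R -> R) (s : R) :
  {for s, continuous x} -> {for s, continuous y} ->
  {for s, continuous (fun t => mkplane (x t) (y t))}.
Proof.
move=> cx cy; apply/cvgrPdist_lt => e e0; near=> t.
rewrite plane_norm_lt !mxE/=; apply/andP; split; near: t.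
  exact: (cvgr_dist_lt _ _ cx).
exact: cvgr_dist_lt cy _ e0.
Unshelve. all: by end_near. Qed.

(** Once the linear part is removed, the remainder [psi] must have derivative 0. Its increments are
    at most e' times those of x and y, whose difference quotients are eventually bounded by |x'| + 1
    and |y'| + 1; this dictates [e']. *)
Lemma is_derive_curve D g (x y : R -> R) (s x' y' : R) :
  open D -> C1_on D g -> D (mkplane (x s) (y s)) ->
  is_derive s 1 x x' -> is_derive s 1 y y' ->
  is_derive s 1 (fun t => g (mkplane (x t) (y t)))
    ('D_(dirE R 0) g (mkplane (x s) (y s)) * x' +
     'D_(dirE R 1) g (mkplane (x s) (y s)) * y').
Proof.
move=> oD gC Dz dx dy.
set z := mkplane (x s) (y s); set a := 'D_(dirE R 0) g z; set b := 'D_(dirE R 1) g z.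
pose psi t := g (mkplane (x t) (y t)) - (a * x t + b * y t).
have cx : {for s, continuous x}.
  by apply: differentiable_continuous; apply/derivable1_diffP; have [] := dx.
have cy : {for s, continuous y}.
  by apply: differentiable_continuous; apply/derivable1_diffP; have [] := dy.
suff dpsi : is_derive s 1 psi 0.
  rewrite (_ : (fun t => _) = psi + ((a *: x) + (b *: y))).
    rewrite (_ : a * x' + b * y' = 0 + (a *: x' + b *: y')); last by rewrite add0r.
    exact: (is_deriveD dpsi (is_deriveD (is_deriveZ a dx) (is_deriveZ b dy))).
  by apply/funext => t; rewrite !fctE /psi /GRing.scale/= subrK.
suff H : (fun h : R => h^-1 *: ((psi \o shift s) (h *: 1) - psi s)) @ 0^' --> (0 : R).
  by split; [apply/cvg_ex; exists 0|rewrite /derive; apply/cvg_lim].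
have dq (f : R -> R) (f' : R) : is_derive s 1 f f' ->
    \forall h \near (0 : R)^', `|h^-1 * (f (h + s) - f s)| <= `|f'| + 1.
  move=> [df dE].
  have := @cvgr_norm_le _ _ _ _ _ _ _ df (`|f'| + 1).
  rewrite -/(derive f s 1) dE ltrDl ltr01 => /(_ _ isT).
  by apply: filterS => h; rewrite /= /GRing.scale/= mulr1.
apply/cvgr0Pnorm_le => e e0.
pose e' := e / (`|x'| + 1 + (`|y'| + 1)).
have k0 : 0 < `|x'| + 1 + (`|y'| + 1) by rewrite addr_gt0// ltr_wpDl.
have e'0 : 0 < e' by rewrite divr_gt0.
have E := C1_expand oD gC Dz e'0.
have E2 : \forall h \near (0 : R)^',
    `|g (mkplane (x (h + s)) (y (h + s))) - g z - (a * (x (h + s) - x s) + b * (y (h + s) - y s))|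
    <= e' * (`|x (h + s) - x s| + `|y (h + s) - y s|).
  have c : (fun h : R => mkplane (x (h + s)) (y (h + s))) @ (0 : R)^' --> z.
    apply: cvg_within_filter.
    have := @mkplane_cvg x y s cx cy.
    rewrite /prop_for /continuous_at => C.
    apply: (@cvg_comp _ _ _ (fun h : R => h + s) (fun t => mkplane (x t) (y t)) _ (nbhs s)) C.
    have : (fun h : R => h + s) @ 0 --> 0 + s by apply: cvgD; [exact: cvg_id|exact: cvg_cst].
    by rewrite add0r.
  have := c _ E; rewrite /nbhs/=; apply: filterS => h.
  by rewrite /= /z !mkplane0 !mkplane1.
near=> h.
have h0 : h != 0 by near: h; exact: nbhs_dnbhs_neq.
have E2h : `|g (mkplane (x (h + s)) (y (h + s))) - g z - (a * (x (h + s) - x s) + b * (y (h + s) - y s))|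
    <= e' * (`|x (h + s) - x s| + `|y (h + s) - y s|) by near: h; exact: E2.
have X : `|h^-1 * (x (h + s) - x s)| <= `|x'| + 1 by near: h; exact: dq.
have Y : `|h^-1 * (y (h + s) - y s)| <= `|y'| + 1 by near: h; exact: dq.
rewrite /= /GRing.scale/= mulr1 normrM.
rewrite (_ : psi (h + s) - psi s = g (mkplane (x (h + s)) (y (h + s))) - g z - (a * (x (h + s) - x s) + b * (y (h + s) - y s))); last first.
  by rewrite /psi -/z; ring.
rewrite (le_trans (ler_wpM2l _ E2h))//.
rewrite mulrCA mulrDr -!normrM.
have eE : e = e' * (`|x'| + 1 + (`|y'| + 1)) by rewrite divfK// gt_eqF.
by rewrite [leRHS]eE ler_pM2l// lerD.
Unshelve. all: by end_near. Qed.

Lemma circleE c (r t : R) :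
  circle c r t = mkplane (c 0 0 + r * cos t) (c 0 1 + r * sin t).
Proof.
by apply/rowP => -[[|[|//]] i]; rewrite !mxE/=; congr (c 0 _ + _); apply: val_inj.
Qed.

Lemma circle0 c (r t : R) : circle c r t 0 0 = c 0 0 + r * cos t.
Proof. by rewrite circleE mkplane0. Qed.

Lemma circle1 c (r t : R) : circle c r t 0 1 = c 0 1 + r * sin t.
Proof. by rewrite circleE mkplane1. Qed.

Lemma cos_norm_le (t : R) : `|cos t| <= 1.
Proof. by rewrite ler_norml cos_geN1 cos_le1. Qed.

Lemma sin_norm_le (t : R) : `|sin t| <= 1.
Proof. by rewrite ler_norml sin_geN1 sin_le1. Qed.

Lemma circle_norm c (r t : R) : `|circle c r t - c| <= `|r|.
Proof.
rewrite /circle addrAC subrr add0r normrZ ler_piMr//.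
apply: row_norm_le => // -[[|[|//]]] j; rewrite mxE/=.
  exact: cos_norm_le.
exact: sin_norm_le.
Qed.

Lemma is_derive_circle_radius D g c (r t : R) : open D -> C1_on D g ->
  D (circle c r t) ->
  is_derive r 1 (fun r => g (circle c r t))
    ('D_(dirE R 0) g (circle c r t) * cos t + 'D_(dirE R 1) g (circle c r t) * sin t).
Proof.
move=> oD gC; rewrite circleE => Dz.
rewrite (_ : (fun r => _) = fun r => g (mkplane (c 0 0 + r * cos t) (c 0 1 + r * sin t))).
  apply: (@is_derive_curve D g (fun r => c 0 0 + r * cos t) (fun r => c 0 1 + r * sin t) r _ _ oD gC Dz).
    by apply: is_derive_eq; rewrite scaler0 !add0r [LHS]mul1r [LHS]mulr1.
  by apply: is_derive_eq; rewrite scaler0 !add0r [LHS]mul1r [LHS]mulr1.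
by apply/funext => r'; rewrite circleE.
Qed.

Lemma is_derive_circle_angle D g c (r al t : R) : open D -> C1_on D g ->
  D (circle c r (al + t)) ->
  is_derive t 1 (fun t => g (circle c r (al + t)))
    (r * ('D_(dirE R 1) g (circle c r (al + t)) * cos (al + t) -
          'D_(dirE R 0) g (circle c r (al + t)) * sin (al + t))).
Proof.
move=> oD gC; rewrite circleE => Dz.
rewrite (_ : (fun t => _) = fun t => g (mkplane (c 0 0 + r * cos (al + t)) (c 0 1 + r * sin (al + t)))).
  set z := mkplane _ _.
  rewrite (_ : r * _ = 'D_(dirE R 0) g z * (r * - sin (al + t)) + 'D_(dirE R 1) g z * (r * cos (al + t))); last by ring.
  apply: (@is_derive_curve D g (fun t => c 0 0 + r * cos (al + t)) (fun t => c 0 1 + r * sin (al + t)) t _ _ oD gC Dz).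
    have := is_deriveD (is_derive_cst (c 0 0) t (1 : R)) (is_deriveZ r (is_derive_cosD al t)).
    by rewrite add0r.
  have := is_deriveD (is_derive_cst (c 0 1) t (1 : R)) (is_deriveZ r (is_derive_sinD al t)).
  by rewrite add0r.
by apply/funext => r'; rewrite circleE.
Qed.

End C1Plane.

(** * Cauchy-Riemann pairs *)

Section CauchyRiemann.
Context {R : realType}.
Implicit Types (z w c : plane R) (u v g : plane R -> R) (D : set (plane R)).
Local Notation d i g := ('D_(dirE R i) g).

(** The function u + i v is holomorphic, in the C^1 sense. *)
Definition cauchy_riemann D u v :=
  [/\ C1_on D u, C1_on D v,
      forall z, D z -> d 0 u z = d 1 v z &
      forall z, D z -> d 1 u z = - d 0 v z].

Definition partials_bounded D g c (rho C : R) :=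
  forall w, `|w - c| < rho -> D w /\ forall i, `|d i g w| <= C.

Lemma C1_partials_bounded D g z : open D -> C1_on D g -> D z ->
  exists rho C, 0 < rho /\ partials_bounded D g z rho C.
Proof.
move=> oD gC Dz; have [rho rho0 H] := C1_local_approx oD gC Dz ltr01.
exists rho, (`|d 0 g z| + `|d 1 g z| + 1); split=> // w /H[Dw {}H].
split=> // i; have [_ be] := H i.
have : `|d i g w| <= `|d i g z| + 1.
  by rewrite -lerBlDl (le_trans _ be)// lerB_dist.
move/le_trans; apply; rewrite lerD2r; case: i {be} => -[|[|//]] i.
  by rewrite (_ : Ordinal i = 0) ?lerDl//; exact: val_inj.
by rewrite (_ : Ordinal i = 1) ?lerDr//; exact: val_inj.
Qed.

Lemma near_eq_continuous {T U : topologicalType} (f h : T -> U) (a : T) :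
  (\forall b \near a, f b = h b) -> {for a, continuous h} -> {for a, continuous f}.
Proof.
move=> fh ch; have e := nbhs_singleton fh.
rewrite /prop_for /continuous_at e; apply: cvg_trans ch.
by apply: near_eq_cvg; apply: filterS fh => w.
Qed.

Lemma C1_on_is_derive n (D : set 'rV[R]_n.+1) (g : 'rV[R]_n.+1 -> R) (dg : 'I_n.+1 -> 'rV[R]_n.+1 -> R) : open D ->
  (forall i (a : 'rV[R]_n.+1), D a -> is_derive a (dirE R i) g (dg i a)) ->
  (forall i (a : 'rV[R]_n.+1), D a -> {for a, continuous (dg i)}) -> C1_on D g.
Proof.
move=> oD gd cd i z Dz; split; first by have [] := gd i z Dz.
apply: near_eq_continuous (cd i z Dz).
have : \forall w \near z, D w by exact: open_nbhs_nbhs.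
by apply: filterS => w Dw; have [] := gd i w Dw.
Qed.

Lemma C1_onN D g : open D -> C1_on D g -> C1_on D (- g).
Proof.
move=> oD gC; apply: (@C1_on_is_derive 1 D (- g) (fun i => - d i g) oD).
  move=> i z Dz; have [dg _] := gC i z Dz.
  exact: (is_deriveN (derivableP dg)).
by move=> i z Dz; have [_ cg] := gC i z Dz; exact: (continuousN cg).
Qed.

(** This is multiplication of u + i v by -i. It lets every statement about the first component of a
    pair serve for the second. *)
Lemma cauchy_riemann_rot D u v : open D -> cauchy_riemann D u v -> cauchy_riemann D v (- u).
Proof.
move=> oD [uC vC e0 e1].
have dN i z : D z -> d i (- u) z = - d i u z.
  by move=> Dz; apply: deriveN; have [] := uC i z Dz.
split; [exact: vC|exact: C1_onN|move=> z Dz|move=> z Dz].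
- by rewrite dN// e1// opprK.
- by rewrite dN// e0// opprK.
Qed.

Lemma continuous_circle c (r al : R) : continuous (fun t => circle c r (al + t)).
Proof.
rewrite (_ : (fun t => _) = fun t => mkplane (c 0 0 + r * cos (al + t)) (c 0 1 + r * sin (al + t))); last first.
  by apply/funext => t; rewrite circleE.
move=> t; apply: (@mkplane_cvg R (fun t => c 0 0 + r * cos (al + t)) (fun t => c 0 1 + r * sin (al + t))).
  apply: cvgD; first exact: cvg_cst.
  by apply: cvgM; [exact: cvg_cst|exact: continuous_cosD].
apply: cvgD; first exact: cvg_cst.
by apply: cvgM; [exact: cvg_cst|exact: continuous_sinD].
Qed.

Lemma continuous_circle_comp g c (r al : R) :
  (forall t, {for circle c r (al + t), continuous g}) ->
  continuous (fun t => g (circle c r (al + t))).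
Proof.
move=> cg t; apply: (@continuous_comp _ _ _ (fun t => circle c r (al + t)) g).
  exact: continuous_circle.
exact: cg.
Qed.

Lemma continuous_mul (f h : R -> R) : continuous f -> continuous h ->
  continuous (fun t => f t * h t).
Proof. by move=> cf ch t; apply: cvgM; [exact: cf|exact: ch]. Qed.

Lemma continuous_add (f h : R -> R) : continuous f -> continuous h ->
  continuous (fun t => f t + h t).
Proof. by move=> cf ch t; apply: cvgD; [exact: cf|exact: ch]. Qed.

Lemma circle_Dtwopi c (r t : R) : circle c r (t + 2 * pi) = circle c r t.
Proof. by rewrite !circleE cos_Dtwopi sin_Dtwopi. Qed.

Lemma zero_derive_const (f : R -> R) :
  (forall s : R, 0 <= s <= 1 -> is_derive s 1 f 0) -> f 1 = f 0.
Proof.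
move=> fd; apply/eqP; rewrite -subr_eq0 -normr_le0.
by apply: (slope_le fd) => s _; rewrite normr0.
Qed.

Section Ball.
Variables (D : set (plane R)) (u v : plane R -> R) (c : plane R) (rho C : R).
Hypotheses (oD : open D) (uv : cauchy_riemann D u v)
  (ub : partials_bounded D u c rho C).
Let uC : C1_on D u. Proof. by case: uv. Qed.
Let vC : C1_on D v. Proof. by case: uv. Qed.

Lemma circle_in (r t : R) : `|r| < rho -> D (circle c r t).
Proof. by move=> /(le_lt_trans (circle_norm c r t)) /ub[]. Qed.

Lemma C1_continuous_circle g (r al : R) : C1_on D g -> `|r| < rho ->
  continuous (fun t => g (circle c r (al + t))) /\
  forall i, continuous (fun t => d i g (circle c r (al + t))).
Proof.
move=> gC rr; split=> [|i].
  apply: (@continuous_circle_comp g) => t.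
  exact: (C1_continuous oD gC (circle_in (al + t) rr)).
apply: (@continuous_circle_comp (d i g)) => t.
by have [_ cg] := gC i _ (circle_in (al + t) rr).
Qed.

Lemma partials_bounded_rot : partials_bounded D v c rho C.
Proof.
have [_ _ e0 e1] := uv.
move=> w /ub[Dw uw]; split=> // -[[|[|//]] i].
  by rewrite (_ : Ordinal i = 0) -1?normrN -?e1//; exact: val_inj.
by rewrite (_ : Ordinal i = 1) -?e0//; exact: val_inj.
Qed.

Lemma radial_bound (x y t : R) : `|x| <= C -> `|y| <= C ->
  `|x * cos t + y * sin t| <= C + C.
Proof.
move=> xC yC; rewrite (le_trans (ler_normD _ _))// lerD// normrM.
  by rewrite (le_trans _ xC)// ler_piMr// cos_norm_le.
by rewrite (le_trans _ yC)// ler_piMr// sin_norm_le.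
Qed.

(* The derivative of the circular mean of u in the radius is, by the
   Cauchy-Riemann equations, the mean of an angular derivative of v. *)
Lemma avg_circle (r al : R) : `|r| < rho ->
  avg (fun t => u (circle c r (al + t))) = u c.
Proof.
move=> rr.
pose M r := avg (fun t => u (circle c r (al + t))).
have M0 : M 0 = u c.
  rewrite /M (_ : (fun t => _) = fun=> u c) ?avg_cst//.
  by apply/funext => t; rewrite /circle scale0r addr0.
suff dM (x : R) : `|x| < rho -> is_derive x 1 M 0.
  rewrite -M0 -/(M r) -[in RHS](mul0r r) -[in LHS](mul1r r).
  apply: (@zero_derive_const (fun s => M (s * r))) => s /andP[s0 s1].
  have sr : `|s * r| < rho.
    by rewrite normrM (le_lt_trans _ rr)// ler_piMl// ger0_norm.
  have K : is_derive s 1 (fun s : R => s * r) r.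
    by apply: is_derive_eq; rewrite scaler0 add0r [LHS]mulr1.
  by have := @is_derive1_comp R M (fun s => s * r) s _ _ (dM _ sr) K; rewrite mul0r.
move=> xr.
pose dF r t := d 0 u (circle c r (al + t)) * cos (al + t) + d 1 u (circle c r (al + t)) * sin (al + t).
have cdF y : `|y| < rho -> continuous (dF y).
  move=> /(C1_continuous_circle al uC)[_ cu].
  by apply: continuous_add; apply: continuous_mul;
    [exact: cu|exact: continuous_cosD|exact: cu|exact: continuous_sinD].
have near_r y : `|y - x| < rho - `|x| -> `|y| < rho.
  rewrite ltrBrDr => /(le_lt_trans _); apply.
  by rewrite (le_trans _ (ler_normD _ _))// subrK.
have := @is_derive_avg R (fun r t => u (circle c r (al + t))) dF x (rho - `|x|) (C + C).
rewrite subr_gt0 => /(_ xr) H.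
suff <- : avg (dF x) = 0.
  apply: H => //.
  - move=> y t /near_r yr; apply: (is_derive_circle_radius oD uC); exact: circle_in.
  - move=> y t /near_r yr.
    have [_ b] := ub (le_lt_trans (circle_norm c y (al + t)) yr).
    by apply: radial_bound; exact: b.
  - by move=> y /near_r/(C1_continuous_circle al uC)[].
  - exact: cdF.
(* The angular derivative carries a factor x and says nothing at radius 0; there the integrand is a
   combination of cos and sin with constant coefficients. *)
have [x0|x0] := eqVneq x 0.
  rewrite (_ : dF x = fun t => d 0 u c * cos (al + t) + d 1 u c * sin (al + t)).
    rewrite avgD ?avgZ ?avg_cosD ?avg_sinD ?mulr0 ?addr0//.
    - exact: continuous_sinD.
    - exact: continuous_cosD.
    - by apply: continuous_mul; [move=> ?; exact: cvg_cst|exact: continuous_cosD].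
    - by apply: continuous_mul; [move=> ?; exact: cvg_cst|exact: continuous_sinD].
  by apply/funext => t; rewrite /dF x0 /circle scale0r addr0.
apply: (mulfI x0); rewrite mulr0 -avgZ; last exact: cdF.
have dG (t : R) : is_derive t 1 (fun t => v (circle c x (al + t))) (x * dF x t).
  have [_ _ e0 e1] := uv; have Dz := circle_in (al + t) xr.
  have := is_derive_circle_angle oD vC Dz.
  by rewrite -e0// -[X in _ - X * _]opprK -e1// mulNr opprK.
have cx : continuous (fun t => x * dF x t).
  by apply: continuous_mul; [move=> ?; exact: cvg_cst|exact: cdF].
by rewrite (avg_antiderivative cx dG) circle_Dtwopi addr0 subrr mul0r.
Qed.

End Ball.
End CauchyRiemann.

(** * Cauchy's formula for the derivative of a holomorphic function *)

Section SecondDerivatives.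
Context {R : realType}.
Implicit Types (z w c : plane R) (u v g : plane R -> R) (D : set (plane R)).
Local Notation d i g := ('D_(dirE R i) g).

Lemma is_derive_of_line {V W : normedModType R} (g : V -> W) (a v : V) (l : W) :
  is_derive (0 : R) 1 (fun h : R => g (a + h *: v)) l -> is_derive a v g l.
Proof.
have e : (fun h : R => h^-1 *: ((g \o shift a) (h *: v) - g a)) =
    (fun h : R => h^-1 *: (((fun h : R => g (a + h *: v)) \o shift 0) (h *: 1) -
      (fun h : R => g (a + h *: v)) 0)).
  apply/funext => h /=; congr (_ *: (g _ - g _)).
    by rewrite addr0 [h%:A]mulr1 addrC.
  by rewrite scale0r addr0.
by move=> [dg gl]; split; [rewrite /derivable e|rewrite /derive e].
Qed.

Lemma dirE_norm i : `|dirE R i : plane R| <= 1.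
Proof. by apply: row_norm_le => // j; rewrite !mxE/=; case: eqP => _; rewrite ?normr1// normr0. Qed.

Lemma partials_bounded_sub D g c c' (rho C : R) : partials_bounded D g c rho C ->
  `|c' - c| < rho / 2 -> partials_bounded D g c' (rho / 2) C.
Proof.
move=> H cc w wc; apply: H.
rewrite (splitr rho) (_ : w - c = (w - c') + (c' - c)); last by rewrite addrA subrK.
by rewrite (le_lt_trans (ler_normD _ _))// ltrD.
Qed.

Lemma circle_shift c (r t h : R) i :
  circle (c + h *: dirE R i) r t = circle c r t + h *: dirE R i.
Proof. by rewrite /circle addrAC. Qed.

Lemma shift_norm_lt c (h e : R) i : `|h| < e -> `|c + h *: dirE R i - c| < e.
Proof.
rewrite addrAC subrr add0r normrZ; apply: le_lt_trans.
by rewrite ler_piMr// dirE_norm.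
Qed.

Lemma near0_norm_lt (x h : R) : `|h - 0| < x -> `|h| < x.
Proof. by rewrite subr0. Qed.

Section Ball.
Variables (D : set (plane R)) (u v : plane R -> R) (c : plane R) (rho C : R).
Hypotheses (oD : open D) (uv : cauchy_riemann D u v)
  (ub : partials_bounded D u c rho C).
Let uC : C1_on D u. Proof. by case: uv. Qed.
Let vC : C1_on D v. Proof. by case: uv. Qed.

Lemma is_derive_shift_circle g (r al x : R) i : C1_on D g -> `|r| < rho / 2 ->
  `|x| < rho / 2 ->
  forall t, is_derive x 1 (fun h : R => g (circle (c + h *: dirE R i) r (al + t)))
    (d i g (circle (c + x *: dirE R i) r (al + t))).
Proof.
move=> gC rr xr t.
rewrite (_ : (fun h => _) = fun h : R => g (circle c r (al + t) + h *: dirE R i)).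
  rewrite circle_shift; apply: is_derive_line.
  have ub' := partials_bounded_sub ub (shift_norm_lt c i xr).
  have [|dg _] := gC i (circle c r (al + t) + x *: dirE R i); last exact: dg.
  by rewrite -circle_shift; exact: (circle_in ub').
by apply/funext => h; rewrite circle_shift.
Qed.

Lemma half_gt0 (r : R) : `|r| < rho / 2 -> 0 < rho / 2.
Proof. exact: le_lt_trans. Qed.

(** Moving the centre in the mean value property of u and differentiating under the integral: the
    partials inherit the property before they are known to be differentiable. *)
Lemma avg_partial_circle i (r al : R) : `|r| < rho / 2 ->
  avg (fun t => d i u (circle c r (al + t))) = d i u c.
Proof.
move=> rr; have rho0 := half_gt0 rr.
have sub h : `|h| < rho / 2 -> partials_bounded D u (c + h *: dirE R i) (rho / 2) C.
  by move=> hr; exact: (partials_bounded_sub ub (shift_norm_lt c i hr)).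
have H := @is_derive_avg R (fun h t => u (circle (c + h *: dirE R i) r (al + t)))
  (fun h t => d i u (circle (c + h *: dirE R i) r (al + t))) 0 (rho / 2) C rho0.
have {H} : is_derive (0 : R) 1 (fun h : R => u (c + h *: dirE R i))
    (avg (fun t => d i u (circle (c + 0 *: dirE R i) r (al + t)))).
  apply: near_eq_is_derive (H _ _ _ _).
  - have : \forall h \near (0 : R), `|h - 0| < rho / 2 by exact: near_dist_lt.
    apply: filterS => h; rewrite subr0 => hr.
    exact: (avg_circle oD uv (sub _ hr)).
  - by move=> h t /near0_norm_lt hr; exact: is_derive_shift_circle.
  - move=> h t /near0_norm_lt hr.
    by have [_] := sub _ hr _ (le_lt_trans (circle_norm _ _ (al + t)) rr); apply.
  - by move=> h /near0_norm_lt/sub ub'; have [] := C1_continuous_circle oD ub' al uC rr.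
  - have ub' : partials_bounded D u (c + 0 *: dirE R i) (rho / 2) C.
      by apply: sub; rewrite normr0.
    by have [_] := C1_continuous_circle oD ub' al uC rr; apply.
by rewrite scale0r addr0 => /is_derive_of_line[_ ->].
Qed.

(** With f = u + i v, this is the real part of Cauchy's formula: r f'(c) is the mean of exp(-i t)
    f(c + r exp(i t)). By the Cauchy-Riemann equations the radial derivative of the integrand is the
    first partial of u, whose mean is constant in the radius, and the mean of the integrand vanishes
    at radius 0. *)
Lemma first_mode (r al : R) : `|r| < rho / 2 ->
  avg (fun t => cos (al + t) * u (circle c r (al + t)) +
                sin (al + t) * v (circle c r (al + t))) = r * d 0 u c.
Proof.
move=> rr; have rho0 := half_gt0 rr.
have lt_rho (x : R) : `|x| < rho / 2 -> `|x| < rho.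
  by move/lt_le_trans; apply; rewrite ler_pdivrMr// ler_peMr ?ler1n//; lra.
pose E r t := cos (al + t) * u (circle c r (al + t)) + sin (al + t) * v (circle c r (al + t)).
have [_ _ e0 e1] := uv.
have vb := partials_bounded_rot uv ub.
have dE (x : R) : `|x| < rho / 2 -> is_derive x 1 (fun r => avg (E r)) (d 0 u c).
  move=> xr; rewrite -(avg_partial_circle 0 al xr).
  have near_r y : `|y - x| < rho / 2 - `|x| -> `|y| < rho / 2.
    rewrite ltrBrDr => /(le_lt_trans _); apply.
    by rewrite (le_trans _ (ler_normD _ _))// subrK.
  apply: (@is_derive_avg R E (fun r t => d 0 u (circle c r (al + t))) x (rho / 2 - `|x|) C).
  - by rewrite subr_gt0.
  - move=> y t /near_r/lt_rho yr; have Dz := circle_in ub (al + t) yr.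
    have H := is_deriveD (is_deriveZ (cos (al + t)) (is_derive_circle_radius oD uC Dz))
      (is_deriveZ (sin (al + t)) (is_derive_circle_radius oD vC Dz)).
    apply: is_derive_eq H _.
    rewrite (e1 _ Dz) -(e0 _ Dz) /GRing.scale/=.
    have := cos2Dsin2 (al + t); rewrite !expr2 => cs.
    by rewrite -[RHS]mulr1 -cs; ring.
  - move=> y t /near_r/lt_rho yr.
    by have [_] := ub (le_lt_trans (circle_norm _ _ (al + t)) yr); apply.
  - move=> y /near_r/lt_rho yr.
    have [cu _] := C1_continuous_circle oD ub al uC yr.
    have [cv _] := C1_continuous_circle oD vb al vC yr.
    by apply: continuous_add; apply: continuous_mul => //;
      [exact: continuous_cosD|exact: continuous_sinD].
  - by have [_] := C1_continuous_circle oD ub al uC (lt_rho _ xr); apply.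
have E0 : avg (E 0) = 0.
  rewrite /E /circle (_ : (fun t => _) = fun t => u c * cos (al + t) + v c * sin (al + t)).
    rewrite avgD ?avgZ ?avg_cosD ?avg_sinD ?mulr0 ?addr0//.
    - exact: continuous_sinD.
    - exact: continuous_cosD.
    - by apply: continuous_mul; [move=> ?; exact: cvg_cst|exact: continuous_cosD].
    - by apply: continuous_mul; [move=> ?; exact: cvg_cst|exact: continuous_sinD].
  by apply/funext => t; rewrite !scale0r !addr0 mulrC [X in _ + X]mulrC.
have := @zero_derive_const R (fun s => avg (E (s * r)) - s * (r * d 0 u c)).
rewrite !mul1r !mul0r E0 !subr0 => H; apply/eqP; rewrite -subr_eq0; apply/eqP.
apply: H => s /andP[s0 s1].
have sr : `|s * r| < rho / 2.
  by rewrite normrM (le_lt_trans _ rr)// ler_piMl// ger0_norm.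
have K (k : R) : is_derive s 1 (fun s : R => s * k) k.
  by apply: is_derive_eq; rewrite scaler0 add0r [LHS]mulr1.
have := @is_derive1_comp R (fun r => avg (E r)) (fun s => s * r) s _ _ (dE _ sr) (K r).
move=> /is_deriveB/(_ (K (r * d 0 u c))).
by rewrite [d 0 u c * r]mulrC subrr.
Qed.

End Ball.

(** Dividing [first_mode] by r writes the first partial of u as a mean over a circle of fixed
    radius. Its dependence on the centre is differentiable, and the derivative involves only first
    partials of u and v. *)
Lemma is_derive_partial0 D u v z (rho C r : R) c i : open D ->
  cauchy_riemann D u v -> partials_bounded D u z rho C ->
  0 < r -> r < rho / 2 / 2 -> `|c - z| < rho / 2 ->
  is_derive c (dirE R i) (d 0 u)
    (r^-1 * avg (fun t => cos (0 + t) * d i u (circle c r (0 + t)) +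
                          sin (0 + t) * d i v (circle c r (0 + t)))).
Proof.
move=> oD uv ub r0 rr cz.
have [uC vC _ _] := uv.
have vb := partials_bounded_rot uv ub.
pose e := rho / 2 - `|c - z|.
have e0 : 0 < e by rewrite subr_gt0.
have nr : `|r| = r by rewrite gtr0_norm.
pose e' := Num.min e (rho / 2 / 2).
have e'0 : 0 < e' by rewrite lt_min e0 (lt_trans r0 rr).
have sub h : `|h| < e' -> `|c + h *: dirE R i - z| < rho / 2.
  rewrite lt_min => /andP[he _].
  rewrite addrAC (le_lt_trans (ler_normD _ _))//.
  rewrite -ltrBrDl (le_lt_trans _ he)//.
  by rewrite normrZ ler_piMr// dirE_norm.
have nr2 : `|r| < rho / 2 by rewrite nr (lt_trans rr)// ltr_pdivrMr//; lra.
have ubh h : `|h| < e' -> partials_bounded D u (c + h *: dirE R i) (rho / 2) C.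
  by move=> /sub; exact: partials_bounded_sub.
have vbh h : `|h| < e' -> partials_bounded D v (c + h *: dirE R i) (rho / 2) C.
  by move=> /sub; exact: partials_bounded_sub.
pose F h t := cos (0 + t) * u (circle (c + h *: dirE R i) r (0 + t)) +
  sin (0 + t) * v (circle (c + h *: dirE R i) r (0 + t)).
pose dF h t := cos (0 + t) * d i u (circle (c + h *: dirE R i) r (0 + t)) +
  sin (0 + t) * d i v (circle (c + h *: dirE R i) r (0 + t)).
have cdF h : `|h| < e' -> continuous (dF h).
  move=> he; have [_ cu] := C1_continuous_circle oD (ubh _ he) 0 uC nr2.
  have [_ cv] := C1_continuous_circle oD (vbh _ he) 0 vC nr2.
  by apply: continuous_add; apply: continuous_mul;
    [exact: continuous_cosD|exact: cu|exact: continuous_sinD|exact: cv].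
have H : is_derive (0 : R) 1 (fun h => avg (F h)) (avg (dF 0)).
  apply: (@is_derive_avg R F dF 0 e' (C + C)) => //.
  - move=> h t /near0_norm_lt he.
    have hr : `|h| < rho / 2 / 2 by move: he; rewrite lt_min => /andP[].
    have ubc : partials_bounded D u c (rho / 2) C by exact: (partials_bounded_sub ub cz).
    have nr3 : `|r| < rho / 2 / 2 by rewrite nr.
    exact: (is_deriveD (is_deriveZ (cos (0 + t)) (is_derive_shift_circle ubc 0 i uC nr3 hr t))
      (is_deriveZ (sin (0 + t)) (is_derive_shift_circle ubc 0 i vC nr3 hr t))).
  - move=> h t /near0_norm_lt he; rewrite /dF mulrC [sin _ * _]mulrC.
    apply: radial_bound.
      by have [_] := ubh _ he _ (le_lt_trans (circle_norm _ _ (0 + t)) nr2); apply.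
    by have [_] := vbh _ he _ (le_lt_trans (circle_norm _ _ (0 + t)) nr2); apply.
  - move=> h /near0_norm_lt he.
    have [cu _] := C1_continuous_circle oD (ubh _ he) 0 uC nr2.
    have [cv _] := C1_continuous_circle oD (vbh _ he) 0 vC nr2.
    by apply: continuous_add; apply: continuous_mul;
      [exact: continuous_cosD|exact: cu|exact: continuous_sinD|exact: cv].
  - by apply: cdF; rewrite normr0.
have {H} := is_deriveZ r^-1 H.
rewrite [dF 0](_ : _ = fun t => cos (0 + t) * d i u (circle c r (0 + t)) +
                          sin (0 + t) * d i v (circle c r (0 + t))); last first.
  by apply/funext => t; rewrite /dF scale0r addr0.
move=> H; apply: is_derive_of_line; apply: near_eq_is_derive H.
have : \forall h \near (0 : R), `|h - 0| < e' by exact: near_dist_lt.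
apply: filterS => h; rewrite subr0 => he.
rewrite -[LHS]/(r^-1 * avg (F h)) /F (first_mode oD uv (ubh _ he)) ?nr//.
by rewrite mulrA mulVf ?mul1r// gt_eqF.
Qed.

End SecondDerivatives.

(** * Second-order regularity and harmonicity of holomorphic components *)

Section CauchyRiemannC2.
Context {R : realType}.
Implicit Types (z w c : plane R) (u v g : plane R -> R) (D : set (plane R)).
Local Notation d i g := ('D_(dirE R i) g).

Lemma ord2_cases (i : 'I_2) : i = 0 \/ i = 1.
Proof. by case: i => -[|[|//]] i; [left|right]; exact: val_inj. Qed.

Lemma open_near {T : topologicalType} (D : set T) a : open D -> D a -> \forall b \near a, D b.
Proof. by move=> oD Da; exact: open_nbhs_nbhs. Qed.

Lemma C1_on_eq n (D : set 'rV[R]_n.+1) (f h : 'rV[R]_n.+1 -> R) : open D ->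
  (forall a, D a -> f a = h a) -> C1_on D h -> C1_on D f.
Proof.
move=> oD fh hC i a Da.
have near_eq b : D b -> \forall x \near b, h x = f x.
  move=> Db; have : \forall x \near b, D x by exact: open_nbhs_nbhs.
  by apply: filterS => x /fh ->.
have [dh ch] := hC i a Da; split.
  exact: near_eq_derivable (near_eq _ Da) dh.
apply: near_eq_continuous ch.
have : \forall x \near a, D x by exact: open_nbhs_nbhs.
by apply: filterS => x Dx; apply/esym/near_eq_derive; exact: near_eq.
Qed.

Section Local.
Variables (D : set (plane R)) (u v : plane R -> R) (z : plane R) (rho C r : R).
Hypotheses (oD : open D) (uv : cauchy_riemann D u v)
  (ub : partials_bounded D u z rho C) (r0 : 0 < r) (rr : r < rho / 2 / 2).

Let r_half : `|r| < rho / 2.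
Proof. by rewrite gtr0_norm// (lt_trans rr)// ltr_pdivrMr//; move: r0 rr; lra. Qed.

(** The formula of [is_derive_partial0] bounds the second derivatives by (C + C) / r. *)
Lemma partial0_lipschitz c c' : `|c - z| < rho / 2 -> `|c' - z| < rho / 2 ->
  `|d 0 u c' - d 0 u c| <= r^-1 * (C + C) * (`|c' 0 0 - c 0 0| + `|c' 0 1 - c 0 1|).
Proof.
have [uC vC _ _] := uv.
move=> cz c'z; apply: (@partials_lipschitz R (d 0 u) z (rho / 2) _ _ c c' cz c'z) => i w wz.
have [dd ->] := is_derive_partial0 i oD uv ub r0 rr wz; split; first exact: dd.
have ubw := partials_bounded_sub ub wz.
have vbw := partials_bounded_sub (partials_bounded_rot uv ub) wz.
have ri : 0 < r^-1 by rewrite invr_gt0.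
rewrite normrM (gtr0_norm ri) ler_pM2l//.
have [_ cu] := C1_continuous_circle oD ubw 0 uC r_half.
have [_ cv] := C1_continuous_circle oD vbw 0 vC r_half.
apply: normr_avg_le => [|t].
  by apply: continuous_add; apply: continuous_mul;
    [exact: continuous_cosD|exact: cu|exact: continuous_sinD|exact: cv].
rewrite mulrC [sin _ * _]mulrC; apply: radial_bound.
  by have [_] := ubw _ (le_lt_trans (circle_norm _ _ (0 + t)) r_half); apply.
by have [_] := vbw _ (le_lt_trans (circle_norm _ _ (0 + t)) r_half); apply.
Qed.

End Local.

(** When the centre moves, Lipschitz p and q change by an amount that is small uniformly in t, and
    so does the mean. Applied to partials of u and v, this gives the continuity of the second
    derivatives. *)
Lemma continuous_avg_circle (p q : plane R -> R) z (rho K r : R) :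
  0 < r -> r < rho / 2 ->
  (forall c c', `|c - z| < rho -> `|c' - z| < rho ->
     `|p c' - p c| <= K * (`|c' 0 0 - c 0 0| + `|c' 0 1 - c 0 1|)) ->
  (forall c c', `|c - z| < rho -> `|c' - z| < rho ->
     `|q c' - q c| <= K * (`|c' 0 0 - c 0 0| + `|c' 0 1 - c 0 1|)) ->
  (forall c, `|c - z| < rho / 2 -> continuous (fun t => p (circle c r (0 + t))) /\
    continuous (fun t => q (circle c r (0 + t)))) ->
  {for z, continuous (fun c => avg (fun t => cos (0 + t) * p (circle c r (0 + t)) +
                          sin (0 + t) * q (circle c r (0 + t))))}.
Proof.
move=> r0 rr pK qK pqc.
have rho0 : 0 < rho / 2 by exact: lt_trans rr.
set Q := fun c => avg _.
pose F c t := cos (0 + t) * p (circle c r (0 + t)) + sin (0 + t) * q (circle c r (0 + t)).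
have cF c : `|c - z| < rho / 2 -> continuous (F c).
  by move=> /pqc[cp cq]; apply: continuous_add; apply: continuous_mul => //;
    [exact: continuous_cosD|exact: continuous_sinD].
have zz : `|z - z| < rho / 2 by rewrite subrr normr0.
pose K' := `|K| + 1.
have K'0 : 0 < K' by rewrite ltr_wpDl.
apply: (@cvgrPdist_le _ _ _ (nbhs z) _ Q (Q z)).2 => e e0.
near=> c.
have cz : `|c - z| < rho / 2 by near: c; exact: (@near_dist_lt R (plane R) z).
have cze : `|c - z| < e / 4 / K'.
  by near: c; apply: (@near_dist_lt R (plane R) z); rewrite !divr_gt0.
rewrite -avgB; [|exact: cF|exact: cF].
apply: normr_avg_le => [|t].
  by move=> t; apply: cvgB; exact: cF.
have in_ball a : `|a - z| < rho / 2 -> `|circle a r (0 + t) - z| < rho.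
  move=> az; rewrite (_ : _ - z = (circle a r (0 + t) - a) + (a - z)); last by rewrite addrA subrK.
  rewrite (le_lt_trans (ler_normD _ _))// (splitr rho) ltrD//.
  by rewrite (le_lt_trans (circle_norm _ _ _))// gtr0_norm.
have lip (g : plane R -> R) :
    (forall c c', `|c - z| < rho -> `|c' - z| < rho ->
     `|g c' - g c| <= K * (`|c' 0 0 - c 0 0| + `|c' 0 1 - c 0 1|)) ->
    `|g (circle z r (0 + t)) - g (circle c r (0 + t))| <= e / 2.
  move=> gK; rewrite (le_trans (gK _ _ (in_ball _ cz) (in_ball _ zz)))//.
  have cancel (a b k : R) : a + k - (b + k) = a - b by ring.
  rewrite !circle0 !circle1 !cancel.
  have b j : `|z 0 j - c 0 j| <= e / 4 / K'.
    rewrite (_ : z 0 j - c 0 j = - (c - z) 0 j); last by rewrite !mxE opprB.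
    by rewrite normrN (le_trans (normr_coord_le _ _ _))// ltW.
  rewrite (@le_trans _ _ (K' * (e / 4 / K' + e / 4 / K')))//.
    rewrite (@le_trans _ _ (K' * (`|z 0 0 - c 0 0| + `|z 0 1 - c 0 1|)))//.
      by rewrite ler_wpM2r ?addr_ge0// /K' (le_trans (ler_norm K))// lerDl.
    by rewrite ler_pM2l// lerD.
  by rewrite -mulrDl mulrCA mulfV ?gt_eqF// mulr1; lra.
rewrite (_ : _ - _ = cos (0 + t) * (p (circle z r (0 + t)) - p (circle c r (0 + t))) +
   sin (0 + t) * (q (circle z r (0 + t)) - q (circle c r (0 + t)))); last by ring.
rewrite (le_trans (ler_normD _ _))// (splitr e) lerD// normrM.
  by rewrite (le_trans _ (lip _ pK))// ler_piMl// cos_norm_le.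
by rewrite (le_trans _ (lip _ qK))// ler_piMl// sin_norm_le.
Unshelve. all: by end_near. Qed.

Lemma partials_opp D g z i : C1_on D g -> D z -> d i (- g) z = - d i g z.
Proof. by move=> gC Dz; apply: deriveN; have [] := gC i z Dz. Qed.

Lemma cauchy_riemann_partial0_C1 D u v : open D -> cauchy_riemann D u v ->
  C1_on D (d 0 u).
Proof.
move=> oD uv i z Dz.
have [uC vC e0 e1] := uv.
have [rho [C [rho0 ub]]] := C1_partials_bounded oD uC Dz.
have vb := partials_bounded_rot uv ub.
pose r := rho / 8.
have r0 : 0 < r by rewrite divr_gt0.
have rr : r < rho / 2 / 2 by rewrite /r; move: rho0; lra.
have rr' : `|r| < rho / 2 by rewrite gtr0_norm// /r; move: rho0; lra.
have zz : `|z - z| < rho / 2 by rewrite subrr normr0 divr_gt0.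
split; first by have [] := is_derive_partial0 i oD uv ub r0 rr zz.
pose Q c := avg (fun t => cos (0 + t) * d i u (circle c r (0 + t)) +
                          sin (0 + t) * d i v (circle c r (0 + t))).
have cQ : {for z, continuous Q}.
  have in_half c : `|c - z| < rho / 2 -> D c.
    by move=> cz; have [] := ub c; rewrite // (lt_trans cz)//; move: rho0; lra.
  have lu := partial0_lipschitz oD uv ub r0 rr.
  have lv := partial0_lipschitz oD (cauchy_riemann_rot oD uv) vb r0 rr.
  apply: (@continuous_avg_circle _ _ z (rho / 2) (r^-1 * (C + C)) r r0 rr).
  - move=> c c' cz c'z; have [->|->] := ord2_cases i; first exact: lu.
    rewrite !e1; [|exact: in_half|exact: in_half].
    by rewrite -opprD normrN; exact: lv.
  - move=> c c' cz c'z; have [->|->] := ord2_cases i; first exact: lv.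
    by rewrite -!e0; [exact: lu|exact: in_half|exact: in_half].
  - move=> c cz; have cz' : `|c - z| < rho / 2 by rewrite (lt_trans cz)//; move: rho0; lra.
    have [_ cu] := C1_continuous_circle oD (partials_bounded_sub ub cz') 0 uC rr'.
    have [_ cv] := C1_continuous_circle oD (partials_bounded_sub vb cz') 0 vC rr'.
    by split.
apply: (@near_eq_continuous _ _ _ (fun c => r^-1 * Q c)).
  have : \forall c \near z, `|c - z| < rho / 2 by apply: (@near_dist_lt R (plane R) z); rewrite divr_gt0.
  by apply: filterS => c cz; have [_ ->] := is_derive_partial0 i oD uv ub r0 rr cz.
exact: (continuousM (@cst_continuous _ _ r^-1 z) cQ).
Qed.

(** The second partial of u is minus the first partial of v, and v is the first component of the
    rotated pair. *)
Lemma cauchy_riemann_C2 D u v : open D -> cauchy_riemann D u v -> C2_on D u.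
Proof.
move=> oD uv; have [uC vC e0 e1] := uv; split=> [|i]; first exact: uC.
have [->|->] := ord2_cases i; first exact: cauchy_riemann_partial0_C1 uv.
apply: (@C1_on_eq 1 D _ (- d 0 v) oD e1); apply: (C1_onN oD).
exact: (cauchy_riemann_partial0_C1 oD (cauchy_riemann_rot oD uv)).
Qed.

(** Symmetry of mixed partials is not invoked: the second derivative of u in x and the y-derivative
    of the x-partial of v are circular means of the same integrand, by the Cauchy-Riemann
    equations. *)
Lemma cauchy_riemann_laplacian D u v z : open D -> cauchy_riemann D u v -> D z ->
  laplacian u z = 0.
Proof.
move=> oD uv Dz; have [uC vC e0 e1] := uv.
have vu := cauchy_riemann_rot oD uv.
have [rho [C [rho0 ub]]] := C1_partials_bounded oD uC Dz.
have vb := partials_bounded_rot uv ub.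
pose r := rho / 8.
have r0 : 0 < r by rewrite divr_gt0.
have rr : r < rho / 2 / 2 by rewrite /r; move: rho0; lra.
have zz : `|z - z| < rho / 2 by rewrite subrr normr0 divr_gt0.
have rr' : `|r| < rho by rewrite gtr0_norm// /r; move: rho0; lra.
have E : avg (fun t => cos (0 + t) * d 0 u (circle z r (0 + t)) +
                          sin (0 + t) * d 0 v (circle z r (0 + t))) =
         avg (fun t => cos (0 + t) * d 1 v (circle z r (0 + t)) +
                          sin (0 + t) * d 1 (- u) (circle z r (0 + t))).
  congr avg; apply/funext => t; have Dw := circle_in ub (0 + t) rr'.
  by rewrite (e0 _ Dw) (partials_opp _ uC Dw) (e1 _ Dw) opprK.
rewrite /laplacian big_ord_recr big_ord1/=.
rewrite (_ : widen_ord _ _ = 0); last exact: val_inj.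
rewrite (_ : ord_max = 1 :> 'I_2); last exact: val_inj.
have [_ ->] := is_derive_partial0 0 oD uv ub r0 rr zz.
have -> : d 1 (fun w => d 1 u w) z = - d 1 (d 0 v) z.
  rewrite (@near_eq_derive _ _ _ _ (- d 0 v)).
    by apply: deriveN; have [] := cauchy_riemann_partial0_C1 oD vu 1 Dz.
  exact: filterS (fun x => e1 x) (open_near oD Dz).
have [_ ->] := is_derive_partial0 1 oD vu vb r0 rr zz.
rewrite E; exact: subrr.
Qed.

End CauchyRiemannC2.

(** * Quaternions *)

Section Quaternions.
Context {R : realType}.
Implicit Types (p q a b l I : quat R) (z w : plane R).

Lemma mkquatE (a b c d : R) : ((mkquat a b c d 0 0 = a) * (mkquat a b c d 0 1 = b) *
  (mkquat a b c d 0 2 = c) * (mkquat a b c d 0 3 = d))%type.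
Proof. by rewrite !mxE. Qed.

Lemma quat_ext p q : p 0 0 = q 0 0 -> p 0 1 = q 0 1 -> p 0 2 = q 0 2 ->
  p 0 3 = q 0 3 -> p = q.
Proof.
move=> e0 e1 e2 e3; apply/rowP => -[[|[|[|[|//]]]] i].
- by rewrite (_ : Ordinal i = 0) ?e0//; exact: val_inj.
- by rewrite (_ : Ordinal i = 1) ?e1//; exact: val_inj.
- by rewrite (_ : Ordinal i = 2) ?e2//; exact: val_inj.
- by rewrite (_ : Ordinal i = 3) ?e3//; exact: val_inj.
Qed.

Lemma coordD p q j : (p + q) 0 j = p 0 j + q 0 j. Proof. by rewrite mxE. Qed.
Lemma coordN p j : (- p) 0 j = - p 0 j. Proof. by rewrite mxE. Qed.
Lemma coordZ (s : R) p j : (s *: p) 0 j = s * p 0 j. Proof. by rewrite mxE. Qed.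
Definition coordE := (coordD, coordN, coordZ, mkquatE).

Lemma qmulDl p q b : qmul (p + q) b = qmul p b + qmul q b.
Proof. by apply: quat_ext; rewrite /qmul !coordE; ring. Qed.

Lemma qmulDr p q b : qmul b (p + q) = qmul b p + qmul b q.
Proof. by apply: quat_ext; rewrite /qmul !coordE; ring. Qed.

Lemma qmulZl (s : R) q b : qmul (s *: q) b = s *: qmul q b.
Proof. by apply: quat_ext; rewrite /qmul !coordE; ring. Qed.

Lemma qmulZr (s : R) q b : qmul b (s *: q) = s *: qmul b q.
Proof. by apply: quat_ext; rewrite /qmul !coordE; ring. Qed.

Lemma qmulNl q b : qmul (- q) b = - qmul q b.
Proof. by rewrite -scaleN1r qmulZl scaleN1r. Qed.

Lemma qmulNr q b : qmul b (- q) = - qmul b q.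
Proof. by rewrite -scaleN1r qmulZr scaleN1r. Qed.

Lemma qmulA p q b : qmul p (qmul q b) = qmul (qmul p q) b.
Proof. by apply: quat_ext; rewrite /qmul !coordE; ring. Qed.

Lemma qmul1q b : qmul (qone R) b = b.
Proof. by apply: quat_ext; rewrite /qmul /qone !coordE; ring. Qed.

Lemma qmulq1 b : qmul b (qone R) = b.
Proof. by apply: quat_ext; rewrite /qmul /qone !coordE; ring. Qed.

Lemma qmul_unitK I b : imag_units I -> qmul I (qmul I b) = - b.
Proof. by move=> II; rewrite qmulA II qmulNl qmul1q. Qed.

Definition qi : quat R := mkquat 0 1 0 0.
Definition qj : quat R := mkquat 0 0 1 0.
Definition qk : quat R := mkquat 0 0 0 1.

Lemma qi_unit : imag_units qi.
Proof. by apply: quat_ext; rewrite /qmul /qi /qone !coordE; ring. Qed.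

Lemma qj_unit : imag_units qj.
Proof. by apply: quat_ext; rewrite /qmul /qj /qone !coordE; ring. Qed.

Lemma qk_unit : imag_units qk.
Proof. by apply: quat_ext; rewrite /qmul /qk /qone !coordE; ring. Qed.

Lemma qk_qi b : qmul qk (qmul qi b) = qmul qj b.
Proof. by apply: quat_ext; rewrite /qmul /qk /qi /qj !coordE; ring. Qed.

Definition qconj q : quat R := mkquat (q 0 0) (- q 0 1) (- q 0 2) (- q 0 3).

Definition dotq l q : R :=
  l 0 0 * q 0 0 + l 0 1 * q 0 1 + l 0 2 * q 0 2 + l 0 3 * q 0 3.

(** The adjoint of left multiplication by p is left multiplication by its conjugate; real
    functionals of I f are thus real functionals of f. *)
Lemma dotq_mul l p q : dotq l (qmul p q) = dotq (qmul (qconj p) l) q.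
Proof. by rewrite /dotq /qmul /qconj !mkquatE; ring. Qed.

Lemma dotqN l q : dotq l (- q) = - dotq l q.
Proof. by rewrite /dotq !coordE; ring. Qed.

Lemma dotqB l p q : dotq l (p - q) = dotq l p - dotq l q.
Proof. by rewrite /dotq !coordE; ring. Qed.

Lemma row_continuous (T : topologicalType) n (f : T -> 'rV[R]_n.+1) (a : T) :
  (forall j, {for a, continuous (fun x => f x 0 j)}) -> {for a, continuous f}.
Proof.
move=> fc; apply: (@cvgrPdist_le _ _ _ (nbhs a) _ f (f a)).2 => e e0.
have : \forall x \near a, forall j, `|f a 0 j - f x 0 j| <= e.
  by apply: filter_forall => j; exact: (cvgr_dist_le _ _ (fc j)).
apply: filterS => x fx; apply: row_norm_le => [|j]; first exact: ltW.
by rewrite !mxE.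
Qed.

Lemma dotq_continuous l : continuous (dotq l).
Proof.
move=> q; have c j : {for q, continuous (fun q : quat R => l 0 j * q 0 j)}.
  exact: (continuousM (@cst_continuous _ _ (l 0 j) q) (@coord_continuous _ _ _ 0 j q)).
exact: (continuousD (continuousD (continuousD (c 0) (c 1)) (c 2)) (c 3)).
Qed.

Lemma coord_dotq q j : q 0 j = dotq (delta_mx 0 j) q.
Proof.
rewrite /dotq !mxE; case: j => -[|[|[|[|//]]]] i /=; rewrite !mul1r !mul0r ?addr0 ?add0r;
  by congr (q 0 _); exact: val_inj.
Qed.

Lemma affine_continuous a b : continuous (fun q => a + qmul q b).
Proof.
move=> q; apply: (continuousD (@cst_continuous _ _ a q)).
apply: row_continuous => j.
rewrite (_ : (fun q => qmul q b 0 j) = dotq (mkquat (qmul (qone R) b 0 j) (qmul qi b 0 j) (qmul qj b 0 j) (qmul qk b 0 j))).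
  exact: dotq_continuous.
apply/funext => p; rewrite /dotq !mkquatE.
have {1}-> : p = p 0 0 *: qone R + p 0 1 *: qi + p 0 2 *: qj + p 0 3 *: qk.
  by apply: quat_ext; rewrite /qone /qi /qj /qk !coordE; ring.
by rewrite !qmulDl !qmulZl !coordD !coordZ; ring.
Qed.

Lemma sliceD I z w : slice I (z + w) = slice I z + slice I w.
Proof. by apply: quat_ext; rewrite /slice /qone !coordE ![(z + w) _ _]mxE; ring. Qed.

Lemma sliceZ I (s : R) w : slice I (s *: w) = s *: slice I w.
Proof. by apply: quat_ext; rewrite /slice /qone !coordE ![(s *: w) _ _]mxE; ring. Qed.

Lemma slice_dirE0 I : slice I (dirE R 0) = qone R.
Proof. by rewrite /slice !mxE/= scale1r scale0r addr0. Qed.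

Lemma slice_dirE1 I : slice I (dirE R 1) = I.
Proof. by rewrite /slice !mxE/= scale1r scale0r add0r. Qed.

Lemma slice_continuous I : continuous (slice I).
Proof.
move=> z; exact: (continuousD (continuousZr_tmp (@coord_continuous _ _ _ 0 0 z)) (continuousZr_tmp (@coord_continuous _ _ _ 0 1 z))).
Qed.

Lemma cline_continuous I a b : continuous (cline I a b).
Proof.
move=> z; apply: (@continuous_comp _ _ _ (slice I) (fun q => a + qmul q b)).
  exact: slice_continuous.
exact: affine_continuous.
Qed.

Lemma clineD I a b z w : cline I a b (z + w) = cline I (cline I a b z) b w.
Proof. by rewrite /cline sliceD qmulDl addrA. Qed.

Lemma cline_dirE0 I a b z (s : R) : cline I a b (z + s *: dirE R 0) = cline I a b z + s *: b.
Proof. by rewrite clineD /cline sliceZ slice_dirE0 qmulZl qmul1q. Qed.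

Lemma cline_dirE1 I a b z (s : R) : cline I a b (z + s *: dirE R 1) = cline I a b z + s *: qmul I b.
Proof. by rewrite clineD /cline sliceZ slice_dirE1 qmulZl. Qed.

Lemma derivable_row (V : normedModType R) n (f : V -> 'rV[R]_n.+1) (a v : V) j : derivable f a v ->
  is_derive a v (fun x => f x 0 j) ('D_v f a 0 j).
Proof.
move=> df; split; first by have := (derivable_mxP _ _ _).1 df 0 j.
by have := derive_mx df => /rowP/(_ j); rewrite mxE.
Qed.

Lemma is_derive_dotq (V : normedModType R) l (f : V -> quat R) (a v : V) : derivable f a v ->
  is_derive a v (fun x => dotq l (f x)) (dotq l ('D_v f a)).
Proof.
move=> df; have H j := is_deriveZ (l 0 j) (derivable_row j df).
exact: (is_deriveD (is_deriveD (is_deriveD (H 0) (H 1)) (H 2)) (H 3)).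
Qed.

Lemma C1_on_dotq l (D : set (plane R)) (f : plane R -> quat R) : open D -> C1_on D f ->
  C1_on D (fun z => dotq l (f z)).
Proof.
move=> oD fC; apply: (@C1_on_is_derive R 1 D _ (fun i z => dotq l ('D_(dirE R i) f z)) oD).
  by move=> i z Dz; have [df _] := fC i z Dz; exact: is_derive_dotq.
move=> i z Dz; have [_ cf] := fC i z Dz.
by apply: (@continuous_comp _ _ _ ('D_(dirE R i) f) (dotq l)); [exact: cf|exact: dotq_continuous].
Qed.

Lemma open_slice I (O : set (quat R)) : open O -> open (slice I @^-1` O).
Proof. by move=> oO; apply: open_comp => // z _; exact: slice_continuous. Qed.

Lemma regular_partials (O : set (quat R)) f I z : regular O f -> imag_units I ->
  (slice I @^-1` O) z ->
  'D_(dirE R 1) (f \o slice I) z = qmul I ('D_(dirE R 0) (f \o slice I) z).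
Proof.
move=> rf II Dz; have [_ /(_ z Dz)] := rf I II.
move=> /eqP; rewrite scaler_eq0 invr_eq0 pnatr_eq0/= addr_eq0 => /eqP ->.
by rewrite qmulNr qmul_unitK// opprK.
Qed.

(** Every real functional of a curve holomorphic for I is a component of a scalar holomorphic
    function: the y-derivative of f is I times its x-derivative, and applying I once more produces
    the minus sign. *)
Lemma dotq_cauchy_riemann (D : set (plane R)) (f : plane R -> quat R) I l :
  open D -> imag_units I -> C1_on D f ->
  (forall z, D z -> 'D_(dirE R 1) f z = qmul I ('D_(dirE R 0) f z)) ->
  cauchy_riemann D (fun z => dotq l (qmul I (f z))) (fun z => dotq l (f z)).
Proof.
move=> oD II fC fd.
rewrite (_ : (fun z => dotq l (qmul I (f z))) = fun z => dotq (qmul (qconj I) l) (f z)); last first.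
  by apply/funext => z; rewrite dotq_mul.
have E m i z : D z -> 'D_(dirE R i) (fun z => dotq m (f z)) z = dotq m ('D_(dirE R i) f z).
  by move=> Dz; have [df _] := fC i z Dz; have [] := is_derive_dotq m df.
split; [exact: (C1_on_dotq _ oD fC)|exact: (C1_on_dotq _ oD fC)|move=> z Dz|move=> z Dz].
  rewrite (E _ _ _ Dz) (E _ _ _ Dz) -dotq_mul (fd _ Dz).
  reflexivity.
rewrite (E _ _ _ Dz) (E _ _ _ Dz) -dotq_mul (fd _ Dz).
rewrite (qmul_unitK _ II) dotqN; reflexivity.
Qed.

Lemma C1_on_continuous (D : set (plane R)) (f : plane R -> quat R) z :
  open D -> C1_on D f -> D z -> {for z, continuous f}.
Proof.
move=> oD fC Dz; apply: row_continuous => j.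
rewrite (_ : (fun x => _) = fun x => dotq (delta_mx 0 j) (f x)); last first.
  by apply/funext => x; rewrite -coord_dotq.
exact: (C1_continuous oD (C1_on_dotq (delta_mx 0 j) oD fC) Dz).
Qed.

End Quaternions.

(** * Harmonic functions *)

Section LocalC2.
Context {R : realType} {n : nat}.
Implicit Types (D : set 'rV[R]_n.+1) (g h : 'rV[R]_n.+1 -> R) (z : 'rV[R]_n.+1).

Lemma near_eq_derive_near g h z v : (\forall w \near z, g w = h w) ->
  \forall w \near z, 'D_v g w = 'D_v h w.
Proof. by move/near_join; apply: filterS => w; exact: near_eq_derive. Qed.

Lemma near_eq_sym g h z : (\forall w \near z, g w = h w) -> \forall w \near z, h w = g w.
Proof. by apply: filterS => w ->. Qed.

Lemma C1_on_local D g :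
  (forall z, D z -> exists2 h, \forall w \near z, g w = h w & C1_on D h) -> C1_on D g.
Proof.
move=> H i z Dz; have [h gh hC] := H z Dz; have [dh ch] := hC i z Dz.
split; first exact: near_eq_derivable (near_eq_sym gh) dh.
exact: near_eq_continuous (near_eq_derive_near (dirE R i) gh) ch.
Qed.

(** The comparison function h may change with z. This matters because u will be affine near each
    point, with coefficients that depend on the point. *)
Lemma C2_on_local D g :
  (forall z, D z -> exists2 h, \forall w \near z, g w = h w & C2_on D h) -> C2_on D g.
Proof.
move=> H; split=> [|i]; apply: C1_on_local => z Dz; have [h gh [hC1 hC2]] := H z Dz.
  by exists h.
by exists ('D_(dirE R i) h); [exact: near_eq_derive_near|exact: hC2].
Qed.

Lemma near_eq_laplacian g h z : (\forall w \near z, g w = h w) ->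
  laplacian g z = laplacian h z.
Proof.
move=> gh; apply: eq_bigr => i _; apply: near_eq_derive.
exact: near_eq_derive_near.
Qed.

Lemma C1_on_cst D (c : R) : C1_on D (fun=> c).
Proof.
move=> i z _; split; first exact: derivable_cst.
have -> : (fun w => 'D_(dirE R i) (fun _ : 'rV[R]_n.+1 => c) w) = (fun=> 0 : R).
  by apply/funext => w; rewrite derive_cst.
exact: cst_continuous.
Qed.

End LocalC2.

(** * Functions harmonic on all complex lines are locally affine *)

Section ComplexLines.
Context {R : realType}.
Implicit Types (g : quat R -> R) (I a b q : quat R) (z : plane R).

(** The difference quotients themselves coincide, so derivatives along a line are directional
    derivatives of g without any differentiability of g. *)
Lemma growth_rate_cline0 g I a b z :
  (fun h : R => h^-1 *: (((g \o cline I a b) \o shift z) (h *: dirE R 0) - (g \o cline I a b) z)) =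
  (fun h : R => h^-1 *: ((g \o shift (cline I a b z)) (h *: b) - g (cline I a b z))).
Proof.
by apply/funext => h /=; congr (_ *: (g _ - _)); rewrite addrC cline_dirE0 addrC.
Qed.

Lemma growth_rate_cline1 g I a b z :
  (fun h : R => h^-1 *: (((g \o cline I a b) \o shift z) (h *: dirE R 1) - (g \o cline I a b) z)) =
  (fun h : R => h^-1 *: ((g \o shift (cline I a b z)) (h *: qmul I b) - g (cline I a b z))).
Proof.
by apply/funext => h /=; congr (_ *: (g _ - _)); rewrite addrC cline_dirE1 addrC.
Qed.

Lemma derive_cline0 g I a b z : 'D_(dirE R 0) (g \o cline I a b) z = 'D_b g (cline I a b z).
Proof. by rewrite /derive growth_rate_cline0. Qed.

Lemma derive_cline1 g I a b z :
  'D_(dirE R 1) (g \o cline I a b) z = 'D_(qmul I b) g (cline I a b z).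
Proof. by rewrite /derive growth_rate_cline1. Qed.

Lemma laplacian_cline g I a b z : laplacian (g \o cline I a b) z =
  'D_b ('D_b g) (cline I a b z) + 'D_(qmul I b) ('D_(qmul I b) g) (cline I a b z).
Proof.
have H0 : 'D_(dirE R 0) (fun w => 'D_(dirE R 0) (g \o cline I a b) w) z =
    'D_b ('D_b g) (cline I a b z).
  have -> : (fun w => 'D_(dirE R 0) (g \o cline I a b) w) = 'D_b g \o cline I a b.
    by apply/funext => w; exact: derive_cline0.
  exact: derive_cline0.
have H1 : 'D_(dirE R 1) (fun w => 'D_(dirE R 1) (g \o cline I a b) w) z =
    'D_(qmul I b) ('D_(qmul I b) g) (cline I a b z).
  have -> : (fun w => 'D_(dirE R 1) (g \o cline I a b) w) = 'D_(qmul I b) g \o cline I a b.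
    by apply/funext => w; exact: derive_cline1.
  exact: derive_cline1.
rewrite /laplacian big_ord_recr big_ord1/=.
rewrite (_ : widen_ord _ _ = 0); last exact: val_inj.
rewrite (_ : ord_max = 1 :> 'I_2); last exact: val_inj.
exact: (f_equal2 (fun x y : R => x + y) H0 H1).
Qed.

Lemma cline0 I a b : cline I a b 0 = a.
Proof.
by rewrite /cline -(scale0r (0 : plane R)) sliceZ scale0r -(scale0r (0 : quat R)) qmulZl scale0r addr0.
Qed.

Variables (O : set (quat R)) (v : quat R -> R).
Hypotheses (oO : open O)
  (vH : forall I a b, imag_units I -> C2_on (cline I a b @^-1` O) (v \o cline I a b) /\
    forall z, (cline I a b @^-1` O) z -> laplacian (v \o cline I a b) z = 0).

Lemma derivable_harmonic q b : O q -> derivable v q b /\ derivable ('D_b v) q b.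
Proof.
move=> Oq; have [[H1 H2] _] := vH q b qi_unit.
have O0 : (cline qi q b @^-1` O) 0 by rewrite /= cline0.
have [d1 _] := H1 0 _ O0; have [d2 _] := H2 0 0 _ O0.
split; first by move: d1; rewrite /derivable growth_rate_cline0 cline0.
move: d2; have -> : (fun w => 'D_(dirE R 0) (v \o cline qi q b) w) = 'D_b v \o cline qi q b.
  by apply/funext => w; exact: derive_cline0.
by rewrite /derivable growth_rate_cline0 cline0.
Qed.

(* The real planes spanned by (b, i b), (b, j b) and (i b, j b) are all
   complex lines: the last one for the structure k. *)
Lemma second_derive_harmonic q b : O q -> 'D_b ('D_b v) q = 0.
Proof.
move=> Oq; pose S x := 'D_x ('D_x v) q.
have E I x : imag_units I -> S x + S (qmul I x) = 0.
  move=> II; have [_ /(_ 0)] := vH q x II.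
  by rewrite laplacian_cline /= cline0; apply.
rewrite -/(S b); clearbody S.
have e3 := E _ (qmul qi b) qk_unit; rewrite qk_qi in e3.
have e1 := E _ b qi_unit; have e2 := E _ b qj_unit; lra.
Qed.

(** Along the segment the derivative of v in direction h has derivative 0, so it is constant; then
    v(q + s h) minus s times that derivative is constant too. *)
Lemma segment_affine q h : (forall s : R, 0 <= s <= 1 -> O (q + s *: h)) ->
  v (q + h) = v q + 'D_h v q.
Proof.
move=> Os.
have d1 (s : R) : 0 <= s <= 1 -> is_derive s 1 (fun s => v (q + s *: h)) ('D_h v (q + s *: h)).
  by move=> /Os/(derivable_harmonic h)[d _]; exact: is_derive_line.
have d2 (s : R) : 0 <= s <= 1 -> is_derive s 1 (fun s => 'D_h v (q + s *: h)) 0.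
  move=> /Os Oqs; have [_ d] := derivable_harmonic h Oqs.
  by have := is_derive_line d; rewrite (second_derive_harmonic _ Oqs).
have := zero_derive_const d2; rewrite scale1r scale0r addr0 => e2.
have d3 (s : R) : 0 <= s <= 1 ->
    is_derive s 1 (fun s => v (q + s *: h) - s * 'D_h v (q + s *: h)) 0.
  move=> s01; apply: is_derive_eq (is_deriveB (d1 s s01) (is_deriveM (is_derive_id s 1) (d2 s s01))) _.
  by rewrite scaler0 add0r [X in _ - X]mulr1 subrr.
have := zero_derive_const d3; rewrite scale1r scale0r addr0 mul1r mul0r subr0 e2.
by move=> <-; rewrite subrK.
Qed.

Lemma derive_dirZ q b (s : R) : O q -> 'D_(s *: b) v q = s * 'D_b v q.
Proof.
move=> Oq; have [d _] := derivable_harmonic b Oq.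
have d' : derivable v (q + (0 * s) *: b) b by rewrite mul0r scale0r addr0.
have K : is_derive (0 : R) 1 (fun t : R => t * s) s.
  by apply: is_derive_eq; rewrite scaler0 add0r [LHS]mulr1.
have := @is_derive1_comp R (fun t => v (q + t *: b)) (fun t => t * s) 0 _ _ (is_derive_line d') K.
rewrite mul0r scale0r addr0 mulrC => H.
have [|_ <-//] := @is_derive_of_line R _ _ v q (s *: b) (s * 'D_b v q).
apply: near_eq_is_derive H.
by apply: (@nearW _ (nbhs (0 : R))) => t /=; rewrite scalerA.
Qed.

(** The hypotheses concern v on lines only, without joint regularity, so that both implications of
    the harmonic case can use the result. Affineness on segments from q makes v the sum of a
    constant and the homogeneous function [L]; what needs proof is the additivity of [L]. *)
Lemma locally_affine q : O q ->
  exists (c : R) (l : quat R), \forall p \near q, v p = c + dotq l p.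
Proof.
move=> Oq.
have [rho /= rho0 Hrho] := (nbhs_normP _ _).1 (open_near oO Oq).
have inO (h : quat R) : `|h| < rho -> O (q + h).
  by move=> hr; apply: Hrho; rewrite /= opprD addNKr normrN.
pose L h := 'D_h v q.
have LE (h : quat R) : `|h| < rho -> v (q + h) = v q + L h.
  move=> hr; apply: segment_affine => s /andP[s0 s1]; apply: inO.
  by rewrite normrZ (le_lt_trans _ hr)// ler_piMl// ger0_norm.
have LZ (s : R) h : L (s *: h) = s * L h by exact: derive_dirZ.
(* The point q + h + k is the midpoint of q + 2 h and q + 2 k. Affineness on the segment between
   them gives v(q + 2 h) + v(q + 2 k) = 2 v(q + h + k), which is additivity after homogeneity. *)
have LD (h k : quat R) : `|h| < rho / 2 -> `|k| < rho / 2 -> L (h + k) = L h + L k.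
  move=> hr kr.
  have r2 (x : quat R) : `|x| < rho / 2 -> `|2 *: x| < rho.
    by move=> xr; rewrite normrZ ger0_norm// mulrC -ltr_pdivlMr.
  have hk : `|h + k| < rho.
    by rewrite (le_lt_trans (ler_normD _ _))// (splitr rho) ltrD.
  have conv (x y : quat R) (s : R) : 0 <= s <= 1 -> `|x| < rho -> `|y| < rho ->
      `|(1 - s) *: x + s *: y| < rho.
    move=> /andP[s0 s1] xr yr; rewrite (le_lt_trans (ler_normD _ _))// !normrZ.
    rewrite !ger0_norm ?subr_ge0//; have [xy|/ltW xy] := leP `|x| `|y|; nra.
  have A (x y : quat R) : `|x| < rho / 2 -> `|y| < rho / 2 ->
      v (q + (x + y) + (x - y)) = v (q + (x + y)) + 'D_(x - y) v (q + (x + y)).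
    move=> xr yr; apply: segment_affine => s s01.
    rewrite (_ : _ + _ = q + ((1 - s) *: (x + y) + s *: (2 *: x))).
      apply/inO/conv => //; last exact: r2.
      by rewrite (le_lt_trans (ler_normD _ _))// (splitr rho) ltrD.
    by apply/rowP => j; rewrite !mxE; ring.
  have Ahk := A h k hr kr; have := A k h kr hr.
  rewrite [k + h]addrC (_ : k - h = (-1) *: (h - k)); last by rewrite scaleN1r opprB.
  rewrite (derive_dirZ _ _ (inO _ hk)).
  rewrite (_ : q + (h + k) + (-1) *: (h - k) = q + 2 *: k); last first.
    by apply/rowP => j; rewrite !mxE; ring.
  move: Ahk; rewrite (_ : q + (h + k) + (h - k) = q + 2 *: h); last first.
    by apply/rowP => j; rewrite !mxE; ring.
  rewrite (LE _ (r2 _ hr)) (LE _ (r2 _ kr)) (LE _ hk) !LZ; lra.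
have basis_norm (e : quat R) : (forall j, `|e 0 j| <= 1) -> `|e| <= 1.
  by move=> ej; apply: row_norm_le.
have n0 : `|qone R| <= 1.
  by apply: basis_norm => -[[|[|[|[|//]]]] j]; rewrite mxE/= ?normr1 ?normr0.
have n1 : `|qi : quat R| <= 1.
  by apply: basis_norm => -[[|[|[|[|//]]]] j]; rewrite mxE/= ?normr1 ?normr0.
have n2 : `|qj : quat R| <= 1.
  by apply: basis_norm => -[[|[|[|[|//]]]] j]; rewrite mxE/= ?normr1 ?normr0.
have n3 : `|qk : quat R| <= 1.
  by apply: basis_norm => -[[|[|[|[|//]]]] j]; rewrite mxE/= ?normr1 ?normr0.
pose l : quat R := mkquat (L (qone R)) (L qi) (L qj) (L qk).
exists (v q - dotq l q), l.
(* Sums of up to three coordinate components, each of norm below rho / 8, must stay below rho / 2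
   for [LD] to apply. *)
have : \forall p \near q, `|p - q| < rho / 8.
  by apply: (@near_dist_lt R (quat R) q); rewrite divr_gt0.
apply: filterS => p pq.
have pq' : `|p - q| < rho by rewrite (lt_le_trans pq)//; move: rho0; lra.
rewrite -[in LHS](subrK q p) [in LHS]addrC LE//.
pose h := p - q; rewrite -/h.
suff : L h = dotq l h by rewrite /h dotqB => ->; ring.
have small (e : quat R) j : `|e| <= 1 -> `|h 0 j *: e| < rho / 8.
  move=> e1; rewrite normrZ (le_lt_trans _ pq)// (le_trans _ (normr_coord_le _ 0 j))//.
  by rewrite ler_piMr.
have s2 (a b : quat R) (x y : R) : `|a| < x -> `|b| < y -> `|a + b| < x + y.
  by move=> ax bx; rewrite (le_lt_trans (ler_normD _ _))// ltrD.
have lt2 x (a : quat R) : `|a| < x -> x <= rho / 2 -> `|a| < rho / 2 by exact: lt_le_trans.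
have s0 := small _ 0 n0; have s1 := small _ 1 n1.
have s3 := small _ 2 n2; have s4 := small _ 3 n3.
have s34 := s2 _ _ _ _ s3 s4; have s134 := s2 _ _ _ _ s1 s34.
have -> : h = h 0 0 *: qone R + (h 0 1 *: qi + (h 0 2 *: qj + h 0 3 *: qk)).
  by apply: quat_ext; rewrite /qone /qi /qj /qk !coordD !coordZ !mkquatE; ring.
rewrite LD; [|by apply: (lt2 _ _ s0); move: rho0; lra|by apply: (lt2 _ _ s134); move: rho0; lra].
rewrite LD; [|by apply: (lt2 _ _ s1); move: rho0; lra|by apply: (lt2 _ _ s34); move: rho0; lra].
rewrite LD; [|by apply: (lt2 _ _ s3); move: rho0; lra|by apply: (lt2 _ _ s4); move: rho0; lra].
rewrite !LZ /dotq /l !coordD !coordZ /qone /qi /qj /qk !mkquatE; ring.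
Qed.

End ComplexLines.

(** * Affine regular maps *)

Section Affine.
Context {R : realType}.
Implicit Types (I a b q : quat R) (O : set (quat R)).

Definition qinv b : quat R := (dotq b b)^-1 *: qconj b.

Lemma dotq_gt0 b : b != 0 -> dotq b b != 0.
Proof.
apply: contra_neq => b0; have sq (x : R) : 0 <= x * x by rewrite -expr2 sqr_ge0.
have z j : b 0 j * b 0 j = 0 -> b 0 j = 0 by move/eqP; rewrite mulf_eq0 orbb => /eqP.
have := sq (b 0 0); have := sq (b 0 1); have := sq (b 0 2); have := sq (b 0 3).
move: b0; rewrite /dotq => b0 p3 p2 p1 p0.
by apply: quat_ext; rewrite [RHS]mxE; apply: z; lra.
Qed.

Lemma qmulqV b : b != 0 -> qmul b (qinv b) = qone R.
Proof.
move=> /dotq_gt0 b0; rewrite /qinv qmulZr.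
have -> : qmul b (qconj b) = dotq b b *: qone R.
  by apply: quat_ext; rewrite /qmul /qconj /qone /dotq !coordZ !mkquatE; ring.
by rewrite scalerA mulVf// scale1r.
Qed.

Lemma qmulVq b : b != 0 -> qmul (qinv b) b = qone R.
Proof.
move=> /dotq_gt0 b0; rewrite /qinv qmulZl.
have -> : qmul (qconj b) b = dotq b b *: qone R.
  by apply: quat_ext; rewrite /qmul /qconj /qone /dotq !coordZ !mkquatE; ring.
by rewrite scalerA mulVf// scale1r.
Qed.

(** The map is a homeomorphism with inverse [g], and the preimage of O is its image under [g],
    whence connectedness. The hypothesis of the converse implications speaks only of functions
    defined on domains. *)
Lemma affine_preimage_domain O a b : b != 0 -> domain O ->
  domain ((fun q => a + qmul q b) @^-1` O).
Proof.
move=> b0 [[p Op] oO cO].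
pose g p := - qmul a (qinv b) + qmul p (qinv b).
have gK p' : a + qmul (g p') b = p'.
  rewrite /g qmulDl qmulNl -!qmulA qmulVq// !qmulq1.
  by rewrite addrA subrr add0r.
have Kg q : g (a + qmul q b) = q.
  by rewrite /g qmulDl -!qmulA qmulqV// qmulq1 addrA addNr add0r.
split.
- by exists (g p); rewrite /= gK.
- by apply: open_comp => // q _; exact: affine_continuous.
- rewrite (_ : _ @^-1` O = g @` O).
    apply: connected_continuous_connected => //.
    by apply: continuous_subspaceT => q; exact: affine_continuous.
  apply/seteqP; split=> [q Oq|_ [p' Op' <-]]; last by rewrite /= gK.
  by exists (a + qmul q b); rewrite ?Kg.
Qed.

Lemma is_derive_cline0 I a b z : is_derive z (dirE R 0) (cline I a b) b.
Proof.
apply: is_derive_of_line.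
rewrite (_ : (fun h : R => _) = fun h : R => cline I a b z + h *: b); last first.
  by apply/funext => h; rewrite cline_dirE0.
have d : derivable (fun q : quat R => q) (cline I a b z + (0 : R) *: b) b by exact: derivable_id.
by have := is_derive_line d; rewrite derive_id.
Qed.

Lemma is_derive_cline1 I a b z : is_derive z (dirE R 1) (cline I a b) (qmul I b).
Proof.
apply: is_derive_of_line.
rewrite (_ : (fun h : R => _) = fun h : R => cline I a b z + h *: qmul I b); last first.
  by apply/funext => h; rewrite cline_dirE1.
have d : derivable (fun q : quat R => q) (cline I a b z + (0 : R) *: qmul I b) (qmul I b) by exact: derivable_id.
by have := is_derive_line d; rewrite derive_id.
Qed.

Lemma affine_regular O a b : regular O (fun q => a + qmul q b).
Proof.
move=> I II D fI.
have fE : fI = cline I a b by [].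
rewrite fE; have E0 z : 'D_(dirE R 0) (cline I a b) z = b.
  by have [_] := is_derive_cline0 I a b z.
have E1 z : 'D_(dirE R 1) (cline I a b) z = qmul I b.
  by have [_] := is_derive_cline1 I a b z.
split=> [i z _|z _]; last by rewrite E0 E1 qmul_unitK// subrr scaler0.
have [->|->] := ord2_cases i.
  split; first by have [] := is_derive_cline0 I a b z.
  rewrite (_ : (fun w => 'D_(dirE R 0) (cline I a b) w) = fun=> b); last exact/funext.
  exact: cst_continuous.
split; first by have [] := is_derive_cline1 I a b z.
rewrite (_ : (fun w => 'D_(dirE R 1) (cline I a b) w) = fun=> qmul I b); last exact/funext.
exact: cst_continuous.
Qed.

Lemma cline_b0 I a z : cline I a 0 z = a.
Proof. by rewrite /cline -(scale0r (0 : quat R)) qmulZr scale0r addr0. Qed.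

End Affine.

(** * The equivalence for harmonic functions *)

Section Harmonic.
Context {R : realType}.
Implicit Types (Omega : set (quat R)) (u : quat R -> \bar R).

Lemma cauchy_riemann_cst (D : set (plane R)) (c : R) :
  cauchy_riemann D (fun=> c) (fun=> 0).
Proof.
by split; [exact: C1_on_cst|exact: C1_on_cst| |] => z _; rewrite !derive_cst ?oppr0.
Qed.

Lemma cauchy_riemann_addc (D : set (plane R)) (c : R) f g : open D ->
  cauchy_riemann D f g -> cauchy_riemann D (fun z => c + f z) g.
Proof.
move=> oD [fC gC e0 e1].
have dc i z : D z -> is_derive z (dirE R i) (fun z => c + f z) ('D_(dirE R i) f z).
  move=> Dz; have [df _] := fC i z Dz.
  by have := is_deriveD (is_derive_cst c z (dirE R i)) (derivableP df); rewrite add0r.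
have E i z : D z -> 'D_(dirE R i) (fun z => c + f z) z = 'D_(dirE R i) f z.
  by move=> Dz; have [] := dc i z Dz.
split.
- apply: (@C1_on_is_derive R 1 D _ (fun i => 'D_(dirE R i) f) oD dc).
  by move=> i z Dz; have [] := fC i z Dz.
- exact: gC.
- by move=> z Dz; rewrite (E _ _ Dz); exact: e0.
- by move=> z Dz; rewrite (E _ _ Dz); exact: e1.
Qed.

(** Each pair is holomorphic on all of D, but its first component has to agree with w only near z:
    such pairs arise from the local affine expressions of u evaluated along one and the same
    curve. *)
Lemma harmonic_on_local (D : set (plane R)) (w : plane R -> \bar R) : open D ->
  (forall z, D z -> w z \is a fin_num) ->
  (forall z, D z -> exists2 fg, \forall x \near z, fine (w x) = fg.1 x & cauchy_riemann D fg.1 fg.2) ->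
  harmonic_on D w.
Proof.
move=> oD wfin H; split=> [||z Dz]; first exact: wfin.
- apply: C2_on_local => z /H[fg wf fgC]; exists fg.1; first exact: wf.
  exact: cauchy_riemann_C2 fgC.
- have [fg wf fgC] := H z Dz.
  by rewrite (near_eq_laplacian wf); exact: (cauchy_riemann_laplacian oD fgC).
Qed.

Lemma harmonic_clines_regular Omega u (O' : set (quat R)) f : open Omega ->
  (forall q, Omega q -> u q \is a fin_num) ->
  (forall I a b, imag_units I -> harmonic_on (cline I a b @^-1` Omega) (u \o cline I a b)) ->
  open O' -> (forall q, O' q -> Omega (f q)) -> regular O' f ->
  weakly_harmonic O' (u \o f).
Proof.
move=> oO ufin uh oO' fO rf I II.
have oD := open_slice (I := I) oO'.
have [fC _] := rf I II.
have vH J a b : imag_units J -> C2_on (cline J a b @^-1` Omega) ((fine \o u) \o cline J a b) /\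
    forall z, (cline J a b @^-1` Omega) z -> laplacian ((fine \o u) \o cline J a b) z = 0.
  by move=> JJ; have [_ ? ?] := uh J a b JJ.
apply: harmonic_on_local => [|z Dz|z Dz]; first exact: oD.
  exact/ufin/fO.
have [c [l cl]] := locally_affine oO vH (fO _ Dz).
(* The rotation puts the functional of f itself, rather than that of I f, in first position. *)
have cr := cauchy_riemann_rot oD (dotq_cauchy_riemann l oD II fC
  (fun z => regular_partials rf II (z := z))).
exists (fun x => c + dotq l (f (slice I x)), - (fun z => dotq l (qmul I (f (slice I z))))); last exact: (cauchy_riemann_addc c oD cr).
suff cf : {for z, continuous (f \o slice I)} by exact: (cf _ cl).
exact: C1_on_continuous oD fC Dz.
Qed.

(** The affine maps yield harmonicity on lines, but [pluriharmonic_on] also asks for C^2 regularity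
    in four real variables, which lines do not display; it is read off from [locally_affine]. *)
Lemma regular_harmonic_clines Omega u : domain Omega ->
  (forall (O' : set (quat R)) f, domain O' -> (forall q, O' q -> Omega (f q)) ->
     regular O' f -> weakly_harmonic O' (u \o f)) ->
  strongly_harmonic Omega u.
Proof.
move=> dO H; have [_ oO _] := dO.
have one_neq0 : qone R != 0.
  by apply/eqP => /rowP/(_ 0); rewrite !mxE/= => /eqP; rewrite oner_eq0.
have lineH I a b : imag_units I -> b != 0 ->
    harmonic_on (cline I a b @^-1` Omega) (u \o cline I a b).
  move=> II b0; have := H _ (fun q => a + qmul q b) (affine_preimage_domain a b0 dO).
  by move=> /(_ (fun q => id) (@affine_regular _ _ a b))/(_ I II).
have ufin q : Omega q -> u q \is a fin_num.
  move=> Oq; have [fin _ _] := lineH qi q (qone R) qi_unit one_neq0.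
  by have := fin 0; rewrite /= cline0; exact.
have lineH' I a b : imag_units I ->
    harmonic_on (cline I a b @^-1` Omega) (u \o cline I a b).
  (* For b = 0 the affine map is constant, and the preimage of Omega may be empty, hence not a
     domain; the restriction of u to this degenerate line is constant. *)
  move=> II; have [->|b0] := eqVneq b 0; last exact: lineH.
  rewrite (_ : u \o cline I a 0 = fun=> u a); last first.
    by apply/funext => z /=; rewrite cline_b0.
  apply: harmonic_on_local => [|z|z Dz].
  - by apply: open_comp => // z _; exact: cline_continuous.
  - by rewrite /= cline_b0; exact: ufin.
  - exists (fun=> fine (u a), fun=> 0); last exact: cauchy_riemann_cst.
    by apply: (@nearW _ (nbhs z)).
have vH J a b : imag_units J -> C2_on (cline J a b @^-1` Omega) ((fine \o u) \o cline J a b) /\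
    forall z, (cline J a b @^-1` Omega) z -> laplacian ((fine \o u) \o cline J a b) z = 0.
  by move=> JJ; have [_ ? ?] := lineH' J a b JJ.
move=> I II; split; [exact: ufin| |by move=> a b; exact: lineH'].
apply: C2_on_local => q Oq; have [c [l cl]] := locally_affine oO vH Oq.
exists (fun p => c + dotq l p); first exact: cl.
have dl i (p : quat R) : is_derive p (dirE R i) (fun p => c + dotq l p) (dotq l (dirE R i)).
  have d : derivable (fun q : quat R => q) p (dirE R i) by exact: derivable_id.
  have := is_deriveD (is_derive_cst c p (dirE R i)) (is_derive_dotq l d).
  by rewrite add0r derive_id.
split=> [|i].
  apply: (@C1_on_is_derive R 3 Omega _ (fun i _ => dotq l (dirE R i)) oO (fun i p _ => dl i p)).
  by move=> i p _; exact: cst_continuous.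
rewrite (_ : (fun w => _) = fun=> dotq l (dirE R i)); first exact: C1_on_cst.
by apply/funext => p; have [] := dl i p.
Qed.

Lemma strongly_harmonic_regular_iff Omega u : domain Omega -> us Omega u ->
  strongly_harmonic Omega u <->
  (forall (O' : set (quat R)) f, domain O' -> (forall q, O' q -> Omega (f q)) ->
     regular O' f -> weakly_harmonic O' (u \o f)).
Proof.
move=> dO uO; have [_ oO _] := dO; split=> [sh O' f [_ oO' _] fO rf|].
  apply: harmonic_clines_regular fO rf => //.
    by have [] := sh _ qi_unit.
  by move=> I a b /sh[].
exact: regular_harmonic_clines.
Qed.

End Harmonic.

Section SubharmonicConverse.
Context {R : realType}.

(** Meant for the degenerate lines b = 0. The bound on c is conditional because the value of u at a
    point outside Omega is arbitrary, and D is then empty. *)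
Lemma subharmonic_on_cst (D : set (plane R)) (c : \bar R) :
  (D !=set0 -> (c < +oo)%E) -> subharmonic_on D (fun=> c).
Proof.
move=> cy; split.
  split=> [z Dz|z Dz a ca]; first by apply: cy; exists z.
  by apply: (@nearW _ (nbhs z)).
move=> z r r0 rD.
have zD : D z.
  by apply: rD; rewrite /closed_disc/= !subrr expr0n/= addr0 sqr_ge0.
rewrite integral_cst//= lebesgue_measure_itv/= lte_fin twopi_gt0 -EFinB subr0.
have p0 := @twopi_gt0 R.
rewrite muleCA -EFinM mulVf ?mule1// gt_eqF//.
Qed.

Lemma regular_strongly_subharmonic Omega (u : quat R -> \bar R) : domain Omega -> us Omega u ->
  (forall (O' : set (quat R)) f, domain O' -> (forall q, O' q -> Omega (f q)) ->
     regular O' f -> weakly_subharmonic O' (u \o f)) ->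
  strongly_subharmonic Omega u.
Proof.
move=> dO [uO _] H I II; split=> // a b.
have [->|b0] := eqVneq b 0.
  rewrite (_ : u \o cline I a 0 = fun=> u a); last first.
    by apply/funext => z /=; rewrite cline_b0.
  apply: subharmonic_on_cst => -[z]; rewrite /= cline_b0 => Oa.
  by have [+ _] := uO; apply.
have := H _ (fun q => a + qmul q b) (affine_preimage_domain a b0 dO).
by move=> /(_ (fun q => id) (@affine_regular _ _ a b))/(_ I II).
Qed.

End SubharmonicConverse.

(** * From local to global sub-mean inequalities *)

Section RiemannSums.
Context {R : realType}.
Implicit Types (g : R -> R).
Local Notation mu := (@lebesgue_measure R).

(** The primitive is an integral from the base point -B, hence the half-line. *)
Lemma antiderivative_exists g (B : R) : continuous g ->
  exists G : R -> R, forall t, - B < t -> is_derive t 1 G (g t).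
Proof.
move=> cg; exists (fun x => \int[mu]_(t in `[- B, x]) g t) => t Bt.
have t1 : t < t + 1 by rewrite ltrDl.
have [d e] := @continuous_FTC1_closed R g (- B) t (t + 1) t1
  (continuous_integrable _ _ cg) Bt (cg t).
by split; [exact: d|rewrite -derive1E e].
Qed.

(** Heine's theorem with only x confined to the segment; y may leave it. *)
Lemma uniform_continuity_segment g (a b e : R) : continuous g -> 0 < e ->
  exists2 d : R, 0 < d & forall x y, a <= x <= b -> `|y - x| <= d -> `|g y - g x| <= e.
Proof.
move=> cg e0.
have K := (compact_near_coveringP _).1 (@segment_compact R a b).
have : \forall d \near (0 : R)^'+, `[a, b] `<=`
    (fun x => forall y, `|y - x| <= d -> `|g y - g x| <= e).
  apply: K => x _.
  have e2 : 0 < e / 2 by rewrite divr_gt0.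
  have [d0 /= d00 Hd0] := (nbhs_normP _ _).1 (cvgr_distC_le _ _ (cg x) _ e2).
  have H y : `|y - x| < d0 -> `|g y - g x| <= e / 2 by rewrite distrC => /Hd0.
  near=> x' d => y yx.
  have x'x : `|x' - x| < d0 / 2 by near: x'; apply: (@near_dist_lt R _ x); rewrite divr_gt0.
  have dd : d < d0 / 2 by near: d; apply: nbhs_right_lt; rewrite divr_gt0.
  have yx2 : `|y - x| < d0.
    rewrite (_ : y - x = (y - x') + (x' - x)); last by rewrite addrA subrK.
    by rewrite (le_lt_trans (ler_normD _ _))// (splitr d0) ltrD// (le_lt_trans yx).
  have x'x2 : `|x' - x| < d0 by rewrite (lt_trans x'x)//; move: (d00); lra.
  rewrite (_ : g y - g x' = (g y - g x) - (g x' - g x)); last by ring.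
  by rewrite (le_trans (ler_normB _ _))// (splitr e) lerD// H.
move=> H; near (0 : R)^'+ => d.
have d0 : 0 < d by near: d; exact: nbhs_right_gt.
have Hd : `[a, b]%classic `<=` (fun x => forall y, `|y - x| <= d -> `|g y - g x| <= e) by near: d.
by exists d => // x y xab; apply: Hd; rewrite /= in_itv.
Unshelve. all: by end_near. Qed.

(** The number of nodes is fixed before the phase s, because s will be the angle of a maximum point
    of a function built from these nodes. On each step the mean value theorem for a primitive turns
    the error into an oscillation of g. *)
Lemma Riemann_sum_periodic g (e : R) : continuous g ->
  (forall t, g (t + 2 * pi) = g t) -> 0 < e ->
  exists N : nat, forall s, - pi <= s <= pi ->
    `|N.+1%:R^-1 * \sum_(k < N.+1) g (s + k%:R * (2 * pi / N.+1%:R)) - avg g| <= e.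
Proof.
move=> cg gper e0; have p0 := @twopi_gt0 R; have pi0 := pi_gt0 R.
(* The segment from -pi to 3 pi contains every period starting at some s between -pi and pi. *)
have [d d0 Hd] := uniform_continuity_segment (- pi) (3 * pi) cg e0.
have [N Nd] : exists N : nat, 2 * pi / N.+1%:R <= d.
  exists (Num.trunc (2 * pi / d)).
  rewrite ler_pdivrMr ?ltr0n// -ler_pdivrMl// [leLHS]mulrC ltW//.
  by rewrite truncnS_gt.
have [G Gg] := antiderivative_exists (4 * pi + 1) cg.
exists N => s /andP[s1 s2].
set h := 2 * pi / N.+1%:R.
have h0 : 0 < h by rewrite divr_gt0// ltr0n.
have Nh : N.+1%:R * h = 2 * pi by rewrite /h mulrC divfK// pnatr_eq0.
have Gg1 (t : R) : - pi <= t -> is_derive t 1 G (g t) by move=> t1; apply: Gg; lra.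
have step k : (k < N.+1)%N -> `|G (s + k.+1%:R * h) - G (s + k%:R * h) - h * g (s + k%:R * h)| <= h * e.
  move=> kN; set x := s + k%:R * h.
  have xS : s + k.+1%:R * h = x + h by rewrite /x -natr1 mulrDl mul1r addrA.
  rewrite xS.
  have kh0 : 0 <= k%:R * h by rewrite mulr_ge0// ltW.
  have x1 : - pi <= x by rewrite /x; lra.
  have x2 : x <= 3 * pi.
    have : k%:R * h <= N.+1%:R * h by rewrite ler_pM2r// ler_nat ltnW.
    by rewrite Nh /x; lra.
  have xh : x < x + h by rewrite ltrDl.
  have [||c] := @MVT R G g x (x + h) xh.
  - move=> t; rewrite in_itv/= => /andP[xt _]; apply: Gg1; lra.
  - apply: derivable_within_continuous => t; rewrite in_itv/= => /andP[xt _].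
    by have [] := Gg1 t (le_trans x1 xt).
  rewrite in_itv/= => /andP[c1 c2] ->.
  rewrite (_ : g c * _ - _ = h * (g c - g x)); last by ring.
  rewrite normrM gtr0_norm// ler_pM2l//; apply: Hd; first by rewrite x1.
  by rewrite (le_trans _ Nd)// -/h ger0_norm; lra.
have tele n : G (s + n%:R * h) - G s = \sum_(k < n) (G (s + k.+1%:R * h) - G (s + k%:R * h)).
  elim: n => [|n IH]; first by rewrite big_ord0 mul0r addr0 subrr.
  by rewrite big_ord_recr/= -IH; ring.
have avgE : 2 * pi * avg g = G (s + 2 * pi) - G s.
  have -> : 2 * pi * avg g = G (2 * pi) - G 0.
    have Gg' (t : R) : -1 < t -> is_derive t 1 G (g t) by move=> t1; apply: Gg; lra.
    by rewrite (avg_antiderivative_near cg Gg') mulrC divfK// gt_eqF.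
  (* Periodicity of g makes [f] constant, which moves the integral over one period from 0 to s. *)
  pose f (x : R) := G (x * s + 2 * pi) - G (x * s).
  have fd (x : R) : 0 <= x <= 1 -> is_derive x 1 f 0.
    move=> /andP[x0 x1].
    have K1 : is_derive x 1 (fun x : R => x * s) s.
      by apply: is_derive_eq; rewrite scaler0 add0r [LHS]mulr1.
    have K2 : is_derive x 1 (fun x : R => x * s + 2 * pi) s.
      by have := is_deriveD K1 (is_derive_cst (2 * pi) x (1 : R)); rewrite addr0.
    have xs : - pi <= x * s by nra.
    have D1 := @is_derive1_comp R G (fun x => x * s) x _ _ (Gg1 _ xs) K1.
    have xs2 : - pi <= x * s + 2 * pi by lra.
    have D2 := @is_derive1_comp R G (fun x => x * s + 2 * pi) x _ _ (Gg1 _ xs2) K2.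
    by apply: is_derive_eq (is_deriveB D2 D1) _; rewrite gper subrr.
  by have := zero_derive_const fd; rewrite /f mul1r mul0r add0r => ->.
have := tele N.+1; rewrite Nh -avgE => E.
have B : `|2 * pi * avg g - h * \sum_(k < N.+1) g (s + k%:R * h)| <= 2 * pi * e.
  rewrite E mulr_sumr -sumrB (le_trans (ler_norm_sum _ _ _))//.
  rewrite (@le_trans _ _ (\sum_(k < N.+1) h * e))//.
    by apply: ler_sum => k _; exact: step.
  by rewrite sumr_const card_ord -[_ *+ _]mulr_natl mulrA Nh.
rewrite distrC -(ler_pM2l p0) -{1}(gtr0_norm p0) -normrM.
move: B; set S := \sum_(k < _) _ => B.
by rewrite (_ : _ * (_ - _) = 2 * pi * avg g - h * S)// /h; ring.
Qed.

End RiemannSums.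

Section Rotations.
Context {R : realType}.
Implicit Types (c z : plane R) (s t th : R).

Definition rotation c th z : plane R :=
  mkplane (c 0 0 + ((z 0 0 - c 0 0) * cos th - (z 0 1 - c 0 1) * sin th))
          (c 0 1 + ((z 0 0 - c 0 0) * sin th + (z 0 1 - c 0 1) * cos th)).

(** The norm of the plane is the sup norm, which rotations do not preserve; [closed_disc] is a
    sublevel set of this squared Euclidean distance. *)
Definition dist2 c z : R := (z 0 0 - c 0 0) ^+ 2 + (z 0 1 - c 0 1) ^+ 2.

Lemma rot_circle c th z s t : rotation c th (circle z s t) = circle (rotation c th z) s (th + t).
Proof.
rewrite /rotation !circle0 !circle1 circleE !mkplane0 !mkplane1 cosD sinD.
by congr mkplane; ring.
Qed.

Lemma rot_center c th : rotation c th c = c.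
Proof. by rewrite /rotation !subrr !mul0r subr0 addr0 !addr0 -planeE. Qed.

Lemma dist2_rot c th z : dist2 c (rotation c th z) = dist2 c z.
Proof.
rewrite /dist2 /rotation !mkplane0 !mkplane1.
set x := z 0 0 - c 0 0; set y := z 0 1 - c 0 1.
have := cos2Dsin2 th; set a := cos th; set b := sin th => ab.
rewrite [c 0 0 + _]addrC [c 0 1 + _]addrC !addrK.
rewrite (_ : _ + _ = (x ^+ 2 + y ^+ 2) * (a ^+ 2 + b ^+ 2)); last by ring.
by rewrite ab mulr1.
Qed.

Lemma dist2_circle c z s t : dist2 c (circle z s t) =
  dist2 c z + s ^+ 2 + (2 * s * (z 0 0 - c 0 0) * cos t + 2 * s * (z 0 1 - c 0 1) * sin t).
Proof.
rewrite /dist2 circle0 circle1.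
have := cos2Dsin2 t; set a := cos t; set b := sin t => ab.
have -> : s ^+ 2 = s ^+ 2 * (a ^+ 2 + b ^+ 2) by rewrite ab mulr1.
by ring.
Qed.

Lemma coord_dist2 c z i : `|z 0 i - c 0 i| ^+ 2 <= dist2 c z.
Proof.
by rewrite real_normK ?num_real// /dist2; have [->|->] := ord2_cases i;
  rewrite ?lerDl ?lerDr sqr_ge0.
Qed.

Lemma rot_continuous c th : continuous (rotation c th).
Proof.
have cc j (z : plane R) : {for z, continuous (fun z : plane R => z 0 j - c 0 j)}.
  exact: (continuousB (@coord_continuous _ _ _ 0 j z) (@cst_continuous _ _ (c 0 j) z)).
move=> z; apply: row_continuous => i; have [->|->] := ord2_cases i.
  rewrite (_ : (fun x => _) = fun z => c 0 0 + ((z 0 0 - c 0 0) * cos th - (z 0 1 - c 0 1) * sin th)).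
    exact: (continuousD (@cst_continuous _ _ (c 0 0) z) (continuousB
      (continuousM (cc 0 z) (@cst_continuous _ _ (cos th) z))
      (continuousM (cc 1 z) (@cst_continuous _ _ (sin th) z)))).
  by apply/funext => x; rewrite mkplane0.
rewrite (_ : (fun x => _) = fun z => c 0 1 + ((z 0 0 - c 0 0) * sin th + (z 0 1 - c 0 1) * cos th)).
  exact: (continuousD (@cst_continuous _ _ (c 0 1) z) (continuousD
      (continuousM (cc 0 z) (@cst_continuous _ _ (sin th) z))
      (continuousM (cc 1 z) (@cst_continuous _ _ (cos th) z)))).
by apply/funext => x; rewrite mkplane1.
Qed.

Lemma dist2_continuous c : continuous (dist2 c).
Proof.
have cc j (z : plane R) : {for z, continuous (fun z : plane R => z 0 j - c 0 j)}.
  exact: (continuousB (@coord_continuous _ _ _ 0 j z) (@cst_continuous _ _ (c 0 j) z)).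
move=> z; exact: (continuousD (continuousM (cc 0 z) (cc 0 z)) (continuousM (cc 1 z) (cc 1 z))).
Qed.

Lemma polar (x y : R) : x ^+ 2 + y ^+ 2 = 1 ->
  exists2 s, - pi <= s <= pi & cos s = x /\ sin s = y.
Proof.
move=> xy; have x1 : -1 <= x <= 1 by have := sqr_ge0 y; nra.
have yE : Num.sqrt (1 - x ^+ 2) = `|y| by rewrite -xy addrC addKr sqrtr_sqr.
have c := @acosK R x; rewrite in_itv/= in c.
have a0 := acos_ge0 x1; have a1 := acos_lepi x1; have pi0 := pi_gt0 R.
have [y0|y0] := leP 0 y.
  by exists (acos x); [lra|rewrite c// sin_acos// yE ger0_norm].
exists (- acos x); first lra.
by rewrite cosN sinN c// sin_acos// yE ltr0_norm// opprK.
Qed.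

Lemma compact_closed_disc c (r : R) : compact (closed_disc c r).
Proof.
apply: bounded_closed_compact.
  exists (`|c| + `|r|); split=> [|M Mr z zr]; first exact: num_real.
  rewrite /=; apply: le_trans (ltW Mr).
  have -> : z = c + (z - c) by rewrite addrC subrK.
  rewrite (le_trans (ler_normD _ _))// lerD2l.
  apply: row_norm_le => // i; rewrite !mxE.
  have := le_trans (coord_dist2 c z i) zr.
  by rewrite -[r ^+ 2]real_normK ?num_real// ler_sqr// nnegrE.
rewrite (_ : closed_disc c r = dist2 c @^-1` [set x | x <= r ^+ 2])//.
apply: closed_comp; last exact: closed_le.
by move=> z _; exact: dist2_continuous.
Qed.

End Rotations.

(** * The maximum principle for averages over rotations *)

Section GlobalSubmean.
Context {R : realType}.
Implicit Types (c z : plane R) (w : plane R -> R).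

Lemma continuous_sum_at (T : topologicalType) (a : T) n (f : 'I_n -> T -> R) :
  (forall k, {for a, continuous (f k)}) -> {for a, continuous (fun x => \sum_k f k x)}.
Proof.
elim: n f => [|n IH] f fc.
  rewrite (_ : (fun x => _) = fun=> 0); first exact: cst_continuous.
  by apply/funext => x; rewrite big_ord0.
rewrite (_ : (fun x => _) = fun x => f ord0 x + \sum_k f (lift ord0 k) x).
  exact: (continuousD (fc ord0) (IH (fun k => f (lift ord0 k)) (fun k => fc _))).
by apply/funext => x; rewrite big_ord_recl.
Qed.

Lemma near_circle (P : plane R -> Prop) z : (\forall w \near z, P w) ->
  \forall s \near (0 : R)^'+, forall t, P (circle z s t).
Proof.
move=> /nbhs_normP[rho /= rho0 H].
near=> s => t; apply: H; rewrite /= distrC (le_lt_trans (circle_norm _ _ _))//.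
have s0 : 0 < s by near: s; exact: nbhs_right_gt.
by rewrite gtr0_norm//; near: s; exact: nbhs_right_lt.
Unshelve. all: by end_near. Qed.

(** The surplus s^2 is the strict subharmonicity that excludes an interior maximum. *)
Lemma avg_dist2_circle c z (s : R) :
  avg (fun t => dist2 c (circle z s (0 + t))) = dist2 c z + s ^+ 2.
Proof.
have cC (k : R) : continuous (fun _ : R => k) by move=> t; exact: cst_continuous.
have cc (k : R) : continuous (fun t : R => k * cos (0 + t)).
  by apply: continuous_mul; [exact: cC|exact: continuous_cosD].
have cs (k : R) : continuous (fun t : R => k * sin (0 + t)).
  by apply: continuous_mul; [exact: cC|exact: continuous_sinD].
rewrite (_ : (fun t => _) = fun t => (dist2 c z + s ^+ 2) +
    (2 * s * (z 0 0 - c 0 0) * cos (0 + t) + 2 * s * (z 0 1 - c 0 1) * sin (0 + t))); last first.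
  by apply/funext => t; rewrite dist2_circle.
rewrite avgD; [|exact: cC|by apply: continuous_add; [exact: cc|exact: cs]].
rewrite avg_cst avgD; [|exact: cc|exact: cs].
rewrite avgZ; last exact: continuous_cosD.
rewrite avgZ; last exact: continuous_sinD.
by rewrite avg_cosD avg_sinD !mulr0 !addr0.
Qed.

(* Averaging w over the rotations of a regular N-gon and adding delta |z|^2
   gives a function whose maximum over the disc is on the boundary, where
   the average is a Riemann sum of the mean of w. *)
Lemma global_submean c (r : R) w : 0 < r ->
  (forall z, closed_disc c r z -> {for z, continuous w}) ->
  (forall z, dist2 c z < r ^+ 2 -> forall e, 0 < e ->
    \forall s \near (0 : R)^'+, forall al,
      w z <= avg (fun t => w (circle z s (al + t))) + e * s ^+ 2) ->
  w c <= avg (fun t => w (circle c r (0 + t))).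
Proof.
move=> r0 wc wloc; apply/ler_addgt0Pr => e e0.
have e20 : 0 < e / 2 by rewrite divr_gt0.
pose g t := w (circle c r (0 + t)).
have on_circle t : closed_disc c r (circle c r t).
  rewrite /closed_disc/= -/(dist2 c _) dist2_circle /dist2 !subrr.
  by rewrite expr0n/= !mulr0 !mul0r !addr0 add0r.
have cg : continuous g by apply: continuous_circle_comp => t; apply: wc.
have gper t : g (t + 2 * pi) = g t by rewrite /g addrA circle_Dtwopi.
have [N HN] := Riemann_sum_periodic cg gper e20.
pose h : R := 2 * pi / N.+1%:R.
(* On the boundary circle the added term is then d r^2 = e / 2; the other half of e pays for the
   Riemann sum. *)
pose d := e / 2 / r ^+ 2.
have d0 : 0 < d by rewrite divr_gt0// exprn_gt0.
have N0 : 0 < N.+1%:R^-1 :> R by rewrite invr_gt0 ltr0n.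
pose W z := N.+1%:R^-1 * (\sum_(k < N.+1) w (rotation c (k%:R * h) z)) + d * dist2 c z.
have rotK z th : closed_disc c r z -> closed_disc c r (rotation c th z).
  by rewrite /closed_disc/= -!/(dist2 c _) dist2_rot.
have wrot z th : closed_disc c r z -> {for z, continuous (fun z => w (rotation c th z))}.
  move=> zK; apply: (@continuous_comp _ _ _ (rotation c th) w); first exact: rot_continuous.
  exact/wc/rotK.
have Wc z : closed_disc c r z -> {for z, continuous W}.
  move=> zK; apply: continuousD.
    apply: (continuousM (@cst_continuous _ _ _ z)).
    by apply: continuous_sum_at => k; exact: wrot.
  exact: (continuousM (@cst_continuous _ _ d z) (@dist2_continuous R c z)).
have cK : closed_disc c r c.
  by rewrite /closed_disc/= !subrr expr0n/= addr0 sqr_ge0.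
have Kne : closed_disc c r !=set0 by exists c.
have Wwithin : {within closed_disc c r, continuous W}.
  by apply: continuous_in_subspaceT => z /set_mem; exact: Wc.
have [z /set_mem zK zmax] := EVT_max_rV Kne (compact_closed_disc (c := c) (r := r)) Wwithin.
have WcE : W c = w c.
  rewrite /W /dist2 !subrr expr0n/= addr0 mulr0 addr0.
  rewrite (eq_bigr (fun=> w c)); last by move=> k _; rewrite rot_center.
  by rewrite sumr_const card_ord -[w c *+ _]mulr_natl mulrA mulVf ?mul1r// pnatr_eq0.
have wcW : w c <= W z by rewrite -WcE; apply: zmax; rewrite inE.
move: (zK); rewrite /closed_disc/= -/(dist2 c z) le_eqVlt => /orP[/eqP zr|zr].
  have r20 : r != 0 by rewrite gt_eqF.
  have [s sb [cs ss]] : exists2 s : R, - pi <= s <= pi &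
      cos s = (z 0 0 - c 0 0) / r /\ sin s = (z 0 1 - c 0 1) / r.
    by apply: polar; rewrite !expr_div_n -mulrDl -/(dist2 c z) zr divff// expf_neq0.
  have zE : z = circle c r s.
    rewrite circleE cs ss ![r * _]mulrC !divfK//.
    by rewrite [c 0 0 + _]addrC [c 0 1 + _]addrC !subrK -planeE.
  have := HN s sb; rewrite ler_norml => /andP[_ H].
  rewrite (le_trans wcW)// /W zr /d divfK ?expf_neq0//.
  rewrite (_ : \sum_(k < N.+1) _ = \sum_(k < N.+1) g (s + k%:R * (2 * pi / N.+1%:R))); last first.
    apply: eq_bigr => k _; rewrite zE rot_circle rot_center /g add0r.
    by rewrite [s + _]addrC.
  by move: H; rewrite -/g; set S := N.+1%:R^-1 * _; lra.
(* At an interior maximum, small circles lose at most d / 2 s^2 through the approximate sub-mean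
   inequality and gain d s^2 from the squared distance, so the mean of [W] would exceed its
   maximum. *)
exfalso.
pose D0 := [set x | dist2 c x < r ^+ 2].
have oD0 : open D0.
  rewrite (_ : D0 = dist2 c @^-1` [set x | x < r ^+ 2])//.
  by apply: open_comp; [move=> x _; exact: dist2_continuous|exact: open_lt].
have d20 : 0 < d / 2 by rewrite divr_gt0.
have Hloc : \forall s \near (0 : R)^'+, forall (k : 'I_N.+1) al,
    w (rotation c (k%:R * h) z) <= avg (fun t => w (circle (rotation c (k%:R * h) z) s (al + t))) + d / 2 * s ^+ 2.
  by apply: filter_forall => k; apply: wloc => //; rewrite dist2_rot.
have Hin := near_circle (open_near oD0 zr).
near (0 : R)^'+ => s.
have s0 : 0 < s by near: s; exact: nbhs_right_gt.
have sK t : closed_disc c r (circle z s t).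
  apply: ltW; have : forall t, D0 (circle z s t) by near: s; exact: Hin.
  by move=> /(_ t).
have Hs : forall (k : 'I_N.+1) al,
    w (rotation c (k%:R * h) z) <= avg (fun t => w (circle (rotation c (k%:R * h) z) s (al + t))) + d / 2 * s ^+ 2.
  by near: s; exact: Hloc.
(* The phase at the k-th rotated point is chosen as k h: all the small circles are then rotations of
   a single one, with the same parameter t. *)
pose F (k : 'I_N.+1) t := w (circle (rotation c (k%:R * h) z) s (k%:R * h + t)).
have FE k t : F k t = w (rotation c (k%:R * h) (circle z s (0 + t))).
  by rewrite /F rot_circle add0r.
have cF k : continuous (F k).
  apply: continuous_circle_comp => t; apply: wc.
  by rewrite -rot_circle; exact: rotK.
have [cSF aSF] := avg_sum cF.
have cd : continuous (fun t => dist2 c (circle z s (0 + t))).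
  by apply: continuous_circle_comp => t; exact: dist2_continuous.
have cC (k : R) : continuous (fun _ : R => k) by move=> t; exact: cst_continuous.
have A : avg (fun t => N.+1%:R^-1 * (\sum_k F k t) + d * dist2 c (circle z s (0 + t))) <= W z.
  rewrite -[leRHS]avg_cst; apply: ler_avg => [||t].
  - by apply: continuous_add; apply: continuous_mul; [exact: cC|exact: cSF|exact: cC|exact: cd].
  - exact: cC.
  - rewrite (eq_bigr (fun k : 'I_N.+1 => w (rotation c (k%:R * h) (circle z s (0 + t))))) => [|k _]; last exact: FE.
    by apply: zmax; rewrite inE; exact: sK.
have B : W z + d / 2 * s ^+ 2 <= avg (fun t => N.+1%:R^-1 * (\sum_k F k t) + d * dist2 c (circle z s (0 + t))).
  rewrite avgD; [|by apply: continuous_mul; [exact: cC|exact: cSF]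
                 |by apply: continuous_mul; [exact: cC|exact: cd]].
  rewrite avgZ// avgZ// aSF avg_dist2_circle.
  have : \sum_(k < N.+1) w (rotation c (k%:R * h) z) <= \sum_(k < N.+1) (avg (F k) + d / 2 * s ^+ 2).
    by apply: ler_sum => k _; exact: Hs.
  rewrite big_split/= sumr_const card_ord -[d / 2 * s ^+ 2 *+ _]mulr_natl.
  have key (S1 S2 q : R) : S1 <= S2 + N.+1%:R * q -> N.+1%:R^-1 * S1 <= N.+1%:R^-1 * S2 + q.
    by rewrite -(ler_pM2l N0) mulrDr [X in _ + X]mulrA mulVf ?pnatr_eq0// mul1r.
  by move/key; rewrite /W; set S1 := N.+1%:R^-1 * _; set S2 := N.+1%:R^-1 * _; lra.
have : 0 < d / 2 * s ^+ 2 by rewrite mulr_gt0// exprn_gt0.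
by move: A B; set X := avg _; lra.
Unshelve. all: by end_near. Qed.

End GlobalSubmean.

(** * Comparing extended-real circular integrals with means of continuous functions *)

Section IntegralComparison.
Context {R : realType}.
Local Notation mu := (@lebesgue_measure R).

Lemma usc_measurable (G : R -> \bar R) :
  (forall t (a : R), (G t < a%:E)%E -> \forall s \near t, (G s < a%:E)%E) ->
  measurable_fun setT G.
Proof.
move=> uG; have lsc : lower_semicontinuous (fun t => (- G t)%E).
  move=> t a at'; have H : (G t < (- a)%:E)%E by rewrite EFinN lteNr.
  by exists [set s | (G s < (- a)%:E)%E] => [|s /=]; [exact: uG|rewrite EFinN lteNr].
have := lower_semicontinuous_measurable lsc.
move=> /(measurableT_comp (oppe_measurable (D := setT))).
by rewrite (_ : _ \o _ = G)//; apply/funext => t /=; rewrite oppeK.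
Qed.

Lemma EFin_avg (h : R -> R) : continuous h ->
  (avg h)%:E = (((2 * pi)^-1)%:E * \int[mu]_(t in `[0%R, (2 * pi)%R]) (h t)%:E)%E.
Proof.
move=> ch; have ih := continuous_integrable 0 (2 * pi) ch.
by rewrite /avg EFinM /Rintegral fineK//; exact: integrable_fin_num.
Qed.

(** The integral of G may be -oo, so the comparison is made on positive and negative parts
    separately. *)
Lemma integral_le_avg (G : R -> \bar R) (h : R -> R) :
  measurable_fun setT G -> continuous h -> (forall t, (G t <= (h t)%:E)%E) ->
  (((2 * pi)^-1)%:E * \int[mu]_(t in `[0%R, (2 * pi)%R]) G t <= (avg h)%:E)%E.
Proof.
move=> mG ch Gh; rewrite EFin_avg//.
apply: lee_wpmul2l; first by rewrite lee_fin invr_ge0 ltW// twopi_gt0.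
have mI : measurable (`[0, 2 * pi]%classic : set R) by exact: measurable_itv.
have mG' : measurable_fun `[0, 2 * pi] G by apply: measurable_funS mG.
have mh : measurable_fun `[0, 2 * pi] (EFin \o h).
  by have /integrableP[] := continuous_integrable 0 (2 * pi) ch.
rewrite integralE [leRHS]integralE; apply: leeB.
- apply: ge0_le_integral => //.
  + exact: measurable_funepos.
  + exact: measurable_funepos.
  + by move=> t _; rewrite !funepos.unlock ge_max !le_max Gh lexx orbT.
- apply: ge0_le_integral => //.
  + exact: measurable_funeneg.
  + exact: measurable_funeneg.
  + by move=> t _; rewrite !funeneg.unlock ge_max !le_max leeN2 Gh lexx orbT.
Qed.

End IntegralComparison.

(** * Sup-convolutions *)

Section SupConvolution.
Context {R : realType}.
Implicit Types (x p e : quat R) (z : plane R).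

Lemma dotq_sqB p q : dotq (p - q) (p - q) = dotq p p - 2 * dotq p q + dotq q q.
Proof. by rewrite /dotq !coordE; ring. Qed.

Lemma dotq_le p q (a b : R) : `|p| <= a -> `|q| <= b -> `|dotq p q| <= 4 * (a * b).
Proof.
move=> pa qb.
have t j : `|p 0 j * q 0 j| <= a * b.
  rewrite normrM ler_pM//.
    exact: le_trans (normr_coord_le _ _ _) pa.
  exact: le_trans (normr_coord_le _ _ _) qb.
have t0 := t 0; have t1 := t 1; have t2 := t 2; have t3 := t 3.
rewrite /dotq (le_trans (ler_normD _ _))//.
have h1 := ler_normD (p 0 0 * q 0 0 + p 0 1 * q 0 1) (p 0 2 * q 0 2).
have h2 := ler_normD (p 0 0 * q 0 0) (p 0 1 * q 0 1).
by clear t; apply: le_trans (lerD (le_trans h1 (lerD (le_trans h2 (lerD t0 t1)) t2)) t3) _; lra.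
Qed.

Lemma coord_sq_le p j : `|p 0 j| ^+ 2 <= dotq p p.
Proof.
have sq i : 0 <= p 0 i * p 0 i by rewrite -expr2 sqr_ge0.
have := sq 0; have := sq 1; have := sq 2; have := sq 3.
rewrite real_normK ?num_real// expr2 /dotq; case: j => -[|[|[|[|//]]]] i.
- by rewrite (_ : Ordinal i = 0); [lra|exact: val_inj].
- by rewrite (_ : Ordinal i = 1); [lra|exact: val_inj].
- by rewrite (_ : Ordinal i = 2); [lra|exact: val_inj].
- by rewrite (_ : Ordinal i = 3); [lra|exact: val_inj].
Qed.

Lemma dotq_sq_ge0 p : 0 <= dotq p p.
Proof. by rewrite (le_trans _ (coord_sq_le p 0))// sqr_ge0. Qed.

Variables (Omega : set (quat R)) (u : quat R -> \bar R) (D : set (plane R))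
  (F : plane R -> quat R) (c : plane R) (r delta C0 : R).
Hypotheses (oD : open D) (FC : C1_on D F) (KD : closed_disc c r `<=` D)
  (delta0 : 0 < delta)
  (FX : forall z x, closed_disc c r z -> `|x - F z| <= delta ->
     Omega x /\ (u x <= C0%:E)%E)
  (C00 : 0 <= C0).

(** The supremum is restricted to this neighbourhood of the image of the disc because u is bounded
    above by C0 there. *)
Definition tube : set (quat R) :=
  [set x | exists2 z, closed_disc c r z & `|x - F z| <= delta].

(* On the tube, u < +oo, so that the argument of fine is a real number. *)
Definition trunc_below n x : R := fine (maxe (u x) (- n%:R)%:E).

(** On the tube the truncated function lies between -n and C0, so the weight n^2 eventually forces
    near-maximizers within delta / 2 of F z; they can then be displaced without leaving the tube. *)
Definition penalized n z x : R :=
  trunc_below n x - n%:R ^+ 2 * dotq (x - F z) (x - F z).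

Definition supconv n z : R := sup (penalized n z @` tube).

Lemma tube_center z : closed_disc c r z -> tube (F z).
Proof. by move=> zK; exists z; rewrite // subrr normr0 ltW. Qed.

Lemma tube_le x : tube x -> (u x <= C0%:E)%E.
Proof. by move=> [z zK] /(FX zK)[]. Qed.

Lemma trunc_belowE n x : tube x -> (trunc_below n x)%:E = maxe (u x) (- n%:R)%:E.
Proof.
move=> /tube_le ux; rewrite /trunc_below fineK//; apply/fin_numPlt/andP; split.
  by rewrite lt_max ltNyr orbT.
by rewrite gt_max ltry andbT (le_lt_trans ux)// ltry.
Qed.

Lemma trunc_below_ge n x : tube x -> - n%:R <= trunc_below n x.
Proof. by move=> Xx; rewrite -lee_fin trunc_belowE// le_max lexx orbT. Qed.

Lemma trunc_below_ge_u n x : tube x -> (u x <= (trunc_below n x)%:E)%E.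
Proof. by move=> Xx; rewrite trunc_belowE// le_max lexx. Qed.

Lemma trunc_below_le n x : tube x -> trunc_below n x <= C0.
Proof.
move=> Xx; rewrite -lee_fin trunc_belowE// ge_max (tube_le Xx)/= lee_fin.
by rewrite (le_trans _ C00)// oppr_le0.
Qed.

Lemma penalized_le n z x : tube x -> penalized n z x <= C0.
Proof.
move=> Xx; rewrite (le_trans _ (trunc_below_le n Xx))// /penalized lerBlDr lerDl.
by rewrite mulr_ge0// ?sqr_ge0// dotq_sq_ge0.
Qed.

Lemma disc_center : closed_disc c r c.
Proof. by rewrite /closed_disc/= !subrr expr0n/= addr0 sqr_ge0. Qed.

Lemma has_sup_penalized n z : has_sup (penalized n z @` tube).
Proof.
split; first by exists (penalized n z (F c)), (F c) => //; exact/tube_center/disc_center.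
by exists C0 => _ [x Xx <-]; exact: penalized_le.
Qed.

Lemma penalized_le_supconv n z x : tube x -> penalized n z x <= supconv n z.
Proof.
by move=> Xx; apply: sup_upper_bound; [exact: has_sup_penalized|exists x].
Qed.

Lemma supconv_le n z (a : R) : (forall x, tube x -> penalized n z x <= a) ->
  supconv n z <= a.
Proof.
move=> H; apply: ge_sup; first by have [] := has_sup_penalized n z.
by move=> _ [x Xx <-]; exact: H.
Qed.

Lemma supconv_adherent n z (e : R) : 0 < e ->
  exists2 x, tube x & supconv n z - e < penalized n z x.
Proof.
move=> e0; have [_ [x Xx <-] H] := sup_adherent e0 (has_sup_penalized n z).
by exists x.
Qed.

Lemma supconv_ge n z : closed_disc c r z -> trunc_below n (F z) <= supconv n z.
Proof.
move=> zK; have := penalized_le_supconv n z (tube_center zK).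
by rewrite /penalized subrr /dotq !mxE !mulr0 !addr0 mulr0 subr0.
Qed.

Lemma supconv_ge_u n z : closed_disc c r z -> (u (F z) <= (supconv n z)%:E)%E.
Proof.
move=> zK; rewrite (le_trans (trunc_below_ge_u n (tube_center zK)))//.
by rewrite lee_fin supconv_ge.
Qed.

Lemma supconv_decr m n z : (m <= n)%N -> supconv n z <= supconv m z.
Proof.
move=> mn; apply: supconv_le => x Xx.
rewrite (le_trans _ (penalized_le_supconv m z Xx))// /penalized lerB//.
  rewrite -lee_fin !trunc_belowE// ge_max !le_max lexx/= lee_fin lerN2 ler_nat mn.
  by rewrite orbT.
by rewrite ler_wpM2r ?dotq_sq_ge0// ler_sqr ?nnegrE// ler_nat.
Qed.

Lemma disc_continuous z : closed_disc c r z -> {for z, continuous F}.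
Proof. by move=> /KD; exact: C1_on_continuous. Qed.

Lemma tube_bounded : exists M : R, forall x, tube x -> `|x| <= M.
Proof.
have cF : {within closed_disc c r, continuous F}.
  by apply: continuous_in_subspaceT => z /set_mem; exact: disc_continuous.
have := compact_bounded (continuous_compact cF (compact_closed_disc (c := c) (r := r))).
move=> [M [_ HM]]; exists (M + 1 + delta) => x [z zK xz].
have Fz : `|F z| <= M + 1 by apply: (HM (M + 1)); [rewrite ltrDl|exists z].
have -> : x = F z + (x - F z) by rewrite addrC subrK.
by rewrite (le_trans (ler_normD _ _))// lerD.
Qed.

(** The penalties at a and a' differ by n^2 times the scalar product of F a - F a' with 2 x - (F a +
    F a'). As the tube is bounded, this is small uniformly in x, and the suprema are close. *)
Lemma supconv_continuous n z : closed_disc c r z -> {for z, continuous (supconv n)}.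
Proof.
move=> zK; have [M HM] := tube_bounded.
have M0 : 0 <= M by rewrite (le_trans _ (HM _ (tube_center disc_center))).
(* [L] bounds |2 x - (F a + F a')| when one of a, a' is z and the other is near it. The factor 4 in
   [B] is that of [dotq_le], and the summand 1 keeps [B] positive. *)
pose L := 2 * M + 2 * `|F z| + 1.
have L0 : 0 < L by rewrite /L; have := normr_ge0 (F z); move: (M0); lra.
pose B := n%:R ^+ 2 * (4 * L) + 1.
have B0 : 0 < B by rewrite /B ltr_wpDl// mulr_ge0// ?sqr_ge0// mulr_ge0// ltW.
have near_le (a a' : plane R) : `|F a| <= `|F z| + 1 -> `|F a' | <= `|F z| + 1 ->
    `|F a + F a'| <= 2 * `|F z| + 1 ->
    supconv n a <= supconv n a' + `|F a - F a'| * B.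
  move=> _ _ aa; apply: supconv_le => x Xx.
  rewrite -lerBlDr (le_trans _ (penalized_le_supconv n a' Xx))// /penalized.
  have E : dotq (x - F a') (x - F a') - dotq (x - F a) (x - F a) =
      dotq (F a - F a') (2 *: x - (F a + F a')).
    by rewrite /dotq !coordE; ring.
  have b2 : `|2 *: x - (F a + F a')| <= L.
    rewrite (le_trans (ler_normB _ _))// /L -addrA lerD// normrZ ger0_norm// ler_pM2l//.
    exact: HM.
  have := dotq_le (lexx `|F a - F a'|) b2; rewrite -E ler_norml => /andP[_ b3].
  have n0 : 0 <= n%:R ^+ 2 :> R by rewrite sqr_ge0.
  have arith (N k T d1 d2 : R) : 0 <= N -> 0 <= k -> d1 - d2 <= 4 * (k * L) ->
      T - N * d2 - k * (N * (4 * L) + 1) <= T - N * d1.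
    move=> N0 k0 /(ler_wpM2l N0) H.
    rewrite -subr_ge0 (_ : _ - _ = (N * (4 * (k * L)) - N * (d1 - d2)) + k); last by ring.
    by rewrite addr_ge0// subr_ge0.
  exact: (arith _ _ _ _ _ n0 (normr_ge0 (F a - F a')) b3).
apply: (@cvgrPdist_le _ _ _ (nbhs z) _ (supconv n) (supconv n z)).2 => e e0.
have m0 : 0 < Num.min 1 (e / B) by rewrite lt_min ltr01 divr_gt0.
have H : \forall a \near z, `|F z - F a| < Num.min 1 (e / B).
  exact: (cvgr_dist_lt _ _ (disc_continuous zK)).
apply: filterS H => a; rewrite lt_min => /andP[a1 ae].
have Fa : `|F a| <= `|F z| + 1.
  have -> : F a = F z - (F z - F a) by rewrite subKr.
  by rewrite (le_trans (ler_normB _ _))// lerD2l ltW.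
have Fz : `|F z| <= `|F z| + 1 by rewrite lerDl.
have s1 : `|F z + F a| <= 2 * `|F z| + 1.
  by rewrite (le_trans (ler_normD _ _))//; lra.
have s2 : `|F a + F z| <= 2 * `|F z| + 1 by rewrite addrC.
have h1 := near_le z a Fz Fa s1; have h2 := near_le a z Fa Fz s2.
have h3 : `|F z - F a| * B <= e by rewrite -ler_pdivlMr// ltW.
rewrite [`|F a - F z|]distrC in h2.
by rewrite ler_norml; apply/andP; split; move: (h1) (h2) (h3); lra.
Qed.

End SupConvolution.

(** * The sub-mean inequality along translated complex lines *)

Section LineSubmean.
Context {R : realType}.
Implicit Types (x B : quat R) (w z : plane R).

Lemma slice_mul I w (a b : R) : imag_units I ->
  qmul (slice I w) (slice I (mkplane a b)) =
  slice I (mkplane (w 0 0 * a - w 0 1 * b) (w 0 0 * b + w 0 1 * a)).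
Proof.
move=> II; rewrite /slice !mkplane0 !mkplane1 !qmulDl !qmulDr !qmulZl !qmulZr.
rewrite !qmul1q !qmulq1 (II : qmul I I = _); move: (qone R) => o.
by apply/rowP => j; rewrite !mxE; ring.
Qed.

Lemma slice_rotation I al w : imag_units I ->
  qmul (slice I w) (slice I (mkplane (cos al) (sin al))) = slice I (rotation 0 al w).
Proof.
by move=> II; rewrite slice_mul// /rotation ![(0 : plane R) _ _]mxE !subr0 !add0r.
Qed.

Lemma usc_circle_measurable (D : set (plane R)) (v : plane R -> \bar R) c (r : R) :
  usc_on D v -> (forall t, D (circle c r t)) ->
  measurable_fun setT (fun t => v (circle c r t)).
Proof.
move=> [_ uv] Dc; apply: usc_measurable => t a vta.
have cc : {for t, continuous (circle c r)}.
  rewrite (_ : circle c r = fun t => circle c r (0 + t)); first exact: continuous_circle.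
  by apply/funext => s; rewrite add0r.
have H : \forall s \near t, D (circle c r s) -> (v (circle c r s) < a%:E)%E.
  exact: (cc _ (uv _ (Dc t) a vta)).
by apply: filterS H => s; apply.
Qed.

Lemma circle_in_disc c (r t : R) : closed_disc c r (circle c r t).
Proof.
rewrite /closed_disc/= -/(dist2 c _) dist2_circle /dist2 !subrr.
by rewrite expr0n/= !mulr0 !mul0r !addr0 add0r.
Qed.

(** Replacing the direction B by exp(I al) B rotates the parametrization of the line, so that its
    circles start at the angle al. *)
Lemma line_submean (Omega : set (quat R)) (u : quat R -> \bar R) I x B (s al : R)
    (h : R -> R) :
  imag_units I -> plurisubharmonic_on I Omega u -> 0 < s ->
  (forall w, closed_disc 0 s w -> Omega (x + qmul (slice I w) B)) ->
  continuous h ->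
  (forall t, (u (x + qmul (slice I (circle 0 s (al + t))) B)%R <= (h t)%:E)%E) ->
  (u x <= (avg h)%:E)%E.
Proof.
move=> II [_ /(_ x (qmul (slice I (mkplane (cos al) (sin al))) B))] + s0 inO ch uh.
set B' := qmul _ B => -[uscv subv].
have clE w : cline I x B' w = x + qmul (slice I (rotation 0 al w)) B.
  by rewrite /cline /B' qmulA slice_rotation.
have sub : closed_disc 0 s `<=` cline I x B' @^-1` Omega.
  by move=> w ws; rewrite /= clE; apply: inO; rewrite /closed_disc/= -/(dist2 0 _) dist2_rot.
have := subv 0 s s0 sub; rewrite /= cline0 => /le_trans; apply.
apply: integral_le_avg => //.
  by apply: (usc_circle_measurable uscv) => t; apply/sub/circle_in_disc.
by move=> t; rewrite clE rot_circle rot_center; exact: uh.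
Qed.

End LineSubmean.

(** * The approximate sub-mean inequality for the sup-convolution *)

Section LocalSubmean.
Context {R : realType}.
Implicit Types (x p : quat R) (z : plane R).
Variables (Omega : set (quat R)) (u : quat R -> \bar R) (I : quat R)
  (D : set (plane R)) (F : plane R -> quat R) (c : plane R) (r delta C0 : R).
Hypotheses (II : imag_units I) (uI : plurisubharmonic_on I Omega u)
  (oD : open D) (FC : C1_on D F)
  (Fd : forall z, D z -> 'D_(dirE R 1) F z = qmul I ('D_(dirE R 0) F z))
  (KD : closed_disc c r `<=` D) (delta0 : 0 < delta)
  (FX : forall z x, closed_disc c r z -> `|x - F z| <= delta ->
     Omega x /\ (u x <= C0%:E)%E)
  (C00 : 0 <= C0).

Lemma avg_dotq_circle z : D z -> exists2 rho : R, 0 < rho &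
  forall l s al, `|s| < rho ->
    continuous (fun t => dotq l (F (circle z s (al + t)))) /\
    avg (fun t => dotq l (F (circle z s (al + t)))) = dotq l (F z).
Proof.
move=> Dz.
have H i : \forall w \near z, `|'D_(dirE R i) F z - 'D_(dirE R i) F w| <= 1.
  by have [_ cf] := FC i Dz; exact: (cvgr_dist_le _ _ cf).
have : \forall w \near z, D w /\
    forall i, `|'D_(dirE R i) F z - 'D_(dirE R i) F w| <= 1.
  near=> w; split; first by near: w; exact: (open_near oD Dz).
  by near: w; apply: filter_forall => i; exact: H.
move=> /nbhs_normP[rho /= rho0 Hrho].
pose M := `|'D_(dirE R 0) F z| + `|'D_(dirE R 1) F z| + 1.
have aM (a b : R) : 0 <= a -> 0 <= b -> a <= a + b /\ b <= a + b by lra.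
have Mi i : `|'D_(dirE R i) F z| <= `|'D_(dirE R 0) F z| + `|'D_(dirE R 1) F z|.
  have [M0 M1] := aM _ _ (normr_ge0 ('D_(dirE R 0) F z)) (normr_ge0 ('D_(dirE R 1) F z)).
  by have [->|->] := ord2_cases i; [exact: M0|exact: M1].
exists rho; first exact: rho0.
move=> l s al sr.
have ub : partials_bounded D (fun z => dotq l (F z)) z rho (4 * (`|l| * M)).
  move=> w wz; have [|Dw Hw] := Hrho w; first by rewrite /= distrC.
  split=> // i; have [df _] := FC i Dw.
  have [_ ->] := is_derive_dotq l df; apply: dotq_le => //.
  have := Hw i; set a := 'D_(dirE R i) F z; set b := 'D_(dirE R i) F w => ab.
  have -> : b = a - (a - b) by rewrite subKr.
  exact: (le_trans (ler_normB _ _) (lerD (Mi i) ab)).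
have cr := cauchy_riemann_rot oD (dotq_cauchy_riemann l oD II FC Fd).
have [gC _ _ _] := cr.
have [cu _] := C1_continuous_circle oD ub al gC sr.
exact (conj cu (avg_circle oD cr ub al sr)).
Unshelve. all: by end_near. Qed.

Lemma expand_circle z (eta : R) : D z -> 0 < eta -> \forall s \near (0 : R)^'+,
  forall t, `|F (circle z s t) - F z -
      qmul (slice I (circle 0 s t)) ('D_(dirE R 0) F z)| <= eta * s.
Proof.
move=> Dz eta0; set B := 'D_(dirE R 0) F z.
(* The half compensates |cos t| + |sin t| <= 2. *)
have e0 : 0 < eta / 2 by rewrite divr_gt0.
pose Q (j : 'I_4) (w : plane R) :=
    `|dotq (delta_mx 0 j) (F w) - dotq (delta_mx 0 j) (F z) -
      (dotq (delta_mx 0 j) B * (w 0 0 - z 0 0) +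
       dotq (delta_mx 0 j) (qmul I B) * (w 0 1 - z 0 1))| <=
    eta / 2 * (`|w 0 0 - z 0 0| + `|w 0 1 - z 0 1|).
have HQ j : \forall w \near z, Q j w.
  have := C1_expand oD (C1_on_dotq (delta_mx 0 j) oD FC) Dz e0.
  have [d0 _] := FC 0 Dz; have [d1 _] := FC 1 Dz.
  have [_ ->] := is_derive_dotq (delta_mx 0 j) d0.
  by have [_ ->] := is_derive_dotq (delta_mx 0 j) d1; rewrite (Fd Dz).
have H : \forall w \near z, forall j, Q j w.
  by near=> w; near: w; apply: filter_forall => j; exact: HQ.
near=> s => t.
have s0 : 0 < s by near: s; exact: nbhs_right_gt.
have Hs : forall t j, Q j (circle z s t) by near: s; exact: near_circle H.
apply: row_norm_le => [|j]; first by rewrite mulr_ge0// ltW.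
have := Hs t j; rewrite /Q -!coord_dotq circle0 circle1.
have cancel (a k : R) : a + k - a = k by ring.
rewrite !cancel !normrM (gtr0_norm s0) => Hj.
have -> : (F (circle z s t) - F z - qmul (slice I (circle 0 s t)) B) 0 j =
    F (circle z s t) 0 j - F z 0 j - (B 0 j * (s * cos t) + qmul I B 0 j * (s * sin t)).
  rewrite /slice circle0 circle1 ![(0 : plane R) _ _]mxE !add0r qmulDl !qmulZl qmul1q.
  by rewrite !coordD !coordN !coordD !coordZ; ring.
rewrite (le_trans Hj)//.
have := cos_norm_le t; have := sin_norm_le t => cs sn.
have : s * `|cos t| + s * `|sin t| <= s + s.
  by rewrite lerD// ler_piMr// ltW.
by move=> /(ler_wpM2l (ltW e0)); lra.
Unshelve. all: by end_near. Qed.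

Local Notation W := (supconv u F c r delta).

(* If x = F z + p nearly attains the supremum at z, then x + zeta B, with
   zeta = s e^(it) and B = F'(z), is admissible at z + zeta; the penalty there
   is that of p - E, where E, the remainder of the expansion of F at z, is
   o(s) and has mean zero, and u satisfies the sub-mean inequality along
   zeta |-> x + zeta B. *)
Lemma supconv_local_submean n z (e : R) :
  C0 + n%:R + 1 < n%:R ^+ 2 * (delta / 2) ^+ 2 -> dist2 c z < r ^+ 2 -> 0 < e ->
  \forall s \near (0 : R)^'+, forall al,
    W n z <= avg (fun t => W n (circle z s (al + t))) + e * s ^+ 2.
Proof.
move=> nbig zr e0.
have zK : closed_disc c r z by exact: ltW.
have Dz := KD zK; set B := 'D_(dirE R 0) F z.
pose N : R := n%:R ^+ 2.
have N0 : 0 <= N by rewrite /N sqr_ge0.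
(* The quadratic part of the penalty costs at most 4 N eta^2 s^2, and eta^2 <= eta since eta <=
   1. *)
pose eta := Num.min 1 (e / (4 * N + 1)).
have N1 : 0 < 4 * N + 1 by rewrite ltr_wpDl// mulr_ge0.
have eta0 : 0 < eta by rewrite lt_min ltr01 divr_gt0.
have eta_e : 4 * N * eta ^+ 2 <= e.
  have eta1 : eta <= 1 by rewrite ge_min lexx.
  have etae : eta * (4 * N + 1) <= e by rewrite -ler_pdivlMr// ge_min lexx orbT.
  by have : N * eta ^+ 2 <= N * eta; [rewrite ler_wpM2l// expr2 ler_piMl// ltW|move: etae eta0; lra].
have [rho rho0 Hrho] := avg_dotq_circle Dz.
pose D0 := [set x | dist2 c x < r ^+ 2].
have oD0 : open D0.
  rewrite (_ : D0 = dist2 c @^-1` [set x | x < r ^+ 2])//.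
  by apply: open_comp; [move=> x _; exact: dist2_continuous|exact: open_lt].
have Hin := near_circle (open_near oD0 zr).
have Hexp := expand_circle Dz eta0.
pose b := `|B| + `|qmul I B| + 1.
have b0 : 0 < b by rewrite ltr_wpDl// addr_ge0.
near=> s => al.
have s0 : 0 < s by near: s; exact: nbhs_right_gt.
have srho : `|s| < rho by rewrite gtr0_norm//; near: s; exact: nbhs_right_lt.
have sb : s * b <= delta / 2.
  rewrite -ler_pdivlMr// ltW//; near: s; apply: nbhs_right_lt.
  by rewrite !divr_gt0.
have sK t : closed_disc c r (circle z s t).
  have H : forall t, D0 (circle z s t) by near: s; exact: Hin.
  exact: ltW (H t).
have sexp t : `|F (circle z s t) - F z - qmul (slice I (circle 0 s t)) B| <= eta * s.
  move: t; by near: s; exact: Hexp.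
have sB w : closed_disc 0 s w -> `|qmul (slice I w) B| <= delta / 2.
  move=> ws; rewrite (le_trans _ sb)// /slice qmulDl !qmulZl qmul1q.
  have wj j : `|w 0 j| <= s.
    have := le_trans (coord_dist2 0 w j) ws.
    by rewrite mxE subr0 ler_sqr// nnegrE// ltW.
  rewrite (le_trans (ler_normD _ _))// !normrZ.
  have h0 : `|w 0 0| * `|B| <= s * `|B| by rewrite ler_wpM2r.
  have h1 : `|w 0 1| * `|qmul I B| <= s * `|qmul I B| by rewrite ler_wpM2r.
  by move: (h0) (h1) (s0); rewrite /b; lra.
apply/ler_addgt0Pr => eps eps0.
pose eps' := Num.min eps 1.
have eps'0 : 0 < eps' by rewrite lt_min eps0 ltr01.
have [x Xx Hx] := supconv_adherent delta0 FX C00 n z eps'0.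
have eps1 : eps' <= 1 by rewrite ge_min lexx orbT.
have epsle : eps' <= eps by rewrite ge_min lexx.
set p := x - F z.
(* The near-maximum exceeds W - 1 >= -n - 1 while the truncated function is at most C0, so the
   penalty of x is below C0 + n + 1; the hypothesis on n then confines p. *)
have pd : `|p| <= delta / 2.
  have W1 : - n%:R <= W n z.
    exact: (le_trans (trunc_below_ge FX n (tube_center F delta0 zK)) (supconv_ge delta0 FX C00 n zK)).
  have T1 := trunc_below_le FX C00 n Xx.
  have Np : N * dotq p p < N * (delta / 2) ^+ 2.
    apply: lt_trans nbig; move: Hx; rewrite /penalized -/p -/N.
    by move: (trunc_below u n x) (W n z) T1 W1 => T Wz T1 W1 Hx; lra.
  have pp : dotq p p < (delta / 2) ^+ 2.
    by rewrite ltNge; apply/negP => /(ler_wpM2l N0) /le_lt_trans/(_ Np); rewrite ltxx.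
  apply: row_norm_le => [|j]; first by rewrite ltW// divr_gt0.
  have := le_lt_trans (coord_sq_le p j) pp.
  have pn : `|p 0 j| \is Num.nneg by rewrite nnegrE.
  have dn : delta / 2 \is Num.nneg by rewrite nnegrE ltW// divr_gt0.
  by rewrite ltr_sqr// => /ltW.
pose zeta t := qmul (slice I (circle 0 s t)) B.
pose E t := F (circle z s t) - F z - zeta t.
have tubeB w : closed_disc 0 s w -> tube F c r delta (x + qmul (slice I w) B).
  move=> /sB wB; exists z => //.
  rewrite (_ : _ - _ = p + qmul (slice I w) B); last by rewrite /p addrAC.
  by rewrite (le_trans (ler_normD _ _))// (splitr delta) lerD.
(* [h] dominates the truncated function along the displaced circle: the penalty of p - E is
   expanded, its square term in E replaced by a constant bound, and its linear term kept because its
   mean will vanish. *)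
pose h t := W n (circle z s (al + t)) + (N * (dotq p p + 4 * (eta * s * (eta * s))) -
  2 * N * dotq p (E (al + t))).
have trunc_h t : trunc_below u n (x + zeta (al + t)) <= h t.
  have := penalized_le_supconv delta0 FX C00 n (circle z s (al + t))
    (tubeB _ (circle_in_disc 0 s (al + t))).
  rewrite /penalized (_ : _ - F _ = p - E (al + t)); last first.
    by rewrite /p /E /zeta; apply/rowP => j; rewrite !mxE; ring.
  rewrite dotq_sqB -/N lerBlDr => /le_trans; apply.
  rewrite /h lerD2l.
  have := dotq_le (sexp (al + t)) (sexp (al + t)); rewrite -/(E (al + t)).
  rewrite ler_norml => /andP[_ /(ler_wpM2l N0)].
  set d1 := dotq p p; set d2 := dotq p _; set d3 := dotq _ _ => HN.
  have -> : N * (d1 + 4 * (eta * s * (eta * s))) - 2 * N * d2 =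
    N * (d1 - 2 * d2) + N * (4 * (eta * s * (eta * s))) by ring.
  by rewrite mulrDr lerD2l.
have dotE t : dotq p (E (al + t)) = dotq p (F (circle z s (al + t))) -
    (dotq p (F z) + (s * dotq p B * cos (al + t) + s * dotq p (qmul I B) * sin (al + t))).
  rewrite /E /zeta /slice circle0 circle1 ![(0 : plane R) _ _]mxE !add0r qmulDl !qmulZl qmul1q.
  by rewrite /dotq !coordE; ring.
have [cG aG] := Hrho p s al srho.
have cC (k : R) : continuous (fun _ : R => k) by move=> t; exact: cst_continuous.
have cc (k : R) : continuous (fun t : R => k * cos (al + t)).
  by apply: continuous_mul; [exact: cC|exact: continuous_cosD].
have cs (k : R) : continuous (fun t : R => k * sin (al + t)).
  by apply: continuous_mul; [exact: cC|exact: continuous_sinD].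
have clin : continuous (fun t => dotq p (F z) + (s * dotq p B * cos (al + t) + s * dotq p (qmul I B) * sin (al + t))).
  by apply: continuous_add; [exact: cC|apply: continuous_add; [exact: cc|exact: cs]].
have EE : (fun t => dotq p (E (al + t))) = (fun t => dotq p (F (circle z s (al + t))) -
    (dotq p (F z) + (s * dotq p B * cos (al + t) + s * dotq p (qmul I B) * sin (al + t)))).
  by apply/funext => t; exact: dotE.
have cE : continuous (fun t => dotq p (E (al + t))).
  by rewrite EE => t; apply: cvgB; [exact: cG|exact: clin].
have aE : avg (fun t => dotq p (E (al + t))) = 0.
  rewrite EE avgB// aG avgD; [|exact: cC|by apply: continuous_add; [exact: cc|exact: cs]].
  rewrite avg_cst avgD; [|exact: cc|exact: cs].
  rewrite avgZ; last exact: continuous_cosD.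
  rewrite avgZ; last exact: continuous_sinD.
  by rewrite avg_cosD avg_sinD !mulr0 !addr0 subrr.
have cW : continuous (fun t => W n (circle z s (al + t))).
  apply: (@continuous_circle_comp R (W n)) => t.
  have H := supconv_continuous oD FC KD delta0 FX C00; exact: (H n _ (sK (al + t))).
have c2E : continuous (fun t => 2 * N * dotq p (E (al + t))).
  by apply: continuous_mul; [exact: cC|exact: cE].
pose K := N * (dotq p p + 4 * (eta * s * (eta * s))).
have cK2 : continuous (fun t => K - 2 * N * dotq p (E (al + t))).
  by move=> t; apply: cvgB; [exact: cC|exact: c2E].
have ch : continuous h by apply: continuous_add; [exact: cW|exact: cK2].
have ah : avg h = avg (fun t => W n (circle z s (al + t))) + K.
  rewrite /h avgD; [|exact: cW|exact: cK2].
  rewrite avgB; [|exact: cC|exact: c2E].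
  by rewrite avg_cst avgZ// aE mulr0 subr0.
(* The truncated function is a maximum of two: u satisfies the sub-mean inequality on the line, and
   the constant -n lies below [h] pointwise. *)
have trunc_avg : trunc_below u n x <= avg h.
  rewrite -lee_fin (trunc_belowE FX n Xx) ge_max; apply/andP; split.
    apply: (line_submean II uI s0 (B := B) (al := al) _ ch) => [w ws|t].
      by have [z' z'K xz'] := tubeB _ ws; have [] := FX z'K xz'.
    rewrite (le_trans (trunc_below_ge_u FX n (tubeB _ (circle_in_disc _ _ _))))//.
    by rewrite lee_fin; exact: trunc_h.
  rewrite lee_fin -[leLHS]avg_cst; apply: ler_avg => [||t]; [exact: cC|exact: ch|].
  rewrite (le_trans _ (trunc_h t))//.
  exact: (trunc_below_ge FX n (tubeB _ (circle_in_disc _ _ _))).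
move: Hx; rewrite /penalized -/p -/N; move: trunc_avg; rewrite ah /K.
have : 4 * N * eta ^+ 2 * s ^+ 2 <= e * s ^+ 2 by rewrite ler_wpM2r// sqr_ge0.
rewrite (_ : 4 * N * _ * _ = N * (4 * (eta * s * (eta * s)))); last by ring.
rewrite mulrDr; set a1 := N * dotq p p; set a2 := N * _.
move: (trunc_below u n x) (W n z) (avg _) (e * _) epsle => T Wz A es; lra.
Unshelve. all: by end_near. Qed.

End LocalSubmean.

(** * Passage to the limit in the sup-convolutions *)

Section Limit.
Context {R : realType}.
Implicit Types (x p : quat R) (z : plane R).
Local Notation mu := (@lebesgue_measure R).

Lemma ereal_lt_between (y : \bar R) (a : R) : (y < a%:E)%E ->
  exists2 b : R, (y < b%:E)%E & b < a.
Proof.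
case: y => [y| |]//.
  by rewrite lte_fin => ya; exists ((y + a) / 2); rewrite ?lte_fin; lra.
by move=> _; exists (a - 1); [exact: ltNyr|lra].
Qed.

Lemma norm_sq_le_dotq p : `|p| ^+ 2 <= dotq p p.
Proof.
have p0 := dotq_sq_ge0 p.
rewrite -[leRHS]sqr_sqrtr// ler_sqr ?nnegrE ?sqrtr_ge0//.
apply: row_norm_le => [|j]; first exact: sqrtr_ge0.
by rewrite -ler_sqr ?nnegrE ?sqrtr_ge0// sqr_sqrtr// coord_sq_le.
Qed.

Lemma usc_comp (Omega : set (quat R)) (u : quat R -> \bar R) (D : set (plane R))
    (F : plane R -> quat R) : usc_on Omega u ->
  (forall z, D z -> {for z, continuous F}) -> (forall z, D z -> Omega (F z)) ->
  usc_on D (u \o F).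
Proof.
move=> [uy uu] cF FO; split=> [z Dz|z Dz a uza]; first exact/uy/FO.
have H : \forall w \near z, Omega (F w) -> (u (F w) < a%:E)%E.
  exact: (cF z Dz _ (uu _ (FO _ Dz) a uza)).
by apply: filterS H => w + /FO.
Qed.

(** Compactness is used with a single parameter d, serving as the radius and, through its inverse,
    as the upper bound for u. *)
Lemma tube_exists (Omega : set (quat R)) (u : quat R -> \bar R) (D : set (plane R))
    (F : plane R -> quat R) c (r : R) : open Omega -> usc_on Omega u ->
  (forall z, D z -> {for z, continuous F}) -> (forall z, D z -> Omega (F z)) ->
  closed_disc c r `<=` D ->
  exists delta C0 : R, [/\ 0 < delta, 0 <= C0 & forall z x, closed_disc c r z ->
    `|x - F z| <= delta -> Omega x /\ (u x <= C0%:E)%E].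
Proof.
move=> oO [uy uu] cF FO KD.
have K := (compact_near_coveringP _).1 (compact_closed_disc (c := c) (r := r)).
have : \forall d \near (0 : R)^'+, closed_disc c r `<=`
    (fun z => forall x, `|x - F z| <= d -> Omega x /\ (u x <= (d^-1)%:E)%E).
  apply: K => z /KD Dz; have Oz := FO _ Dz.
  have [a a0 uza] : exists2 a : R, 0 < a & (u (F z) < a%:E)%E.
    have := uy _ Oz; case: (u (F z)) => [y| |]// _.
      by exists (`|y| + 1); [rewrite ltr_wpDl|rewrite lte_fin (le_lt_trans (ler_norm y))// ltrDl].
    by exists 1; [exact: ltr01|exact: ltNyr].
  have : \forall x \near F z, Omega x /\ (u x < a%:E)%E.
    near=> x; have Ox : Omega x by near: x; exact: (open_near oO Oz).
    split=> //; have : Omega x -> (u x < a%:E)%E by near: x; exact: (uu _ Oz a uza).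
    exact.
  move=> /nbhs_normP[rho /= rho0 Hrho].
  have cFz := cF z Dz.
  have rho2 : 0 < rho / 2 by rewrite divr_gt0.
  near=> z' d => x xz'.
  have z'z : `|F z - F z'| < rho / 2 by near: z'; exact: (cvgr_dist_lt _ _ cFz).
  have d0 : 0 < d by near: d; exact: nbhs_right_gt.
  have dr : d < rho / 2 by near: d; exact: nbhs_right_lt.
  have da : d < a^-1 by near: d; apply: nbhs_right_lt; rewrite invr_gt0.
  have [|Ox ux] := Hrho x.
    rewrite /= (_ : F z - x = (F z - F z') - (x - F z')); last by rewrite opprB addrA subrK.
    by rewrite (le_lt_trans (ler_normB _ _))// (splitr rho) ltrD// (le_lt_trans xz').
  split=> //; rewrite (le_trans (ltW ux))// lee_fin -[a]invrK lef_pV2 ?posrE ?invr_gt0//.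
  exact: ltW.
move=> H; near (0 : R)^'+ => d.
have d0 : 0 < d by near: d; exact: nbhs_right_gt.
exists d, d^-1; split; [exact: d0|by rewrite invr_ge0 ltW|].
have Hd : closed_disc c r `<=`
    (fun z => forall x, `|x - F z| <= d -> Omega x /\ (u x <= (d^-1)%:E)%E).
  by near: d; exact: H.
by move=> z x zK; exact: Hd.
Unshelve. all: by end_near. Qed.

Section Tube.
Variables (Omega : set (quat R)) (u : quat R -> \bar R) (I : quat R)
  (D : set (plane R)) (F : plane R -> quat R) (c : plane R) (r delta C0 : R).
Hypotheses (II : imag_units I) (uI : plurisubharmonic_on I Omega u)
  (uO : usc_on Omega u)
  (oD : open D) (FC : C1_on D F) (FO : forall z, D z -> Omega (F z))
  (Fd : forall z, D z -> 'D_(dirE R 1) F z = qmul I ('D_(dirE R 0) F z))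
  (KD : closed_disc c r `<=` D) (delta0 : 0 < delta)
  (FX : forall z x, closed_disc c r z -> `|x - F z| <= delta ->
     Omega x /\ (u x <= C0%:E)%E)
  (C00 : 0 <= C0) (r0 : 0 < r).
Local Notation W := (supconv u F c r delta).

(** Near F z semicontinuity keeps u below b; at distance at least rho the penalty is at least n
    rho^2, which eventually exceeds C0 - b. *)
Lemma supconv_eventually_lt z (a : R) : closed_disc c r z -> (u (F z) < a%:E)%E ->
  \forall n \near \oo, W n z < a.
Proof.
move=> zK /ereal_lt_between[b uzb ba].
have [_ uu] := uO; have Oz := FO (KD zK).
have := uu _ Oz b uzb => /nbhs_normP[rho /= rho0 Hrho].
have rho2 : 0 < rho ^+ 2 by rewrite exprn_gt0.
near=> n.
have n1 : 1 <= n%:R :> R by near: n; exact: nbhs_infty_ger.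
have nb : - b <= n%:R by near: n; exact: nbhs_infty_ger.
have nr : (C0 - b) / rho ^+ 2 <= n%:R by near: n; exact: nbhs_infty_ger.
rewrite (le_lt_trans _ ba)//; apply: (supconv_le delta0 FX C00) => x Xx.
have := norm_sq_le_dotq (x - F z); rewrite /penalized; set q := dotq _ _ => q1.
have q0 : 0 <= q by rewrite (le_trans _ q1)// sqr_ge0.
have N0 : 0 <= n%:R ^+ 2 :> R by rewrite sqr_ge0.
have [xz|xz] := ltP `|x - F z| rho.
  have Ox : Omega x by have [z' z'K xz'] := Xx; have [] := FX z'K xz'.
  have ux : (u x < b%:E)%E by apply: Hrho; rewrite //= distrC.
  have tb : trunc_below u n x <= b.
    by rewrite -lee_fin (trunc_belowE FX n Xx) ge_max (ltW ux)/= lee_fin lerNl.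
  by rewrite (le_trans _ tb)// lerBlDr lerDl mulr_ge0.
have tC := trunc_below_le FX C00 n Xx.
have qr : rho ^+ 2 <= q by rewrite (le_trans _ q1)// ler_sqr ?nnegrE// ltW.
have h1 : C0 - b <= n%:R * rho ^+ 2 by rewrite -ler_pdivrMr.
have h2 : n%:R * rho ^+ 2 <= n%:R ^+ 2 * q.
  have n0 : 0 <= n%:R :> R by exact: le_trans n1.
  have nn : n%:R <= n%:R ^+ 2 :> R by rewrite expr2 ler_peMr.
  exact: (ler_pM n0 (ltW rho2) nn qr).
by move: (trunc_below u n x) tC h1 h2 => T; lra.
Unshelve. all: by end_near. Qed.

Lemma supconv_global_submean : \forall n \near \oo,
  W n c <= avg (fun t => W n (circle c r (0 + t))).
Proof.
pose k := (delta / 2) ^+ 2.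
have k0 : 0 < k by rewrite exprn_gt0// divr_gt0.
near=> n.
have n1 : 1 <= n%:R :> R by near: n; exact: nbhs_infty_ger.
(* With n >= 1 and C0 >= 0 this gives n^2 k >= n (C0 + 3) >= C0 + 3 n > C0 + n + 1. *)
have nk : (C0 + 3) / k <= n%:R by near: n; exact: nbhs_infty_ger.
have nbig : C0 + n%:R + 1 < n%:R ^+ 2 * (delta / 2) ^+ 2.
  rewrite -/k; move: nk; rewrite ler_pdivrMr// => nk.
  have h : n%:R * (C0 + 3) <= n%:R ^+ 2 * k.
    by rewrite expr2 -mulrA ler_wpM2l// (le_trans _ n1).
  have h' : C0 <= n%:R * C0 by rewrite ler_peMl.
  by move: h; rewrite mulrDr; move: n1 h'; lra.
apply: (@global_submean R c r (W n) r0) => [z zK|z zr e e0].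
  have H := supconv_continuous oD FC KD delta0 FX C00; exact: (H n _ zK).
exact: (supconv_local_submean II uI oD FC Fd KD delta0 FX C00 nbig zr e0).
Unshelve. all: by end_near. Qed.

(** Subtracting from C0 produces the nonnegative nondecreasing sequences of the monotone convergence
    theorem. The shift by N skips the indices for which the sub-mean inequality is not known. *)
Lemma supconv_lim (N : nat) z : closed_disc c r z ->
  limn (fun n => (C0 - W (N + n)%N z)%:E) = (C0%:E - u (F z))%E.
Proof.
move=> zK.
have nd : nondecreasing_seq (fun n => (C0 - W (N + n)%N z)%:E).
  move=> m n mn; rewrite lee_fin lerD2l lerN2.
  by apply: (supconv_decr delta0 FX C00); rewrite leq_add2l.
rewrite (cvg_lim _ (ereal_nondecreasing_cvgn nd))//.
apply/eqP; rewrite eq_le; apply/andP; split.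
  apply: ge_ereal_sup => _ [n _ <-]; rewrite EFinB; apply: leeB => //.
  exact: (supconv_ge_u delta0 FX C00 _ zK).
rewrite leNgt; apply/negP => lt.
have [S S1 S2] : exists2 S : R, (ereal_sup (range (fun n => (C0 - W (N + n)%N z)%:E)) <= S%:E)%E &
    (S%:E < C0%:E - u (F z))%E.
  move: lt; case: (ereal_sup _) (ereal_sup_ubound (imageT (fun n => (C0 - W (N + n)%N z)%:E) 0%N)) => [S| |].
  - by move=> _ H; exists S.
  - by move=> _; rewrite ltNge leey.
  - by rewrite leeNy_eq.
have uS : (u (F z) < (C0 - S)%:E)%E.
  have := (proj1 uO) _ (FO (KD zK)); move: S2.
  case: (u (F z)) => [y| |]//; last by move=> _ _; exact: ltNyr.
  by rewrite -EFinB !lte_fin; lra.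
have [M _ HM] := supconv_eventually_lt zK uS.
have := HM (N + M)%N (leq_addl _ _).
have : ((C0 - W (N + M)%N z)%:E <= S%:E)%E.
  by apply: le_trans S1; apply: ereal_sup_ubound; exists M.
rewrite lee_fin => h1 h2; have h3 : W (N + M)%N z < C0 - S := h2.
by move: h1 h3; set w := W _ _; lra.
Qed.

Lemma submean_composition :
  (u (F c) <= ((2 * pi)^-1)%:E * \int[mu]_(t in `[0%R, (2 * pi)%R]) u (F (circle c r t)))%E.
Proof.
have [N _ HN] := supconv_global_submean.
have cK : closed_disc c r c by exact: disc_center.
have onK t : closed_disc c r (circle c r t) by exact: circle_in_disc.
pose v n t := W (N + n)%N (circle c r (0 + t)).
have cv n : continuous (v n).
  apply: (@continuous_circle_comp R (W (N + n)%N)) => t.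
  have H := supconv_continuous oD FC KD delta0 FX C00; exact: (H _ _ (onK _)).
have ucv n : (u (F c) <= (avg (v n))%:E)%E.
  apply: le_trans (supconv_ge_u delta0 FX C00 (N + n)%N cK) _.
  by rewrite lee_fin; apply: HN; exact: leq_addr.
have uFc := (proj1 uO) _ (FO (KD cK)).
have p0 := @twopi_gt0 R.
(* The value -oo at the centre is trivial and +oo is excluded; a real value y bounds all the means
   from below. *)
move: ucv uFc; case uE : (u (F c)) => [y| |] ucv // _; last exact: leNye.
have cC (k : R) : continuous (fun _ : R => k) by move=> t; exact: cst_continuous.
pose U t := u (F (circle c r t)).
have usc_uF : usc_on D (u \o F).
  by apply: usc_comp uO _ FO => z; exact: C1_on_continuous.
have mU : measurable_fun setT U.
  by apply: (usc_circle_measurable usc_uF) => t; apply/KD/onK.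
pose G t := (C0%:E - U t)%E.
have mI : measurable (`[0, 2 * pi]%classic : set R) by exact: measurable_itv.
have mU' : measurable_fun `[0, 2 * pi] U by apply: measurable_funS mU.
have mG : measurable_fun `[0, 2 * pi] G.
  by apply: emeasurable_funB => //; exact: measurable_cst.
have UC t : (U t <= C0%:E)%E.
  by have [] := FX (onK t) (_ : `|F (circle c r t) - F (circle c r t)| <= delta);
    rewrite // subrr normr0 ltW.
have G0 t : (0 <= G t)%E.
  by have := UC t; rewrite /G; case: (U t) => [w| |]//=; rewrite ?leey// -EFinB !lee_fin subr_ge0.
pose f n t := (C0 - v n t)%:E.
have mf n : measurable_fun `[0, 2 * pi] (f n).
  have cf : continuous (fun t => C0 - v n t) by move=> t; apply: cvgB; [exact: cC|exact: cv].
  by have /integrableP[] := continuous_integrable 0 (2 * pi) cf.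
have f0 n t : `[0, 2 * pi]%classic t -> (0 <= f n t)%E.
  move=> _; rewrite lee_fin subr_ge0.
  by apply: (supconv_le delta0 FX C00) => x; exact: (penalized_le FX C00).
have ndf t : `[0, 2 * pi]%classic t -> nondecreasing_seq (f^~ t).
  move=> _ m n mn; rewrite lee_fin lerD2l lerN2.
  by apply: (supconv_decr delta0 FX C00); rewrite leq_add2l.
have limf t : limn (f^~ t) = G t.
  by rewrite (supconv_lim N (onK (0 + t))) /G /U add0r.
have mc := monotone_convergence mu mI mf f0 ndf.
have intf n : (\int[mu]_(t in `[0%R, (2 * pi)%R]) f n t <= (2 * pi * (C0 - y))%:E)%E.
  have cf : continuous (fun t => C0 - v n t) by move=> t; apply: cvgB; [exact: cC|exact: cv].
  have := EFin_avg cf; rewrite avgB; [|exact: cC|exact: cv].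
  rewrite avg_cst => E.
  have : (((2 * pi)^-1)%:E * \int[mu]_(t in `[0%R, (2 * pi)%R]) f n t <= (C0 - y)%:E)%E.
    by rewrite -E lee_fin lerD2l lerN2 -lee_fin; exact: ucv.
  by rewrite lee_pdivrMl// EFinM.
have intG : (\int[mu]_(t in `[0%R, (2 * pi)%R]) G t <= (2 * pi * (C0 - y))%:E)%E.
  have -> : (\int[mu]_(t in `[0%R, (2 * pi)%R]) G t = \int[mu]_(t in `[0%R, (2 * pi)%R]) limn (f^~ t))%E.
    by apply: eq_integral => t _; rewrite limf.
  rewrite mc; apply: lime_le; last by apply: nearW.
  apply: ereal_nondecreasing_is_cvgn => m n mn.
  exact: (ge0_le_integral mu mI (f0 m) (mf m) (mf n) (fun t tI => ndf t tI _ _ mn)).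
(* The bound from y makes C0 - u integrable on the circle, which allows the integral of u to be
   recovered by subtraction. *)
have iG : mu.-integrable `[0, 2 * pi] G.
  apply/integrableP; split => //.
  have -> : (\int[mu]_(t in `[0%R, (2 * pi)%R]) `|G t| = \int[mu]_(t in `[0%R, (2 * pi)%R]) G t)%E.
    by apply: eq_integral => t _; rewrite gee0_abs.
  by rewrite (le_lt_trans intG)// ltry.
have iC : mu.-integrable `[0, 2 * pi] (fun=> C0%:E) by exact: (continuous_integrable 0 (2 * pi) (cC C0)).
have UE t : U t = (C0%:E - G t)%E.
  have := UC t; rewrite /G; case: (U t) => [w| |]//= _.
  by rewrite -!EFinB subKr.
have -> : (\int[mu]_(t in `[0%R, (2 * pi)%R]) u (F (circle c r t)) = \int[mu]_(t in `[0%R, (2 * pi)%R]) C0%:E - \int[mu]_(t in `[0%R, (2 * pi)%R]) G t)%E.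
  rewrite -integralB//.
  by apply: eq_integral => t _; exact: UE.
have fG : (\int[mu]_(t in `[0%R, (2 * pi)%R]) G t)%E \is a fin_num by exact: integrable_fin_num.
have EC : (\int[mu]_(t in `[0%R, (2 * pi)%R]) C0%:E = (2 * pi * C0)%:E)%E.
  rewrite integral_cst//= lebesgue_measure_itv/= lte_fin p0 -EFinB subr0.
  by rewrite -EFinM mulrC.
rewrite lee_pdivlMl// EC -(fineK fG) -EFinB -EFinM lee_fin.
by move: intG; rewrite -[X in (X <= _)%E](fineK fG) lee_fin; set g := fine _; lra.
Qed.

End Tube.

Lemma psh_comp_subharmonic (Omega : set (quat R)) (u : quat R -> \bar R) (I : quat R)
  (D : set (plane R)) (F : plane R -> quat R) :
  open Omega -> imag_units I -> plurisubharmonic_on I Omega u -> open D -> C1_on D F ->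
  (forall z, D z -> Omega (F z)) ->
  (forall z, D z -> 'D_(dirE R 1) F z = qmul I ('D_(dirE R 0) F z)) ->
  subharmonic_on D (u \o F).
Proof.
move=> oO II uI oD FC FO Fd; have [uO _] := uI.
have cF z : D z -> {for z, continuous F} by exact: C1_on_continuous.
split; first exact: usc_comp uO cF FO.
move=> c r r0 KD; have [delta [C0 [delta0 C00 FX]]] := tube_exists oO uO cF FO KD.
exact: (submean_composition II uI uO oD FC FO Fd KD delta0 FX C00 r0).
Qed.

Lemma strongly_subharmonic_regular (Omega O' : set (quat R)) (u : quat R -> \bar R) f :
  open Omega -> strongly_subharmonic Omega u -> open O' ->
  (forall q, O' q -> Omega (f q)) -> regular O' f -> weakly_subharmonic O' (u \o f).
Proof.
move=> oO su oO' fO rf I II; have [fC _] := rf I II.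
apply: (psh_comp_subharmonic oO II (su I II) (open_slice oO') fC) => z Dz.
  exact: fO.
exact: (regular_partials rf II Dz).
Qed.

End Limit.

Theorem theorem5p3 (R : realType) (Omega : set (quat R)) (u : quat R -> \bar R)
    (hOmega : domain Omega) (hu : us Omega u) :
  (strongly_subharmonic Omega u <->
     forall (Omega' : set (quat R)) (f : quat R -> quat R),
       domain Omega' -> (forall q, Omega' q -> Omega (f q)) ->
       regular Omega' f -> weakly_subharmonic Omega' (u \o f))
  /\
  (strongly_harmonic Omega u <->
     forall (Omega' : set (quat R)) (f : quat R -> quat R),
       domain Omega' -> (forall q, Omega' q -> Omega (f q)) ->
       regular Omega' f -> weakly_harmonic Omega' (u \o f)).
Proof.
have [_ oO _] := hOmega; split; last exact: strongly_harmonic_regular_iff.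
split; last exact: regular_strongly_subharmonic.
by move=> su O' f [_ oO' _]; exact: strongly_subharmonic_regular.
Qed.
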